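(* There exist absolute constants $c>0$ and $d_0$ such that for every $d\ge d_0$ and all sufficiently large $T$ (depending on $d$), the following hold. (1) Let $\mathcal K_d=\mathrm{conv}(\mathbf{\Delta}_d\cup\{d^{-3/4}\mathbf 1_d\})\subseteq\mathbb R^d$ and $s=\lfloor\sqrt d\rfloor$. There exists an online convex optimization instance over $\mathcal K_d$ with $s$-sparse loss functions and horizon $T$ for which $$\min\{\mathbb E[\mathrm{regret}_{\mathrm{euc}}(T)],\ \mathbb E[\mathrm{regret}_d(T)]\}\ \ge\ c\,\frac{d^{1/4}}{\ln d}\ \mathbb E[\mathrm{regret}_s(T)].$$ That is, online mirror descent with the mirror map corresponding to the $s$-th random block norm, normalized by the radius $\rho_s(\mathcal K_d)$, improves the regret by a factor $\Omega(d^{1/4}/\ln d)$ over the best of online projected gradient descent and $\mathrm{OMD}_d$ with standard step sizes. (2) Let $s=\lfloor\ln d\rfloor$. There exists an online convex optimization instance over the probability simplex $\mathbf{\Delta}_d$ with $s$-sparse loss functions and horizon $T$ for which $$\min\{\mathbb E[\mathrm{regret}_{\mathrm{euc}}(T)],\ \mathbb E[\mathrm{regret}_{\mathrm{ent}}(T)]\}\ \ge\ c\,\frac{\sqrt{\ln d}}{\ln\ln d}\ \mathbb E[\mathrm{regret}_{\lfloor\ln d\rfloor}(T)].$$ That is, online mirror descent with the $\lfloor\ln d\rfloor$-th random block norm improves the regret by a factor $\Omega(\sqrt{\ln d}/\ln\ln d)$ over the best of online projected gradient descent and online exponentiated gradient with standard step sizes.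
   Context: Notation: $[d]=\{1,\dots,d\}$, $\mathbf{\Delta}_d=\{x\in\mathbb R^d:x\ge0,\sum_ix_i=1\}$. OCO instance. An instance over a compact convex set $\mathcal K\subseteq\mathbb R^d$ with horizon $T$ consists of a starting point $x^{(1)}\in\mathcal K$ and a (possibly random) sequence of convex losses $f^{(1)},\dots,f^{(T)}$, fixed in advance independently of the player (oblivious adversary). An algorithm plays $x^{(t)}\in\mathcal K$ and then sees $f^{(t)}$; its regret is $\sum_{t}f^{(t)}(x^{(t)})-\min_{x\in\mathcal K}\sum_tf^{(t)}(x)$. A loss $f$ is $s$-sparse if $\nabla f(x)\in[-1,1]^d$ for all $x\in\mathcal K$ and there is a set $C_f\subseteq[d]$, $|C_f|\le s$, with $\nabla_if(x)=0$ for all $x\in\mathcal K$, $i\notin C_f$. Expectations are over the random losses and, for random block norms, the random partition (independent of the losses). Online mirror descent (OMD) with mirror map $h$ and step size $\eta$: $x^{(t+1)}=\arg\min_{x\in\mathcal K}\langle\nabla f^{(t)}(x^{(t)}),x\rangle+\frac1\eta B_h(x\|x^{(t)})$, where $B_h(x\|y)=h(x)-h(y)-\langle\nabla h(y),x-y\rangle$. Block norms. For a partition $\mathcal B=\{B_1,\dots,B_n\}$ of $[d]$ into nonempty blocks, $\|x\|_{[\mathcal B]}=\sum_{j}\|x_{B_j}\|_2$ ($x_{B_j}$ is the restriction of $x$ to $B_j$), with dual norm $\|g\|^*_{[\mathcal B]}=\max_j\|g_{B_j}\|_2$. It is equal-size if block sizes differ by at most $1$. Put $(\gamma_1,p_1)=(1,2)$,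 $(\gamma_2,p_2)=(\tfrac12,2)$, and $\gamma_n=\frac1{e\ln n}$, $p_n=1+\frac1{\ln n}$ for $n\ge3$; $h_{\mathcal B}(x)=\frac1{\gamma_np_n}\sum_j\|x_{B_j}\|_2^{p_n}$ and $h_{\mathcal B,\rho}(x)=\rho^2h_{\mathcal B}(x/\rho)$. Let $\rho_n(\mathcal K)=\max_{\mathcal B}\sup_{x\in\mathcal K}\|x\|_{[\mathcal B]}$ over equal-size $n$-partitions $\mathcal B$. With $\mathcal B$ uniformly random among equal-size $n$-partitions, let $D_n=\big(\mathbb E_{\mathcal B}[\max_{z\in\mathcal K}B_{h_{\mathcal B,\rho_n(\mathcal K)}}(z\|x^{(1)})]\big)^{1/2}$ and $G_n(s)=\sup\{(\mathbb E_{\mathcal B}[(\|c\|^*_{[\mathcal B]})^2])^{1/2}:c\in[-1,1]^d,|\mathrm{supp}(c)|\le s\}$. Algorithms. $\mathrm{OMD}_n$ (regret denoted $\mathrm{regret}_n$): draw $\mathcal B$ uniformly at random once before the first round, independently of the losses, and run OMD with mirror map $h_{\mathcal B,\rho_n(\mathcal K)}$ and standard step size $\eta=D_n/(G_n(s)\sqrt T)$. For $n=1$ this is online projected gradient descent (mirror map $\frac12\|x\|_2^2$, $G_1(s)=\sqrt s$), whose regret is $\mathrm{regret}_{\mathrm{euc}}$. Online exponentiated gradient on $\mathbf{\Delta}_d$ (regret $\mathrm{regret}_{\mathrm{ent}}$) is OMD with $h_{\mathrm{ent}}(x)=\sum_ix_i\ln x_i$ and standard step size $\eta=D_{\mathrm{ent}}/(G_{\mathrm{ent}}\sqrt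 T)$, where $D_{\mathrm{ent}}=\sqrt{\max_{z\in\mathbf{\Delta}_d}B_{h_{\mathrm{ent}}}(z\|x^{(1)})}$ and $G_{\mathrm{ent}}=\max_t\sup_x\|\nabla f^{(t)}(x)\|_\infty$. *)

(* Defs.v *)
From HB Require Import structures.
From mathcomp Require Export all_boot all_order all_algebra.
From mathcomp Require Export all_classical all_reals all_analysis.
Export Order.TTheory GRing.Theory Num.Theory.
Export numFieldNormedType.Exports.

Set Implicit Arguments.
Unset Strict Implicit.
Unset Printing Implicit Defensive.

#[global] Open Scope classical_set_scope.
#[global] Open Scope ring_scope.

Section Gradients.
Context {R : realType} {d : nat}.
Implicit Types (x y z u v : 'rV[R]_d) (h f : 'rV[R]_d -> R).

Definition dot u v : R := \sum_(i < d) u 0 i * v 0 i.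

(* The vector of partial derivatives: it is the gradient wherever the function
   is differentiable and has no meaning elsewhere. *)
Definition grad f x : 'rV[R]_d := \row_i 'D_(delta_mx 0 i) (f : _ -> R^o) x.

Definition bregman h x y : R := h x - h y - dot (grad h y) (x - y).

Definition simplex : set 'rV[R]_d :=
  [set x | (forall i, 0 <= x 0 i) /\ \sum_i x 0 i = 1].

Definition conv_hull (A : set 'rV[R]_d) : set 'rV[R]_d :=
  smallest (@convex_set R 'rV[R]_d) A.

(* [ln] vanishes at 0, so the convention 0 ln 0 = 0 holds.  The gradient of
   [h_ent], hence [bregman h_ent x y], is only meaningful when y > 0. *)
Definition h_ent x : R := \sum_i x 0 i * ln (x 0 i).

End Gradients.

Arguments simplex : clear implicits.

Section Losses.
Context {R : realType} {d : nat}.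
Implicit Types (K : set 'rV[R]_d).

(* Losses are total functions, so that all d partial derivatives make sense
   even when K has empty interior; convexity is only asked for on K. *)
Definition sparse_loss K (s : nat) (f : 'rV[R]_d -> R) : Prop :=
  (forall x i, K x -> -1 <= grad f x 0 i <= 1) /\
  exists2 C : {set 'I_d}, (#|C| <= s)%N &
    forall x i, K x -> i \notin C -> grad f x 0 i = 0.

(* Rounds are numbered from 0: [loss t] is the (t+1)-st loss, and only the
   rounds t < T matter.  The adversary is oblivious because a loss depends on
   nothing but the sample point. *)
Record oco_instance K (T : nat) := OCOInstance {
  disp : measure_display;
  Omega : measurableType disp;
  law : probability Omega R;
  start : 'rV[R]_d;
  loss : nat -> Omega -> 'rV[R]_d -> R;
  start_in : K start;
  loss_convex : forall t w, (t < T)%N ->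
    convex_function (K : set (convex_lmodType 'rV[R]_d)) (loss t w : _ -> R^o);
  loss_differentiable : forall t w x, (t < T)%N -> K x ->
    differentiable (loss t w : _ -> R^o) x;
  loss_measurable : forall t x, (t < T)%N -> K x ->
    measurable_fun setT (fun w => loss t w x)
}.

End Losses.

Arguments law {R d K T} _.
Arguments start {R d K T} _.
Arguments loss {R d K T} _ t w x.

Section MirrorDescent.
Context {R : realType} {d : nat}.
Variables (K : set 'rV[R]_d) (h : 'rV[R]_d -> R) (eta : R).
Implicit Types (x y z g : 'rV[R]_d) (f : nat -> 'rV[R]_d -> R).

Definition omd_obj g y x : R := dot g x + eta^-1 * bregman h x y.

Definition omd_argmin g y : set 'rV[R]_d :=
  [set x | K x /\ forall z, K z -> omd_obj g y x <= omd_obj g y z].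

(* [xget] picks an element of the set of minimizers; its first argument is
   only returned when that set is empty. *)
Fixpoint omd f (x1 : 'rV[R]_d) (t : nat) : 'rV[R]_d :=
  if t is t'.+1 then
    let y := omd f x1 t' in xget y (omd_argmin (grad (f t') y) y)
  else x1.

(* The infimum is a minimum: K is compact in all uses below. *)
Definition omd_regret (T : nat) f (x1 : 'rV[R]_d) : R :=
  \sum_(t < T) f t (omd f x1 t) - inf [set \sum_(t < T) f t x | x in K].

End MirrorDescent.

Section BlockNorms.
Context {R : realType} {d : nat}.
Implicit Types (P : {set {set 'I_d}}) (B : {set 'I_d}) (x z c : 'rV[R]_d)
  (K : set 'rV[R]_d) (n s : nat).

Definition l2_on B x : R := Num.sqrt (\sum_(i in B) x 0 i ^+ 2).

Definition block_norm P x : R := \sum_(B in P) l2_on B x.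

Definition block_dual_norm P x : R := \big[Num.max/0]_(B in P) l2_on B x.

(* [finset.partition] already excludes empty blocks. *)
Definition eqparts n : {set {set {set 'I_d}}} :=
  [set P : {set {set 'I_d}} |
    [&& finset.partition P [set: 'I_d], #|P| == n &
        [forall A in P, forall B in P, (#|A| <= #|B|.+1)%N]]]%SET.

(* Expectation over a uniformly random equal-size n-partition. *)
Definition avg_eqparts n (F : {set {set 'I_d}} -> R) : R :=
  (\sum_(P in eqparts n) F P) / #|eqparts n|%:R.

Definition gamma n : R :=
  if (n <= 1)%N then 1 else if n == 2 then 2^-1 else (expR 1 * ln n%:R)^-1.

Definition pexp n : R := if (n <= 2)%N then 2 else 1 + (ln n%:R)^-1.

Definition h_block P x : R :=
  (gamma #|P| * pexp #|P|)^-1 * \sum_(B in P) l2_on B x `^ pexp #|P|.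

Definition h_block_scaled P (rho : R) x : R :=
  rho ^+ 2 * h_block P (rho^-1 *: x).

Definition radius n K : R :=
  \big[Num.max/0]_(P in eqparts n) sup [set block_norm P x | x in K].

Definition block_mirror n K P : 'rV[R]_d -> R := h_block_scaled P (radius n K).

Definition diam_block n K (x1 : 'rV[R]_d) : R :=
  Num.sqrt (avg_eqparts n (fun P =>
    sup [set bregman (block_mirror n K P) z x1 | z in K])).

Definition grad_bound_block n s : R :=
  sup [set Num.sqrt (avg_eqparts n (fun P => block_dual_norm P c ^+ 2)) | c in
       [set c : 'rV[R]_d | (forall i, -1 <= c 0 i <= 1) /\
                           (#|[pred i | (c 0 i != 0)%R]| <= s)%N]].

End BlockNorms.

Section ExpectedRegrets.
Context {R : realType} {d : nat} {K : set 'rV[R]_d} {T : nat}.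
Implicit Types (I : oco_instance K T) (n s : nat).

Definition sparse_losses s I : Prop :=
  forall t w, (t < T)%N -> sparse_loss K s (loss I t w).

Definition block_step n s I : R :=
  diam_block n K (start I) / (@grad_bound_block R d n s * Num.sqrt T%:R).

(* Regret for a fixed partition and a fixed realization of the losses. *)
Definition regret_block n s I (P : {set {set 'I_d}}) (w : Omega I) : R :=
  omd_regret K (block_mirror n K P) (block_step n s I) T
    (fun t => loss I t w) (start I).

(* The partition is independent of the losses, so the expectation over both is
   the expectation over the losses of the average over the partitions. *)
Definition E_regret_block n s I : \bar R :=
  'E_(law I)[fun w => avg_eqparts n (fun P => regret_block n s P w)]%E.

Definition integrable_regret_block n s I : Prop :=
  forall P, P \in @eqparts d n ->
    (law I).-integrable setT (EFin \o @regret_block n s I P).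

(* Projected gradient descent: the only 1-partition is {[d]}, for which
   the mirror map is |x|_2^2 / 2 whatever the radius. *)
Definition E_regret_euc s I : \bar R := E_regret_block 1 s I.

Definition integrable_regret_euc s I : Prop := integrable_regret_block 1 s I.

Definition diam_ent I : R :=
  Num.sqrt (sup [set bregman h_ent z (start I) | z in K]).

(* Taken for each realization of the losses.  The norm of ['rV[R]_d] is the
   l_infinity norm. *)
Definition grad_bound_ent I (w : Omega I) : R :=
  \big[Num.max/0]_(t < T) sup [set `|grad (loss I t w) x| | x in K].

Definition regret_ent I (w : Omega I) : R :=
  omd_regret K h_ent (diam_ent I / (grad_bound_ent w * Num.sqrt T%:R)) T
    (fun t => loss I t w) (start I).

Definition E_regret_ent I : \bar R := 'E_(law I)[@regret_ent I]%E.

Definition integrable_regret_ent I : Prop :=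
  (law I).-integrable setT (EFin \o @regret_ent I).

End ExpectedRegrets.

Definition K_mix (R : realType) (d : nat) : set 'rV[R]_d :=
  conv_hull (simplex R d `|` [set const_mx (d%:R `^ (- (3 / 4)))]).

Arguments K_mix : clear implicits.

(* Main.v *)
From HB Require Import structures.
From mathcomp Require Import perm.
Require Import Defs.
From mathcomp Require Import ring lra zify.

(** Both instances are deterministic, with linear losses that each involve one
    coordinate.  Over the simplex the loss is [- x_0] in every round and the
    start is uniform.  [K_mix] is the hull of the simplex and of the spike, the
    constant vector of coordinate sum rho = d^(1/4); there the start puts mass
    1/2 on coordinate 0 and spreads the rest evenly, and the losses are
    [- x_1, ..., - x_(d-1)] in cyclic order for about sqrt T / 400 cycles, and
    zero afterwards.

    Upper bound.  The three-point inequality telescopes ([omd_telescope]): the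
    regret is at most D^2 / eta = D G sqrt T plus the stability sum of
    <g_t, x_t - x_(t+1)> ([block_regret_avg_le]).  For the constant loss the
    stability sum is a difference of coordinates; for the cyclic losses it has
    O_d(sqrt T) nonzero terms, each O_d(1 / sqrt T) by strong convexity of the
    mirror map ([mirror_bregman_ge]).  Either way it is bounded independently
    of T, so D G is what counts.  Here D^2 <= 2 radius^2 / gamma
    ([mirror_bregman_le]), the radius of the spiked simplex is at most 2 for
    n <= sqrt d because the norm of the spike is about sqrt n / rho
    ([spike_block_norm_le]), and G^2 = O(ln n) for s <= n: a random partition
    puts O(ln n) elements of an s-set into its fullest block, by an exponential
    moment estimate in which the elements are added one at a time
    ([load_weight_le], [grad_bound_le]).  The regret is thus O(ln s sqrt T).

    Lower bounds over the simplex.  Projected gradient descent has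
    G >= sqrt s, so steps of order 1 / sqrt (s T), and needs sqrt (s T) / 16
    rounds before half of the mass is at coordinate 0
    ([simplex_euc_regret_ge]).  Exponentiated gradient has steps at most
    sqrt (ln d / T) and is explicit ([entropic_omd]): the weight of
    coordinate 0 after t rounds is at most e^(eta t) / d, so at most 1/2
    for sqrt (T ln d) / 2 rounds ([vertex_ent_regret_ge]).  With s of order ln d
    both regrets have order sqrt (T ln d), against ln ln d sqrt T.

    Lower bounds over [K_mix].  The spike gains nearly rho in each cycle.
    Projected gradient descent, with G >= sqrt s and s of order rho^2, makes
    steps of order 1 / (rho sqrt T): the telescoped inequality with the start
    as comparator shows that it keeps mass 1/4 on coordinate 0 throughout
    ([spiked_euc_regret_ge]), which costs rho / 10 per cycle ([tail_gap]).
    With singleton blocks the iterates are explicit, as every step acts on one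
    coordinate and remains inside the domain ([coordinatewise_trajectory]).
    Each visit multiplies a coordinate by at most e^(27 ln d / sqrt T)
    ([growth_exponent_le]), all visits together by at most
    d^(27/400) <= rho / 2, which costs rho / 4 per cycle
    ([coordinatewise_regret_ge]).  Both regrets have order rho sqrt T, against
    ln d sqrt T. *)

Set Implicit Arguments.
Unset Strict Implicit.
Unset Printing Implicit Defensive.

(** * Strong convexity of powers *)

(** Young's inequality for [t `^ q] and 1 with the exponents 1/q and
    1/(1-q). *)
Lemma powR_bernoulli (R : realType) (t q : R) :
  0 <= t -> 0 <= q <= 1 -> t `^ q <= 1 + q * (t - 1).
Proof.
move=> t0 /andP[q0 q1].
have [->|qn0] := eqVneq q 0; first by rewrite powRr0 mul0r addr0.
have [->|qn1] := eqVneq q 1; first by rewrite powRr1 // mul1r; lra.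
have {}q0 : 0 < q by rewrite lt0r qn0.
have {}q1 : q < 1 by rewrite lt_neqAle qn1.
have := @conjugate_powR R (t `^ q) 1 q^-1 (1 - q)^-1 (powR_ge0 _ _) ler01.
rewrite !invr_gt0 !invrK subr_gt0 q0 q1 => /(_ isT isT).
rewrite -powRrM divff ?gt_eqF// powRr1// powR1 mulr1.
by move=> /(_ ltac:(ring)); lra.
Qed.

(** The right side is the Bregman divergence of the power 1 + q in one variable.
    By homogeneity only the ratio of the smaller to the larger of a and b
    matters, and Bernoulli's inequality for that ratio, with exponent q or
    1 - q, gives the bound with max(a, b) in place of M; since q <= 1, the
    power [M `^ (q - 1)] decreases in M. *)
Lemma powR_bregman_ge (R : realType) (q a b M : R) :
  0 < q <= 1 -> 0 < M -> 0 <= a <= M -> 0 <= b <= M ->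
  q ^+ 2 * M `^ (q - 1) * (a - b) ^+ 2 <=
  a `^ (1 + q) + q * b `^ (1 + q) - (1 + q) * a * b `^ q.
Proof.
move=> /andP[q0 q1] M0 /andP[a0 aM] /andP[b0 bM].
have pD (x : R) : 0 <= x -> x `^ (1 + q) = x * x `^ q.
  move=> x0; have [->|xn0] := eqVneq x 0.
    by rewrite mul0r powR0// gt_eqF//; lra.
  by rewrite powRD ?xn0 ?implybT// powRr1.
have Mle (x : R) : 0 < x -> x <= M -> M `^ (q - 1) * x <= x `^ q.
  move=> x0 xM; have -> : x `^ q = x `^ (q - 1) * x.
    by rewrite -[X in _ = _ * X]powRr1 ?ltW// -powRD ?subrK// gt_eqF//= implybT.
  apply: ler_wpM2r; first exact: ltW.
  rewrite -(opprB 1 q) !powRN lef_pV2 ?posrE ?powR_gt0//.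
  by apply: ge0_ler_powR; rewrite ?nnegrE; lra.
rewrite !pD//.
have [ba|/ltW ab] := lerP b a.
- have [a00|an0] := eqVneq a 0.
    have b00 : b = 0 by apply/le_anti; rewrite b0 -a00 ba.
    by rewrite a00 b00; nra.
  have {}a0 : 0 < a by rewrite lt0r an0.
  pose t := b / a.
  have t0 : 0 <= t by rewrite divr_ge0// ltW.
  have t1 : t <= 1 by rewrite ler_pdivrMr// mul1r.
  have -> : b = t * a by rewrite /t divfK.
  rewrite powRM ?(ltW a0)//.
  have := powR_bernoulli t0 (introT andP (conj (ltW q0) q1)).
  have := Mle a a0 aM.
  have := powR_ge0 t q; have := powR_ge0 a q.
  have := powR_ge0 M (q - 1).
  move: (t `^ q) (a `^ q) (M `^ _) => x y z z0 y0 x0 zy xt.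
  have H1 : z * a * (q * (t - 1)) ^+ 2 * a <= y * (q * (t - 1)) ^+ 2 * a.
    by apply: ler_wpM2r; [lra|apply: ler_wpM2r => //; exact: sqr_ge0].
  have H2 : (1 + q - q * t) * x <= (1 + q - q * t) * (1 + q * (t - 1)).
    by apply: ler_wpM2l => //; nra.
  have H3 := ler_wpM2l (mulr_ge0 y0 (ltW a0)) H2.
  nra.
- have [b00|bn0] := eqVneq b 0.
    have a00 : a = 0 by apply/le_anti; rewrite a0 -b00 ab.
    by rewrite a00 b00; nra.
  have {}b0 : 0 < b by rewrite lt0r bn0.
  pose t := a / b.
  have t0 : 0 <= t by rewrite divr_ge0// ltW.
  have t1 : t <= 1 by rewrite ler_pdivrMr// mul1r.
  have -> : a = t * b by rewrite /t divfK.
  rewrite powRM ?(ltW b0)//.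
  have q1' : 0 <= 1 - q <= 1 by lra.
  have := powR_bernoulli t0 q1'.
  have : t `^ (1 - q) * t `^ q = t.
    have [->|tn0] := eqVneq t 0; first by rewrite (@powR0 _ q) ?mulr0// gt_eqF.
    by rewrite -powRD ?subrK ?tn0 ?implybT// powRr1.
  have := Mle b b0 bM.
  have := powR_ge0 t q; have := powR_ge0 b q.
  have := powR_ge0 M (q - 1).
  move: (t `^ q) (t `^ (1 - q)) (b `^ q) (M `^ _) => x x' y z z0 y0 x0 zy xx x't.
  pose D := q + (1 - q) * t.
  have D0 : 0 < D by rewrite /D; nra.
  have D1 : D <= 1 by rewrite /D; nra.
  (* Bernoulli with exponent 1 - q bounds t^(1-q) by D, hence t^q >= t / D. *)
  have H0 : t * x * D >= t ^+ 2.
    have x'D : x' <= D by rewrite /D; lra.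
    by have := ler_wpM2l (mulr_ge0 t0 x0) x'D; nra.
  have H1 : z * b * (q * (t - 1)) ^+ 2 * b <= y * (q * (t - 1)) ^+ 2 * b.
    by apply: ler_wpM2r; [lra|apply: ler_wpM2r => //; exact: sqr_ge0].
  have H2 : t * x - 1 - (1 + q) * (t - 1) >= (q * (t - 1)) ^+ 2.
    have : (t * x - 1 - (1 + q) * (t - 1)) * D >= (q * (t - 1)) ^+ 2.
      by move: H0; rewrite /D; nra.
    move=> H; have : 0 <= (t * x - 1 - (1 + q) * (t - 1)).
      by rewrite -(pmulr_lge0 _ D0); apply: le_trans H; exact: sqr_ge0.
    nra.
  have H3 := ler_wpM2l (mulr_ge0 y0 (ltW b0)) H2.
  nra.
Qed.

(** * Geometry of block norms *)

Section BlockGeometry.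
Context {R : realType} {d : nat}.
Implicit Types (P : {set {set 'I_d}}) (B : {set 'I_d}) (x z v : 'rV[R]_d).

Definition dot_on B x z : R := \sum_(i in B) x 0 i * z 0 i.

Lemma l2_on_ge0 B x : 0 <= l2_on B x.
Proof. exact: sqrtr_ge0. Qed.

Lemma l2_onE B x : l2_on B x ^+ 2 = dot_on B x x.
Proof. by rewrite sqr_sqrtr// sumr_ge0// => i _; exact: sqr_ge0. Qed.

Lemma l2_on_eq0 B x i : l2_on B x = 0 -> i \in B -> x 0 i = 0.
Proof.
move=> x0 iB; have := l2_onE B x; rewrite x0 expr0n/= => /esym/eqP.
rewrite /dot_on psumr_eq0 => [/allP/(_ i)|j _]; last by rewrite -expr2 sqr_ge0.
by rewrite mem_index_enum iB mulf_eq0 orbb => /(_ isT)/eqP.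
Qed.

Lemma dot_on_cauchy B x z : dot_on B z x <= l2_on B z * l2_on B x.
Proof.
have [x0|xn0] := eqVneq (l2_on B x) 0.
  rewrite x0 mulr0 /dot_on big1// => i iB.
  by rewrite (l2_on_eq0 x0 iB) mulr0.
have [z0|zn0] := eqVneq (l2_on B z) 0.
  rewrite z0 mul0r /dot_on big1// => i iB.
  by rewrite (l2_on_eq0 z0 iB) mul0r.
set a := l2_on B z; set b := l2_on B x.
have ab0 : 0 < a * b by rewrite mulr_gt0 ?lt0r ?xn0 ?zn0 ?l2_on_ge0.
have : 0 <= \sum_(i in B) (b * z 0 i - a * x 0 i) ^+ 2.
  by apply: sumr_ge0 => i _; exact: sqr_ge0.
have -> : \sum_(i in B) (b * z 0 i - a * x 0 i) ^+ 2 =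
  b ^+ 2 * dot_on B z z + a ^+ 2 * dot_on B x x - 2 * a * b * dot_on B z x.
  rewrite /dot_on !mulr_sumr -big_split/= -sumrB; apply: eq_bigr => i _; ring.
by rewrite -!l2_onE -/a -/b; nra.
Qed.

Lemma l2_on_le (B : {set 'I_d}) x (M : R) :
  0 <= M -> (l2_on B x <= M) = (dot_on B x x <= M ^+ 2).
Proof. by move=> M0; rewrite -l2_onE ler_sqr// nnegrE ?l2_on_ge0. Qed.

Lemma l2_onD B x z : l2_on B (x + z) <= l2_on B x + l2_on B z.
Proof.
rewrite l2_on_le ?addr_ge0 ?l2_on_ge0//.
have -> : dot_on B (x + z) (x + z) =
    dot_on B x x + dot_on B z z + 2 * dot_on B x z.
  rewrite /dot_on mulr_sumr -!big_split/=; apply: eq_bigr => i _.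
  by rewrite !mxE; ring.
by have := dot_on_cauchy B z x; rewrite -!l2_onE; nra.
Qed.

Lemma l2_onZ B (c : R) x : 0 <= c -> l2_on B (c *: x) = c * l2_on B x.
Proof.
move=> c0; rewrite /l2_on -[X in X * _](ger0_norm c0) -sqrtr_sqr.
rewrite -sqrtrM ?sqr_ge0// mulr_sumr.
by congr Num.sqrt; apply: eq_bigr => i _; rewrite mxE exprMn.
Qed.

Lemma block_normD P x z : block_norm P (x + z) <= block_norm P x + block_norm P z.
Proof. by rewrite -big_split ler_sum// => B _; exact: l2_onD. Qed.

Lemma block_normZ P (c : R) x :
  0 <= c -> block_norm P (c *: x) = c * block_norm P x.
Proof. by move=> c0; rewrite mulr_sumr; apply: eq_bigr => B _; exact: l2_onZ. Qed.

Lemma block_norm_ge0 P x : 0 <= block_norm P x.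
Proof. by rewrite sumr_ge0// => B _; exact: l2_on_ge0. Qed.

Lemma l2_on_le_block_norm P B x : B \in P -> l2_on B x <= block_norm P x.
Proof.
move=> BP; rewrite /block_norm (bigD1 B)//= lerDl sumr_ge0// => C _.
exact: l2_on_ge0.
Qed.

Lemma dot_partition P x z : finset.partition P [set: 'I_d]%SET ->
  dot x z = \sum_(B in P) dot_on B x z.
Proof.
move=> hP; rewrite -(set_partition_big _ hP)/=; apply: eq_bigl => i.
by rewrite inE.
Qed.

(** The gradient of the sum of the p-th powers of the block norms, divided by
    p. *)
Definition block_grad P (p : R) x : 'rV[R]_d :=
  \row_i (l2_on (finset.pblock P i) x `^ (p - 2) * x 0 i).

Lemma block_grad_dot P p x z : finset.partition P [set: 'I_d]%SET ->
  dot (block_grad P p x) z =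
  \sum_(B in P) l2_on B x `^ (p - 2) * dot_on B z x.
Proof.
move=> hP; rewrite (dot_partition _ _ hP); apply: eq_bigr => B BP.
rewrite /dot_on mulr_sumr; apply: eq_bigr => i iB.
have /and3P[_ tP _] := hP.
by rewrite !mxE (finset.def_pblock tP BP iB); ring.
Qed.

(** Two contributions to |z - x|^2 on the block: (|z| - |x|)^2, which is the
    one-variable case, and twice the Cauchy-Schwarz defect |z| |x| - <z, x>,
    which the divergence counts with the factor (1 + q) |x|^(q-1), at least
    2 q^2 M^(q-1). *)
Lemma l2_on_bregman_ge B (q M : R) x z : 0 < q <= 1 -> 0 < M ->
  l2_on B x <= M -> l2_on B z <= M ->
  q ^+ 2 * M `^ (q - 1) * dot_on B (z - x) (z - x) <=
  l2_on B z `^ (1 + q) - l2_on B x `^ (1 + q)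
    - (1 + q) * (l2_on B x `^ (q - 1) * dot_on B (z - x) x).
Proof.
move=> q01 M0 xM zM; have /andP[q0 q1] := q01.
have -> : dot_on B (z - x) x = dot_on B z x - l2_on B x ^+ 2.
  by rewrite l2_onE /dot_on -sumrB; apply: eq_bigr => i _; rewrite !mxE; ring.
have -> : dot_on B (z - x) (z - x) =
    (l2_on B z - l2_on B x) ^+ 2 + 2 * (l2_on B z * l2_on B x - dot_on B z x).
  transitivity (dot_on B z z + dot_on B x x - 2 * dot_on B z x).
    rewrite /dot_on mulr_sumr -big_split -sumrB/=; apply: eq_bigr => i _.
    by rewrite !mxE; ring.
  by rewrite -!l2_onE; ring.
have zx := dot_on_cauchy B x z.
have a0 := l2_on_ge0 B z; have b0 := l2_on_ge0 B x.
have := @powR_bregman_ge _ q _ _ _ q01 M0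
  (introT andP (conj a0 zM)) (introT andP (conj b0 xM)).
have [b00|bn0] := eqVneq (l2_on B x) 0.
  have -> : dot_on B z x = 0.
    by rewrite /dot_on big1// => i iB; rewrite (l2_on_eq0 b00 iB) mulr0.
  rewrite b00 (@powR0 _ q) ?gt_eqF// (@powR0 _ (1 + q)); last by rewrite gt_eqF//; lra.
  by rewrite expr0n/= !(mulr0, subr0, addr0).
have {}b0 : 0 < l2_on B x by rewrite lt0r bn0.
move: zx xM b0; move: (dot_on B z x) (l2_on B z) (l2_on B x) => c a b zx xM b0.
have bq : b `^ q = b `^ (q - 1) * b.
  by rewrite -[X in _ = _ * X]powRr1 ?ltW// -powRD ?subrK// gt_eqF//= implybT.
have bp : b `^ (1 + q) = b * b `^ q.
  by rewrite powRD ?powRr1 ?ltW// (gt_eqF b0) implybT.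
have Mb : M `^ (q - 1) <= b `^ (q - 1).
  rewrite -(opprB 1 q) !powRN lef_pV2 ?posrE ?powR_gt0//.
  by apply: ge0_ler_powR; rewrite ?nnegrE; lra.
have M0' := powR_ge0 M (q - 1).
rewrite bp bq; move: (b `^ (q - 1)) (M `^ _) Mb M0' => y m my m0 H.
have q2 : 2 * q ^+ 2 <= 1 + q by nra.
have h1 : 2 * q ^+ 2 * (m * (a * b - c)) <= (1 + q) * (y * (a * b - c)).
  apply: ler_pM => //; [nra|nra|].
  by apply: ler_wpM2r => //; lra.
by move: H h1; lra.
Qed.

Lemma block_power_bregman_ge P (q M : R) x z :
  finset.partition P [set: 'I_d]%SET -> 0 < q <= 1 -> 0 < M ->
  (forall B, B \in P -> l2_on B x <= M) -> (forall B, B \in P -> l2_on B z <= M) ->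
  q ^+ 2 * M `^ (q - 1) * dot (z - x) (z - x) <=
  \sum_(B in P) l2_on B z `^ (1 + q) - \sum_(B in P) l2_on B x `^ (1 + q)
    - (1 + q) * dot (block_grad P (1 + q) x) (z - x).
Proof.
move=> hP q01 M0 xM zM.
rewrite block_grad_dot// (dot_partition _ _ hP) !mulr_sumr -!sumrB.
apply: ler_sum => B BP.
have -> : 1 + q - 2 = q - 1 by ring.
by apply: l2_on_bregman_ge; [exact: q01|exact: M0|exact: xM|exact: zM].
Qed.

End BlockGeometry.

(** * Gradients of convex functions *)

Section Calculus.
Context {R : realType} {d : nat}.
Implicit Types (x y z g v : 'rV[R]_d) (h : 'rV[R]_d -> R).

Lemma dotDr g x y : dot g (x + y) = dot g x + dot g y.
Proof. by rewrite -big_split; apply: eq_bigr => i _; rewrite mxE mulrDr. Qed.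

Lemma dotZr g (c : R) x : dot g (c *: x) = c * dot g x.
Proof. by rewrite mulr_sumr; apply: eq_bigr => i _; rewrite mxE mulrCA. Qed.

Lemma dotNr g x : dot g (- x) = - dot g x.
Proof. by rewrite -scaleN1r dotZr mulN1r. Qed.

Lemma dotBr g x y : dot g (x - y) = dot g x - dot g y.
Proof. by rewrite dotDr dotNr. Qed.

Lemma dotC x y : dot x y = dot y x.
Proof. by apply: eq_bigr => i _; rewrite mulrC. Qed.

Lemma dotDl g x y : dot (x + y) g = dot x g + dot y g.
Proof. by rewrite !(dotC _ g) dotDr. Qed.

Lemma dotZl g (c : R) x : dot (c *: x) g = c * dot x g.
Proof. by rewrite !(dotC _ g) dotZr. Qed.

Lemma dotBl g x y : dot (x - y) g = dot x g - dot y g.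
Proof. by rewrite !(dotC _ g) dotBr. Qed.

Lemma dot_delta x i : dot x (delta_mx 0 i) = x 0 i.
Proof.
rewrite /dot (bigD1 i)//= mxE !eqxx mulr1 big1 ?addr0// => j ji.
by rewrite mxE eqxx (negbTE ji) mulr0.
Qed.

Lemma dot_ge0 x : 0 <= dot x x.
Proof. by apply: sumr_ge0 => i _; rewrite -expr2 sqr_ge0. Qed.

Lemma sqr_coord_le_dot x i : x 0 i ^+ 2 <= dot x x.
Proof.
rewrite /dot (bigD1 i)//= expr2 lerDl sumr_ge0// => j _.
by rewrite -expr2 sqr_ge0.
Qed.

Lemma dot_eq0 x : dot x x <= 0 -> x = 0.
Proof.
move=> x0; apply/rowP => i; rewrite mxE.
have := le_trans (sqr_coord_le_dot x i) x0.
by rewrite le_eqVlt ltNge sqr_ge0 orbF sqrf_eq0 => /eqP.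
Qed.

Lemma coord_cts i : continuous (fun x : 'rV[R]_d => x 0 i).
Proof. exact: coord_continuous. Qed.

Lemma sum_cts (I : Type) (r : seq I) (P : pred I) (F : I -> 'rV[R]_d -> R) :
  (forall i, P i -> continuous (F i)) ->
  continuous (fun x => \sum_(i <- r | P i) F i x).
Proof.
move=> Fc; apply: (@continuous_big R I +%R 0 P _ _ r F) => //.
exact: add_continuous.
Qed.

Lemma dot_continuous g : continuous (dot g).
Proof.
apply: sum_cts => i _ x.
apply: (@continuousM _ _ (fun=> g 0 i) (fun y : 'rV[R]_d => y 0 i)).
  exact: cst_continuous.
exact: coord_cts.
Qed.

(** A continuous selection of subgradients is the gradient: the difference
    quotient along a coordinate lies between the values of that coordinate of G
    at the two end points.  This gives the gradients of the mirror maps without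
    differentiating a norm at 0. *)
Lemma grad_of_subgradient h (G : 'rV[R]_d -> 'rV[R]_d) (U : set 'rV[R]_d) x :
  nbhs x U ->
  (forall y z, U y -> U z -> dot (G y) (z - y) <= h z - h y) ->
  (forall i, {for x, continuous (fun y => G y 0 i)}) -> grad h x = G x.
Proof.
move=> nU hG cG; apply/rowP => i; rewrite mxE.
apply/cvg_lim => //=.
have c0 : t *: (delta_mx 0 i : 'rV[R]_d) + x @[t --> (0 : R)^'] --> x.
  apply: (@cvg_trans _ (t *: (delta_mx 0 i : 'rV[R]_d) + x @[t --> (0 : R)])).
    by move=> A /= nA; apply: nbhs_dnbhs.
  suff : t *: (delta_mx 0 i : 'rV[R]_d) + x @[t --> (0 : R)] -->
    (0 : R) *: (delta_mx 0 i : 'rV[R]_d) + x by rewrite scale0r add0r.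
  apply: (@continuousD _ _ _ (fun t : R => t *: (delta_mx 0 i : 'rV[R]_d)) (fun=> x)).
    exact: scalel_continuous.
  exact: cst_continuous.
have cGt : G (t *: (delta_mx 0 i : 'rV[R]_d) + x) 0 i @[t --> (0 : R)^']
    --> G x 0 i by apply: cvg_comp c0 (cG i).
apply/cvgrPdist_le => e e0; near=> t.
have tn0 : t != 0 by near: t; exact: nbhs_dnbhs_neq.
have Ut : U (t *: delta_mx 0 i + x) by near: t; exact: (c0 U nU).
have Ge : `|G x 0 i - G (t *: delta_mx 0 i + x) 0 i| <= e.
  by near: t; move/cvgrPdist_le : cGt => /(_ e e0).
have h1 := hG _ _ (nbhs_singleton nU) Ut.
have h2 := hG _ _ Ut (nbhs_singleton nU).
move: h1 h2; rewrite addrK opprD addrCA subrr addr0 dotNr !dotZr !dot_delta.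
rewrite /shift/=; move: Ge; set a := G x 0 i; set b := G _ 0 i.
set u := h _ - _ => Ge h1 h2.
rewrite /GRing.scale/=.
have -> : a - t^-1 * u = t^-1 * (t * a - u) by field.
have h3 : `|t * a - u| <= `|t| * `|a - b|.
  rewrite -normrM ler_norml; move: h2.
  rewrite -(opprB (h _)) -/u lerN2 => h2.
  have hle : t * (a - b) <= 0 by nra.
  by rewrite (ler0_norm hle); apply/andP; split; nra.
rewrite normrM normfV ler_pdivrMl ?normr_gt0//.
by apply: (le_trans h3); rewrite ler_wpM2l.
Unshelve. all: by end_near. Qed.

Lemma grad_dot g x : grad (dot g) x = g.
Proof.
apply: (@grad_of_subgradient _ (fun=> g) setT x filterT).
- by move=> y z _ _; rewrite dotBr.
- by move=> i; exact: cst_continuous.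
Qed.

End Calculus.

Section BlockCalculus.
Context {R : realType} {d : nat}.
Implicit Types (P : {set {set 'I_d}}) (B : {set 'I_d}) (x z : 'rV[R]_d).

(** Without the absolute value there is a jump at 0: powers of negative numbers
    take the value 1. *)
Lemma powR_norm_continuous (q : R) : 0 < q -> continuous (fun t : R => `|t| `^ q).
Proof.
move=> q0 t; have [->|tn0] := eqVneq t 0.
  rewrite /continuous_at normr0 powR0 ?gt_eqF//.
  apply/cvgr0Pnorm_le => e e0; near=> u.
  rewrite ger0_norm ?powR_ge0// -[leRHS](powRr1 (ltW e0)).
  have qn0 : q != 0 by rewrite gt_eqF.
  rewrite -(mulVf qn0) powRrM.
  apply: ge0_ler_powR; rewrite ?nnegrE ?powR_ge0//; first exact: ltW.
  by near: u; apply: (@nbhs0_le R R^o); rewrite powR_gt0.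
refine (@continuous_comp R R R (fun u => `|u|) (fun u => u `^ q) t _ _).
  exact: (@norm_continuous R R^o).
apply: differentiable_continuous; apply/derivable1_diffP.
by apply: derivable_powR; rewrite in_itv/= normr_gt0 tn0.
Unshelve. all: by end_near. Qed.

Lemma l2_on_continuous B : continuous (@l2_on R d B).
Proof.
move=> x; refine (@continuous_comp _ R R
  (fun x : 'rV[R]_d => \sum_(i in B) x 0 i ^+ 2) (@Num.sqrt R) x _ _).
  apply: sum_cts => i _ y.
  by apply: (@continuousM _ _ (fun y : 'rV[R]_d => y 0 i)); exact: coord_cts.
exact: sqrt_continuous.
Qed.

(** Where a block vanishes the factor |x_B|^(q-1) may be unbounded, but together
    with |x_i| <= |x_B| it is at most |x_B|^q. *)
Lemma block_grad_continuous P (q : R) i : finset.partition P [set: 'I_d]%SET ->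
  0 < q -> continuous (fun x => block_grad P (1 + q) x 0 i).
Proof.
move=> hP q0 x; rewrite /continuous_at !mxE.
set B := finset.pblock P i.
have -> : (fun y : 'rV[R]_d => block_grad P (1 + q) y 0 i) =
    (fun y => l2_on B y `^ (q - 1) * y 0 i).
  by apply/funext => y; rewrite mxE; congr (_ `^ _ * _); ring.
have -> : 1 + q - 2 = q - 1 by ring.
have [x0|xn0] := eqVneq (l2_on B x) 0; last first.
  apply: (@continuousM _ _ (fun y : 'rV[R]_d => l2_on B y `^ (q - 1))); last exact: coord_cts.
  refine (@continuous_comp _ R R (@l2_on R d B) (fun t => t `^ (q - 1)) x _ _).
    exact: l2_on_continuous.
  apply: differentiable_continuous; apply/derivable1_diffP.
  by apply: derivable_powR; rewrite in_itv/= andbT lt0r xn0 l2_on_ge0.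
have iB : i \in B.
  by rewrite /B mem_pblock (cover_partition hP) inE.
rewrite (l2_on_eq0 x0 iB) mulr0.
have cq : `|l2_on B y| `^ q @[y --> x] --> 0.
  have : {for x, continuous (fun y => `|l2_on B y| `^ q)}.
    refine (@continuous_comp _ R R (@l2_on R d B) (fun t => `|t| `^ q) x _ _).
      exact: l2_on_continuous.
    exact: powR_norm_continuous.
  by rewrite /prop_for /continuous_at x0 normr0 powR0 ?gt_eqF.
have FF : Filter (nbhs x) := nbhs_filter x.
apply/(@cvgr0Pnorm_le _ R^o _ _ FF) => e e0.
move/(@cvgr0Pnorm_le _ R^o _ _ FF) : cq => /(_ e e0); apply: (@filterS _ _ FF) => y.
apply: le_trans; rewrite (ger0_norm (l2_on_ge0 B y)) normrM.
rewrite !(ger0_norm (powR_ge0 _ _)).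
have [y0|yn0] := eqVneq (l2_on B y) 0.
  by rewrite (l2_on_eq0 y0 iB) normr0 mulr0 powR_ge0.
have y0 : 0 < l2_on B y by rewrite lt0r yn0 l2_on_ge0.
have -> : l2_on B y `^ q = l2_on B y `^ (q - 1) * l2_on B y.
  by rewrite -[X in _ = _ * X]powRr1 ?ltW// -powRD ?subrK// gt_eqF//= implybT.
rewrite ler_wpM2l ?powR_ge0// -(ler_sqr (normr_ge0 _) (ltW y0)).
rewrite real_normK ?num_real// l2_onE /dot_on (bigD1 i)//= expr2 lerDl sumr_ge0// => j _.
by rewrite -expr2 sqr_ge0.
Qed.

End BlockCalculus.

(** * The block mirror map *)

Section BlockMirror.
Context {R : realType} {d : nat}.
Implicit Types (P : {set {set 'I_d}}) (B : {set 'I_d}) (x z : 'rV[R]_d).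

Lemma expR1_le3 : expR 1 <= 3 :> R.
Proof.
have h : 5 / 6 <= expR (- 6^-1) :> R.
  by have := expR_ge1Dx (- 6^-1 : R); lra.
have h6 : expR (- 6^-1) ^+ 6 = (expR 1)^-1 :> R.
  by rewrite -expRM_natl -expRN; congr expR; field.
have : (5 / 6) ^+ 6 <= expR (- 6^-1) ^+ 6 :> R.
  by apply: lerXn2r => //; rewrite nnegrE ?expR_ge0//; lra.
rewrite h6 -[_ <= 3]lef_pV2 ?posrE ?expR_gt0// => h'.
by apply: le_trans h'; lra.
Qed.

Lemma ln_ge1 (n : nat) : (3 <= n)%N -> 1 <= ln n%:R :> R.
Proof.
move=> n3; rewrite -[leLHS]expRK ler_ln ?posrE ?expR_gt0 ?ltr0n//; last first.
  exact: leq_trans n3.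
by apply: le_trans expR1_le3 _; rewrite ler_nat.
Qed.

Lemma gamma_gt0 n : 0 < gamma n :> R.
Proof.
rewrite /gamma; case: ifPn => // n1; case: ifPn => // n2.
rewrite invr_gt0 mulr_gt0 ?expR_gt0// ln_gt0// ltr1n ltnNge.
exact: n1.
Qed.

Lemma gammaV_le n : (3 <= n)%N -> (gamma n)^-1 <= 3 * ln n%:R :> R.
Proof.
move=> n3; rewrite /gamma ifF; last by lia.
rewrite ifF; last by lia.
by rewrite invrK ler_wpM2r ?expR1_le3// (le_trans ler01)// ln_ge1.
Qed.

Lemma pexpB1_itv n : 0 < (pexp n - 1 : R) <= 1.
Proof.
rewrite /pexp; case: ifPn => n2; first by lra.
have l1 : 1 <= ln n%:R :> R by apply: ln_ge1; rewrite ltnNge.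
rewrite addrAC subrr add0r invr_gt0 invf_le1 ?l1 ?andbT;
  by rewrite (lt_le_trans ltr01).
Qed.

Lemma pexp_gt1 n : 1 < pexp n :> R.
Proof. by have := pexpB1_itv n; lra. Qed.

Definition mirror_grad P (rho : R) x : 'rV[R]_d :=
  (rho / gamma #|P|) *: block_grad P (pexp #|P|) (rho^-1 *: x).

Variables (P : {set {set 'I_d}}) (rho : R).
Hypotheses (hP : finset.partition P [set: 'I_d]%SET) (rho0 : 0 < rho).
Local Notation g := (gamma #|P| : R).
Local Notation p := (pexp #|P| : R).
Local Notation h := (h_block_scaled P rho).

Let rhoV_ge0 : 0 <= rho^-1. Proof. by rewrite invr_ge0 ltW. Qed.

Definition mirror_modulus : R := (p - 1) ^+ 2 / (g * p).

Lemma mirror_modulus_gt0 : 0 < mirror_modulus.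
Proof.
have := pexpB1_itv #|P|; have := gamma_gt0 #|P|; rewrite /mirror_modulus.
move=> g0 /andP[q0 _]; rewrite divr_gt0 ?exprn_gt0// mulr_gt0//.
exact: lt_trans (pexp_gt1 _).
Qed.

(** The estimate for powers at the rescaled points x / rho and z / rho. *)
Lemma mirror_subgradient_ge (M : R) x z : 0 < M ->
  (forall B, B \in P -> l2_on B x <= rho * M) ->
  (forall B, B \in P -> l2_on B z <= rho * M) ->
  mirror_modulus * M `^ (p - 2) * dot (z - x) (z - x) <=
  h z - h x - dot (mirror_grad P rho x) (z - x).
Proof.
move=> M0 xM zM.
have Zle y B : l2_on B y <= rho * M -> l2_on B (rho^-1 *: y) <= M.
  by move=> yM; rewrite l2_onZ ?rhoV_ge0// ler_pdivrMl.
have := @block_power_bregman_ge R d P (p - 1) M (rho^-1 *: x) (rho^-1 *: z) hP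
  (pexpB1_itv _) M0 (fun B BP => Zle _ _ (xM B BP)) (fun B BP => Zle _ _ (zM B BP)).
rewrite (_ : 1 + (p - 1) = p); last by ring.
rewrite -scalerBr !dotZr !dotZl.
rewrite (_ : p - 1 - 1 = p - 2); last by ring.
rewrite /h_block_scaled /h_block /mirror_modulus.
have g0 := gamma_gt0 #|P|; have p1 := pexp_gt1 #|P|.
move: (\sum_(B in P) _) (\sum_(B in P) _) (dot (block_grad _ _ _) _).
move: (dot _ _) => D S1 S2 E.
have gp0 : 0 < g * p by rewrite mulr_gt0//; lra.
move=> H; have := ler_wpM2l (ltW (divr_gt0 (exprn_gt0 2 rho0) gp0)) H.
move: (M `^ _) => m.
set L := (X in X <= _ -> _); set U := (X in _ <= X -> _).
have -> : L = (p - 1) ^+ 2 / (g * p) * m * D.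
  by rewrite /L; field; rewrite !gt_eqF//; lra.
congr (_ <= _); rewrite /U; field.
by rewrite !gt_eqF//; lra.
Qed.

(** Every pair of points lies in a common large ball; the modulus on it is small
    but nonnegative. *)
Lemma mirror_subgradient x z :
  dot (mirror_grad P rho x) (z - x) <= h z - h x.
Proof.
pose M := (block_norm P x + block_norm P z) / rho + 1.
have M0 : 0 < M by rewrite ltr_wpDl// divr_ge0 ?addr_ge0 ?block_norm_ge0// ltW.
have rM : rho * M = block_norm P x + block_norm P z + rho.
  by rewrite /M; field; rewrite gt_eqF.
rewrite -subr_ge0; apply: le_trans (mirror_subgradient_ge M0 _ _).
- by apply: mulr_ge0 (dot_ge0 _); apply: mulr_ge0 (powR_ge0 _ _); exact/ltW/mirror_modulus_gt0.
- move=> B BP; rewrite rM; apply: le_trans (l2_on_le_block_norm x BP) _.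
  by rewrite -addrA lerDl addr_ge0 ?block_norm_ge0// ltW.
- move=> B BP; rewrite rM; apply: le_trans (l2_on_le_block_norm z BP) _.
  by rewrite addrAC lerDr addr_ge0 ?block_norm_ge0// ltW.
Qed.

Lemma mirror_grad_continuous i : continuous (fun x => mirror_grad P rho x 0 i).
Proof.
move=> x; rewrite /mirror_grad.
have -> : (fun y : 'rV[R]_d =>
    ((rho / g) *: block_grad P p (rho^-1 *: y)) 0 i) =
  (fun y => rho / g * block_grad P (1 + (p - 1)) (rho^-1 *: y) 0 i).
  by apply/funext => y; rewrite mxE (_ : 1 + (p - 1) = p)//; ring.
apply: (@continuousM _ _ (fun=> rho / g)
  (fun y : 'rV[R]_d => block_grad P (1 + (p - 1)) (rho^-1 *: y) 0 i)).
  exact: cst_continuous.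
refine (@continuous_comp _ _ R (fun y : 'rV[R]_d => rho^-1 *: y)
  (fun y => block_grad P (1 + (p - 1)) y 0 i) x _ _).
  exact: scaler_continuous.
by apply: block_grad_continuous => //; have /andP[] := pexpB1_itv #|P|.
Qed.

Lemma grad_mirror x : grad h x = mirror_grad P rho x.
Proof.
apply: (@grad_of_subgradient _ _ _ _ setT x filterT).
  by move=> y z _ _; exact: mirror_subgradient.
by move=> i; exact: mirror_grad_continuous.
Qed.

Lemma mirror_bregman_ge0 x z : 0 <= bregman h z x.
Proof. by rewrite /bregman grad_mirror subr_ge0 mirror_subgradient. Qed.

Lemma mirror_bregman_ge x z : block_norm P x <= rho -> block_norm P z <= rho ->
  mirror_modulus * dot (z - x) (z - x) <= bregman h z x.
Proof.
move=> xr zr; rewrite /bregman grad_mirror.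
have := @mirror_subgradient_ge 1 x z ltr01; rewrite powR1 !mulr1; apply.
  by move=> B BP; exact: le_trans (l2_on_le_block_norm x BP) xr.
by move=> B BP; exact: le_trans (l2_on_le_block_norm z BP) zr.
Qed.

Lemma mirror_continuous : continuous h.
Proof.
move=> x; rewrite /h_block_scaled /h_block.
refine (@continuousM R _ (fun=> rho ^+ 2) (fun y : 'rV[R]_d => (g * p)^-1 *
  \sum_(B in P) l2_on B (rho^-1 *: y) `^ p) x (@cst_continuous _ _ _ _) _).
refine (@continuousM R _ (fun=> (g * p)^-1) (fun y : 'rV[R]_d =>
  \sum_(B in P) l2_on B (rho^-1 *: y) `^ p) x (@cst_continuous _ _ _ _) _).
apply: sum_cts => B BP y.
have -> : (fun y : 'rV[R]_d => l2_on B (rho^-1 *: y) `^ p) =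
    (fun y => `|l2_on B (rho^-1 *: y)| `^ p).
  by apply/funext => u; rewrite ger0_norm// l2_on_ge0.
refine (@continuous_comp _ R R (fun y : 'rV[R]_d => l2_on B (rho^-1 *: y))
  (fun t => `|t| `^ p) y _ _).
  refine (@continuous_comp _ _ R (fun y : 'rV[R]_d => rho^-1 *: y)
    (@l2_on R d B) y _ _).
    exact: scaler_continuous.
  exact: l2_on_continuous.
by apply: powR_norm_continuous; apply: lt_trans (pexp_gt1 _).
Qed.

(** At nonnegative points h x and <grad h x, z> enter with a favourable sign.
    The remaining terms h z and <grad h x, x> are at most rho^2 / gamma each,
    because |u|^p <= |u| for the norms of the rescaled blocks. *)
Lemma mirror_bregman_le x z : (forall i, 0 <= x 0 i) -> (forall i, 0 <= z 0 i) ->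
  block_norm P x <= rho -> block_norm P z <= rho ->
  bregman h z x <= 2 * rho ^+ 2 / g.
Proof.
move=> x0 z0 xr zr.
have g0 := gamma_gt0 #|P|; have p1 := pexp_gt1 #|P|.
have gp0 : 0 < g * p by rewrite mulr_gt0//; lra.
have S1 y : block_norm P y <= rho -> \sum_(B in P) l2_on B (rho^-1 *: y) `^ p <= 1.
  move=> yr; apply: (@le_trans _ _ (\sum_(B in P) l2_on B (rho^-1 *: y))).
    apply: ler_sum => B BP.
    have [->|n0] := eqVneq (l2_on B (rho^-1 *: y)) 0.
      by rewrite powR0// gt_eqF//; lra.
    apply: ge1r_powR; last exact: ltW.
    rewrite lt0r n0 l2_on_ge0/= l2_onZ ?rhoV_ge0// ler_pdivrMl// mulr1.
    exact: le_trans (l2_on_le_block_norm y BP) yr.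
  rewrite -/(block_norm P _) block_normZ ?rhoV_ge0//.
  by rewrite ler_pdivrMl// mulr1.
have Gx0 : forall i, 0 <= mirror_grad P rho x 0 i.
  move=> i; rewrite !mxE !mulr_ge0 ?powR_ge0// ?invr_ge0 ltW//.
rewrite /bregman grad_mirror dotBr.
have h1 : 0 <= dot (mirror_grad P rho x) z.
  by apply: sumr_ge0 => i _; rewrite mulr_ge0.
have h2 : 0 <= h x.
  apply: mulr_ge0; first by rewrite exprn_ge0 ?ltW.
  apply: mulr_ge0; first by rewrite invr_ge0 ltW.
  by apply: sumr_ge0 => B _; exact: powR_ge0.
have h3 : h z <= rho ^+ 2 / g.
  rewrite /h_block_scaled /h_block ler_wpM2l ?sqr_ge0//.
  rewrite -[leRHS]mulr1; apply: ler_pM => //.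
  - by rewrite invr_ge0 ltW.
  - by apply: sumr_ge0 => B _; exact: powR_ge0.
  - by rewrite lef_pV2 ?posrE// ler_pMr// ltW.
  - exact: S1.
have h4 : dot (mirror_grad P rho x) x <= rho ^+ 2 / g.
  have -> : dot (mirror_grad P rho x) x =
      rho ^+ 2 / g * dot (block_grad P p (rho^-1 *: x)) (rho^-1 *: x).
    rewrite /mirror_grad dotZl [in RHS]dotZr; field.
    by rewrite !gt_eqF.
  have rg : 0 <= rho ^+ 2 / g by rewrite divr_ge0 ?sqr_ge0// ltW.
  rewrite -[leRHS]mulr1 ler_wpM2l// block_grad_dot//.
  apply: le_trans (S1 x xr); apply: ler_sum => B BP.
  rewrite -l2_onE; have [->|n0] := eqVneq (l2_on B (rho^-1 *: x)) 0.
    by rewrite expr0n/= mulr0 powR0 ?gt_eqF//; lra.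
  rewrite -powR_mulrn ?l2_on_ge0// -powRD ?n0 ?implybT//.
  by rewrite (_ : p - 2 + 2%:R = p)//; ring.
have -> : 2 * rho ^+ 2 / g = rho ^+ 2 / g + rho ^+ 2 / g by ring.
move: h1 h2 h3 h4; move: (dot _ z) (dot _ x) (h x) (h z) (rho ^+ 2 / g) => a b u v w.
lra.
Qed.

End BlockMirror.

(** * Mirror descent with linear losses *)

Lemma bregmanxx (R : realType) (d : nat) (h : 'rV[R]_d -> R) x : bregman h x x = 0.
Proof. by rewrite /bregman dotBr !subrr. Qed.

Section MirrorDescentTheory.
Context {R : realType} {d : nat}.
Variables (K : set 'rV[R]_d) (h : 'rV[R]_d -> R) (eta : R).
Hypotheses (eta_gt0 : 0 < eta).
Implicit Types (x y z g u v : 'rV[R]_d) (G : nat -> 'rV[R]_d).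

Let etaV_ge0 : 0 <= eta^-1. Proof. by rewrite invr_ge0 ltW. Qed.

Lemma omd_objB g y x z : omd_obj h eta g y z - omd_obj h eta g y x =
  dot (g + eta^-1 *: (grad h x - grad h y)) (z - x) + eta^-1 * bregman h z x.
Proof.
rewrite /omd_obj /bregman dotDl dotZl dotBl !dotBr; ring.
Qed.

(** The objective exceeds its value at x by a linear term plus a Bregman
    divergence.  Where the linear term vanishes on K the minimizer is x; this
    is how closed forms of the iterates are verified. *)
Lemma omd_argmin_stationary g y x : K x ->
  (forall z, K z -> dot (g + eta^-1 *: (grad h x - grad h y)) (z - x) = 0) ->
  (forall z, K z -> z != x -> 0 < bregman h z x) ->
  omd_argmin K h eta g y = [set x].
Proof.
move=> Kx sx hx; apply/seteqP; split => [z [Kz zmin]|z ->]/=; last first.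
  split=> // w Kw; rewrite -subr_ge0 omd_objB sx// add0r.
  have [->|wx] := eqVneq w x; last first.
    by rewrite mulr_ge0// ltW// hx.
  by rewrite bregmanxx mulr0.
apply/eqP; apply: contraT => zx.
have := zmin x Kx; rewrite -subr_le0 omd_objB sx// add0r.
by rewrite leNgt mulr_gt0 ?invr_gt0// hx.
Qed.

Hypotheses (Kconv : forall x z (t : R), K x -> K z -> 0 <= t <= 1 ->
                      K (x + t *: (z - x)))
           (Kcomp : compact K)
           (h_cts : continuous h)
           (grad_cts : forall i, continuous (fun x => grad h x 0 i))
           (h_ge0 : forall x z, 0 <= bregman h z x).

Lemma omd_argmin_exists g y : K y -> exists x, omd_argmin K h eta g y x.
Proof.
move=> Ky.
have cobj : continuous (omd_obj h eta g y).
  move=> x; apply: continuousD; first exact: dot_continuous.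
  apply: (@continuousM _ _ (fun=> eta^-1)); first exact: cst_continuous.
  rewrite /bregman; apply: continuousB; last first.
    have -> : (fun z => dot (grad h y) (z - y)) =
       (fun z => dot (grad h y) z - dot (grad h y) y).
      by apply/funext => z; rewrite dotBr.
    apply: continuousB; [exact: dot_continuous|exact: cst_continuous].
  by apply: continuousB; [exact: h_cts|exact: cst_continuous].
have [|c cK cmin] := EVT_min_rV (ex_intro _ y Ky) Kcomp (f := omd_obj h eta g y).
  exact: continuous_subspaceT.
exists c; split; first by rewrite inE in cK.
by move=> z Kz; apply: cmin; rewrite inE.
Qed.

(** Minimality against the points of the segment from x to z gives the
    inequality with the gradient at a point of the segment; that point tends to
    x. *)
Lemma omd_argmin_optimal g y x z : omd_argmin K h eta g y x -> K z ->
  0 <= dot (g + eta^-1 *: (grad h x - grad h y)) (z - x).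
Proof.
move=> [Kx xmin] Kz.
pose F (t : R) := dot (g + eta^-1 *: (grad h (x + t *: (z - x)) - grad h y)) (z - x).
have F0 : F 0 = dot (g + eta^-1 *: (grad h x - grad h y)) (z - x).
  by rewrite /F scale0r addr0.
have Fpos t : 0 < t <= 1 -> 0 <= F t.
  move=> /andP[t0 t1].
  have t01 : 0 <= t <= 1 by rewrite ltW.
  have := xmin _ (Kconv Kx Kz t01).
  rewrite -subr_ge0 -opprB omd_objB oppr_ge0.
  rewrite opprD addNKr.
  rewrite -scaleNr dotZr mulNr -/(F t) => H.
  have h1 : 0 <= eta^-1 * bregman h x (x + t *: (z - x)).
    exact: mulr_ge0.
  rewrite -(pmulr_rge0 _ t0); move: H h1.
  by move: (t * F t) (eta^-1 * _) => u v; lra.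
have Fc : F t @[t --> 0^'+] --> F 0.
  apply: cvg_at_right_filter.
  suff : continuous F by apply.
  have seg : continuous (fun t : R => x + t *: (z - x)).
    move=> t; apply: (@continuousD _ _ _ (fun=> x) (fun t : R => t *: (z - x))).
      exact: cst_continuous.
    exact: scalel_continuous.
  pose Fi i (w : 'rV[R]_d) : R := (g 0 i + eta^-1 * (grad h w 0 i - grad h y 0 i)) * (z - x) 0 i.
  have Fic : continuous (fun w => \sum_i Fi i w).
    apply: sum_cts => i _ w.
    refine (@continuousM R _ (fun w => g 0 i + eta^-1 * (grad h w 0 i - grad h y 0 i))
      (fun=> (z - x) 0 i) w _ (@cst_continuous _ _ _ _)).
    apply: (@continuousD _ R^o _ (fun=> g 0 i)); first exact: cst_continuous.
    apply: (@continuousM _ _ (fun=> eta^-1)); first exact: cst_continuous.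
    by apply: (@continuousB _ R^o); [exact: grad_cts|exact: cst_continuous].
  move=> t.
  have -> : F = (fun w => \sum_i Fi i w) \o (fun t => x + t *: (z - x)).
    by apply/funext => s; apply: eq_bigr => i _; rewrite /Fi !mxE.
  exact: (@continuous_comp R _ R _ _ t (seg t) (Fic _)).
rewrite -F0; apply: (cvgr_to_ge Fc); near=> t; apply: Fpos.
by apply/andP; split; near: t; [exact: nbhs_right_gt|exact: nbhs_right_le].
Unshelve. all: by end_near. Qed.

(** The optimality condition and the identity
    <grad h x - grad h y, z - x> = B(z, y) - B(z, x) - B(x, y). *)
Lemma three_point g y x z : omd_argmin K h eta g y x -> K z ->
  dot g (x - z) <= eta^-1 * (bregman h z y - bregman h z x - bregman h x y).
Proof.
move=> xmin Kz; have := omd_argmin_optimal xmin Kz.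
have -> : eta^-1 * (bregman h z y - bregman h z x - bregman h x y) =
  eta^-1 * dot (grad h x - grad h y) (z - x).
  by rewrite /bregman dotBl !dotBr; ring.
by rewrite dotDl dotZl !dotBr; lra.
Qed.

Section Iterates.
Variables (G : nat -> 'rV[R]_d) (x1 : 'rV[R]_d).
Hypothesis (Kx1 : K x1).
Local Notation X := (omd K h eta (fun t => dot (G t)) x1).

Lemma omd_iter t : K (X t) /\ omd_argmin K h eta (G t) (X t) (X t.+1).
Proof.
have step s : K (X s) -> omd_argmin K h eta (G s) (X s) (X s.+1).
  move=> Ks; have [x xmin] := omd_argmin_exists (G s) Ks.
  by rewrite /= grad_dot; apply: (xgetI (X s) xmin).
elim: t => [|t [Kt mt]]; first by split => //; exact: step.
have Kt1 : K (X t.+1) by case: mt.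
by split => //; exact: step.
Qed.

Lemma omd_in t : K (X t). Proof. by have [] := omd_iter t. Qed.

(** The last divergence is kept: with u = x1 the inequality says that the
    iterates stay near the start. *)
Lemma omd_telescope u n : K u ->
  \sum_(t < n) dot (G t) (X t.+1 - u) <=
  eta^-1 * (bregman h u x1 - bregman h u (X n)).
Proof.
move=> Ku; elim: n => [|n IH]; first by rewrite big_ord0 /= subrr mulr0.
rewrite big_ord_recr [X in X <= _]/=.
have [Kn mn] := omd_iter n.
have := three_point mn Ku; have := h_ge0 (X n) (X n.+1).
have e0 : 0 < eta^-1 by rewrite invr_gt0.
move: IH (mulr_ge0 (ltW e0) (h_ge0 (X n) (X n.+1))).
set a := \sum_(t < n) _; set b := dot _ _ => *.
lra.
Qed.

Variable kappa : R.
Hypotheses (kappa_gt0 : 0 < kappa)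
  (h_sc : forall x z, K x -> K z -> kappa * dot (z - x) (z - x) <= bregman h z x)
  (G_le1 : forall t v, dot (G t) v <= Num.sqrt (dot v v)).

(** Staying put is an alternative to the step; comparing the two gives
    kappa D^2 <= eta D for the length D of the step. *)
Lemma omd_step_le t i : `|X t.+1 0 i - X t 0 i| <= eta / kappa.
Proof.
have [Kt mt] := omd_iter t; have [Kt1 _] := omd_iter t.+1.
have := three_point mt Kt; have := h_ge0 (X t.+1) (X t).
have := h_sc Kt Kt1; have := G_le1 t (X t - X t.+1).
move: Kt1 mt Kt => _ _ _.
set y := X t.+1; set x := X t.
rewrite (bregmanxx h x).
have -> : dot (x - y) (x - y) = dot (y - x) (y - x).
  by rewrite -opprB dotNr dotC dotNr opprK.
set D := Num.sqrt _.
have D2 : dot (y - x) (y - x) = D ^+ 2 by rewrite sqr_sqrtr ?dot_ge0.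
rewrite D2 (_ : dot (G t) (y - x) = - dot (G t) (x - y)); last by rewrite -dotNr opprB.
have xy : `|y 0 i - x 0 i| <= D.
  have := sqr_coord_le_dot (y - x) i; rewrite D2 !mxE => H.
  by rewrite -(ger0_norm (sqrtr_ge0 _ : 0 <= D)) -ler_sqr ?nnegrE// !real_normK ?num_real.
move=> H1 H2 H3 H4.
apply: le_trans xy _.
rewrite ler_pdivlMr//.
have H5 : kappa * D ^+ 2 <= eta * D.
  apply: le_trans H2 _; rewrite -ler_pdivrMl//.
  have := mulr_ge0 etaV_ge0 H3.
  lra.
have [->|Dn0] := eqVneq D 0; first by rewrite mul0r ltW.
have D0 : 0 < D by rewrite lt0r Dn0 sqrtr_ge0.
by rewrite -(ler_pM2r D0); move: H5; rewrite expr2; lra.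
Qed.

Lemma omd_drift_le s t i : (s <= t)%N ->
  `|X t 0 i - X s 0 i| <= (t - s)%:R * (eta / kappa).
Proof.
elim: t => [|t IH]; first by rewrite leqn0 => /eqP ->; rewrite subrr normr0 mul0r.
rewrite leq_eqVlt => /predU1P[->|]; first by rewrite subnn subrr normr0 mul0r.
rewrite ltnS => st; have := IH st; have := omd_step_le t i.
rewrite subSn// -natr1 mulrDl mul1r => H1 H2.
apply: le_trans (lerD H2 H1).
have -> : X t.+1 0 i - X s 0 i = (X t 0 i - X s 0 i) + (X t.+1 0 i - X t 0 i) by ring.
exact: ler_normD.
Qed.

End Iterates.

Lemma omd_regret_linear T G x1 : K x1 ->
  exists2 u, K u & omd_regret K h eta T (fun t => dot (G t)) x1 =
      \sum_(t < T) dot (G t) (omd K h eta (fun t => dot (G t)) x1 t - u) /\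
    forall z, K z ->
      \sum_(t < T) dot (G t) (omd K h eta (fun t => dot (G t)) x1 t - z) <=
      omd_regret K h eta T (fun t => dot (G t)) x1.
Proof.
move=> Kx1.
have sc : continuous (fun x => \sum_(t < T) dot (G t) x).
  by apply: sum_cts => t _; exact: dot_continuous.
have [|u uK umin] := EVT_min_rV (ex_intro _ x1 Kx1) Kcomp
  (f := fun x => \sum_(t < T) dot (G t) x).
  exact: continuous_subspaceT.
rewrite inE in uK.
have E : inf [set \sum_(t < T) dot (G t) x | x in K] = \sum_(t < T) dot (G t) u.
  apply/eqP; rewrite eq_le; apply/andP; split.
    apply: ge_inf; last by exists u.
    by exists (\sum_(t < T) dot (G t) u) => _ [z Kz <-]; apply: umin; rewrite inE.
  apply: lb_le_inf; first by exists (\sum_(t < T) dot (G t) u), u.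
  by move=> _ [z Kz <-]; apply: umin; rewrite inE.
have E2 z : \sum_(t < T) dot (G t) (omd K h eta (fun t => dot (G t)) x1 t - z) =
   \sum_(t < T) dot (G t) (omd K h eta (fun t => dot (G t)) x1 t) -
   \sum_(t < T) dot (G t) z.
  by rewrite -sumrB; apply: eq_bigr => t _; rewrite dotBr.
exists u => //; rewrite /omd_regret E E2; split => // z Kz.
by rewrite E2 lerD2l lerN2; apply: umin; rewrite inE.
Qed.

End MirrorDescentTheory.

(** * Equal-size partitions *)

Section EqualParts.
Context {d : nat}.
Implicit Types (P : {set {set 'I_d}}) (B C : {set 'I_d}) (n : nat) (a : 'I_d).

Lemma eqparts_partition n P : P \in eqparts n -> finset.partition P [set: 'I_d].
Proof. by rewrite inE => /and3P[]. Qed.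

Lemma eqparts_card n P : P \in eqparts n -> #|P| = n.
Proof. by rewrite inE => /and3P[_ /eqP]. Qed.

Lemma eqparts_balanced n P B C :
  P \in eqparts n -> B \in P -> C \in P -> (#|B| <= #|C|.+1)%N.
Proof.
by rewrite inE => /and3P[_ _ /forall_inP/(_ B)] + BP CP => /(_ BP)/forall_inP/(_ C CP).
Qed.

Lemma partition_block_gt0 P B :
  finset.partition P [set: 'I_d] -> B \in P -> (0 < #|B|)%N.
Proof.
move=> /partition_neq0 hP BP; rewrite card_gt0.
exact: hP.
Qed.

(** Each of the n - 1 other blocks has at least |B| - 1 elements. *)
Lemma card_eqparts_block n P B : (0 < d)%N ->
  P \in eqparts n -> B \in P -> (n * #|B|.-1 < d)%N.
Proof.
move=> d0 Pn BP; have hP := eqparts_partition Pn.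
have := card_partition hP; rewrite cardsT card_ord => dE.
have n0 : (0 < n)%N by rewrite -(eqparts_card Pn); apply/card_gt0P; exists B.
rewrite (bigD1 B)//= in dE.
have : (\sum_(C in P | C != B) #|B|.-1 <= \sum_(C in P | C != B) #|C|)%N.
  apply: leq_sum => C /andP[CP _].
  by have := eqparts_balanced Pn BP CP; lia.
rewrite sum_nat_const.
have -> : #|[pred C | (C \in P) && (C != B)]| = n.-1.
  by rewrite -(eqparts_card Pn) (cardsD1 B P) BP/=; apply: eq_card => C; rewrite !inE andbC.
have := partition_block_gt0 hP BP.
move: dE; set S := (\sum_(_ in _ | _) _)%N => dE H1 H2.
by rewrite [X in (_ < X)%N]dE -(prednK n0) mulSn -[X in (_ < X + _)%N](prednK H1) addSn ltnS leq_add2l.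
Qed.

Lemma eqparts_full_card1 P B : P \in eqparts d -> B \in P -> #|B| = 1%N.
Proof.
move=> Pd BP; have hP := eqparts_partition Pd.
have B0 := partition_block_gt0 hP BP.
have d0 : (0 < d)%N by rewrite -(card_ord d); exact: leq_trans B0 (max_card _).
have := card_eqparts_block d0 Pd BP.
by case: #|B| B0 => [|[|k]] //= _; rewrite mulnS -[X in (_ < X)%N]addn0 ltn_add2l ltn0.
Qed.

Lemma eqparts1 P : P \in eqparts 1 -> P = [set [set: 'I_d]]%SET.
Proof.
move=> P1; have hP := eqparts_partition P1.
have /eqP/cards1P [B PB] := eqparts_card P1.
by rewrite PB -(cover_partition hP) PB /finset.cover big_set1.
Qed.

(** The residue classes modulo n. *)
Lemma eqparts_neq0 n : (0 < n <= d)%N -> (0 < #|@eqparts d n|)%N.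
Proof.
move=> /andP[n0 nd].
have d0 : (0 < d)%N by apply: leq_trans nd.
pose Bl (r : 'I_n) := [set i : 'I_d | (i %% n == r)%N]%SET.
have Bl0 r : exists i, i \in Bl r.
  have rd : (r < d)%N by apply: leq_trans nd.
  by exists (Ordinal rd); rewrite inE/= modn_small.
have Blinj : injective Bl.
  move=> r r' e; have [i ir] := Bl0 r; have := ir; rewrite e.
  by move: ir; rewrite !inE => /eqP ir /eqP ir'; apply/val_inj; rewrite /= -ir.
apply/card_gt0P; exists (Bl @: [set: 'I_n])%SET; rewrite inE; apply/and3P; split.
- apply/and3P; split.
  + apply/eqP/setP => i; rewrite !inE; apply/bigcupP.
    have im : (i %% n < n)%N by rewrite ltn_mod.
    by exists (Bl (Ordinal im)); [apply: imset_f; rewrite inE|rewrite inE].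
  + apply/finset.trivIsetP => _ _ /imsetP[r _ ->] /imsetP[r' _ ->] rr'.
    rewrite -finset.setI_eq0; apply: contraNT rr' => /finset.set0Pn[i].
    by rewrite !inE => /andP[/eqP ir /eqP ir']; apply/eqP; congr Bl; apply: val_inj; rewrite /= -ir.
  + apply/imsetP => -[r _ e]; have [i] := Bl0 r.
    by rewrite -e inE.
- by rewrite card_imset// cardsT card_ord.
apply/forall_inP => _ /imsetP[r _ ->]; apply/forall_inP => _ /imsetP[r' _ ->].
have [i0 i0r] : exists i : 'I_d, i = r :> nat.
  have rd : (r < d)%N by apply: leq_trans nd.
  by exists (Ordinal rd).
have i0B : i0 \in Bl r by rewrite inE i0r modn_small.
rewrite (cardsD1 i0) i0B add1n ltnS.
(* Lowering each element by n maps class r, without its least element, into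
   class r'. *)
pose f (i : 'I_d) : 'I_d := insubd i (i - r - n + r')%N.
have key i : i \in (Bl r :\ i0)%SET -> exists k, i = (k * n + r + n)%N :> nat.
  rewrite !inE => /andP[ii0 /eqP ir].
  have := divn_eq i n; rewrite ir; case: (i %/ n)%N => [|k] ik.
    by move: ii0; rewrite -(inj_eq val_inj)/= i0r ik mul0n add0n eqxx.
  by exists k; rewrite ik mulSn; lia.
have fE (i : 'I_d) k : i = (k * n + r + n)%N :> nat -> f i = (k * n + r')%N :> nat.
  move=> ik; rewrite /f val_insubd.
  have -> : (i - r - n + r' < d)%N by have := ltn_ord i; have := ltn_ord r'; lia.
  lia.
rewrite -(card_in_imset (f := f)); last first.
  move=> i j /key[k ik] /key[l jl] /(congr1 val)/=.
  rewrite (fE _ _ ik) (fE _ _ jl) => /addIn e.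
  by apply: val_inj => /=; rewrite ik jl e.
apply: subset_leq_card; apply/fintype.subsetP => _ /imsetP[i /key[k ik] ->].
by rewrite inE (fE _ _ ik) modnMDl modn_small.
Qed.

End EqualParts.

(** * Loads of the blocks of a random partition *)

Section BlockLoads.
Context {R : realType} {d : nat}.
Implicit Types (P : {set {set 'I_d}}) (B C : {set 'I_d}) (n : nat) (a : 'I_d).

Definition swap_blocks (a a' : 'I_d) P : {set {set 'I_d}} :=
  ((fun B : {set 'I_d} => tperm a a' @: B) @: P)%SET.

Lemma imset_tpermK a a' : involutive (fun B : {set 'I_d} => tperm a a' @: B)%SET.
Proof.
move=> B; rewrite -imset_comp -[RHS]imset_id; apply: eq_imset => i /=.
exact: tpermK.
Qed.

Lemma swap_blocksK a a' : involutive (swap_blocks a a').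
Proof.
move=> P; rewrite /swap_blocks -imset_comp -[RHS]imset_id; apply: eq_imset => B /=.
exact: imset_tpermK.
Qed.

Lemma swap_blocks_eqparts a a' n P :
  (swap_blocks a a' P \in eqparts n) = (P \in eqparts n).
Proof.
have imp Q : Q \in eqparts n -> swap_blocks a a' Q \in eqparts n.
  move=> Qn; rewrite inE; apply/and3P; split.
  - have -> : [set: 'I_d]%SET = (tperm a a' @: [set: 'I_d])%SET.
      apply/esym/eqP; rewrite eqEcard finset.subsetT/= card_imset//.
      exact: perm_inj.
    rewrite imset_partition ?(eqparts_partition Qn)//; exact: perm_inj.
  - rewrite card_imset ?(eqparts_card Qn)//; exact: inv_inj (imset_tpermK a a').
  apply/forall_inP => _ /imsetP[B BQ ->]; apply/forall_inP => _ /imsetP[B' B'Q ->].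
  rewrite !card_imset; [exact: eqparts_balanced Qn BQ B'Q|exact: perm_inj|exact: perm_inj].
by apply/idP/idP => [/imp|/imp//]; rewrite swap_blocksK.
Qed.

(** Up to the number of partitions, the expected sum over the blocks of
    e^load, where the load of B is the number of elements of C in it. *)
Definition load_weight n C : R :=
  \sum_(P in @eqparts d n) \sum_(B in P) expR (#|(C :&: B)%SET|%:R).

(** The part of the weight that is multiplied by e when a joins C. *)
Definition load_increment n C a : R :=
  \sum_(P in @eqparts d n) \sum_(B in P | a \in B) expR (#|(C :&: B)%SET|%:R).

(** Transposing a and a' permutes the equal-size partitions and fixes C. *)
Lemma load_increment_sym n C a a' : a \notin C -> a' \notin C ->
  load_increment n C a = load_increment n C a'.
Proof.
move=> aC a'C; rewrite /load_increment.
rewrite (reindex_inj (inv_inj (swap_blocksK a a')))/=.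
apply: eq_big => [P|P _]; first exact: swap_blocks_eqparts.
rewrite /swap_blocks big_mkcondr big_imset/=; last first.
  by move=> ? ? _ _; exact: (inv_inj (imset_tpermK a a')).
rewrite [RHS]big_mkcondr; apply: eq_bigr => B _.
have -> : (a \in (tperm a a' @: B)%SET) = (a' \in B).
  by rewrite -{1}(tpermR a a') mem_imset//; exact: perm_inj.
case: ifP => // _; congr (expR _%:R).
have CE : C = (tperm a a' @: C)%SET.
  rewrite -[LHS]imset_id; apply: eq_in_imset => i iC; rewrite tpermD//.
    by apply: contraNneq aC => ->.
  by apply: contraNneq a'C => ->.
rewrite {1}CE -imsetI; last by move=> ? ? _ _; exact: perm_inj.
by rewrite card_imset//; exact: perm_inj.
Qed.

Lemma load_weightU n C a : a \notin C ->
  load_weight n (a |: C)%SET = load_weight n C + (expR 1 - 1) * load_increment n C a.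
Proof.
move=> aC; rewrite /load_weight /load_increment mulr_sumr -big_split/=.
apply: eq_bigr => P _; rewrite big_mkcondr/= mulr_sumr -big_split/=.
apply: eq_bigr => B _; case: ifPn => aB; last first.
  rewrite mulr0 addr0; congr (expR _%:R); congr #|pred_of_set _|.
  apply/setP => i; rewrite !inE; have [->|//] := eqVneq i a.
  by rewrite (negbTE aB) !andbF.
have -> : ((a |: C) :&: B = a |: (C :&: B))%SET.
  by apply/setP => i; rewrite !inE; have [->|//] := eqVneq i a; rewrite aB.
rewrite cardsU1 inE (negbTE aC)/= natrD expRD.
by ring.
Qed.

(** By symmetry the increment is the mean of the increments of the elements
    outside C; there are at least d / 2 of them, and their sum counts each block
    at most b times. *)
Lemma load_increment_le n (b : nat) C a : a \notin C -> (2 * #|C| <= d)%N ->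
  (forall P B, P \in @eqparts d n -> B \in P -> (#|B| <= b)%N) ->
  load_increment n C a <= 2 * b%:R / d%:R * load_weight n C.
Proof.
move=> aC Cd bP.
have d0 : (0 < d)%N by apply: leq_ltn_trans (ltn_ord a).
have S : \sum_(a' in ~: C) load_increment n C a' = #|(~: C)%SET|%:R * load_increment n C a.
  rewrite mulr_natl -sumr_const; apply: eq_bigr => a'; rewrite inE => a'C.
  exact: load_increment_sym.
have Sle : \sum_(a' in ~: C) load_increment n C a' <= b%:R * load_weight n C.
  rewrite /load_increment /load_weight exchange_big/= mulr_sumr.
  apply: ler_sum => P Pn; under eq_bigr do rewrite big_mkcondr/=.
  rewrite exchange_big/= mulr_sumr; apply: ler_sum => B BP.
  rewrite -big_mkcondr/= sumr_const -[X in X <= _]mulr_natl ler_wpM2r ?expR_ge0// ler_nat.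
  apply: leq_trans (bP _ _ Pn BP); apply: subset_leq_card.
  by apply/fintype.subsetP => i; rewrite unfold_in => /andP[].
have C2 : d%:R / 2 <= #|(~: C)%SET|%:R :> R.
  rewrite cardsCs finset.setCK card_ord ler_pdivrMr// -natrM ler_nat.
  by lia.
have W0 : 0 <= load_increment n C a.
  by apply: sumr_ge0 => P _; apply: sumr_ge0 => B _; exact: expR_ge0.
have := ler_wpM2r W0 C2; rewrite -S => H.
have dR : 0 < d%:R :> R by rewrite ltr0n.
have -> : 2 * b%:R / d%:R * load_weight n C = 2 / d%:R * (b%:R * load_weight n C) by ring.
have {}H := le_trans H Sle.
have -> : load_increment n C a = 2 / d%:R * (d%:R / 2 * load_increment n C a).
  by field; rewrite gt_eqF.
by rewrite ler_wpM2l// divr_ge0.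
Qed.

(** Each new element of C multiplies the weight by at most
    1 + (e - 1) 2b / d <= e^(4b/d). *)
Lemma load_weight_le n (b : nat) C : (2 * #|C| <= d)%N ->
  (forall P B, P \in @eqparts d n -> B \in P -> (#|B| <= b)%N) ->
  load_weight n C <=
    expR (4 * b%:R / d%:R * #|C|%:R) * (n%:R * #|@eqparts d n|%:R).
Proof.
move=> + bP; move: {2}#|C| (leqnn #|C|) => k; elim: k C => [|k IH] C Ck Cd.
  have C0 : C = finset.set0 by apply: cards0_eq; apply/eqP; rewrite -leqn0.
  rewrite C0 cards0 mulr0 expR0 mul1r /load_weight [X in _ <= X]mulr_natr -sumr_const.
  apply: ler_sum => P Pn; rewrite -(eqparts_card Pn) -sumr_const.
  by apply: ler_sum => B _; rewrite finset.set0I cards0 expR0.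
have [C0|/finset.set0Pn[a aC]] := eqVneq C finset.set0.
  by apply: IH; rewrite C0 cards0.
set C' := (C :\ a)%SET.
have CE : C = (a |: C')%SET by rewrite finset.setD1K.
have aC' : a \notin C' by rewrite !inE eqxx.
have cC : #|C| = #|C'|.+1 by rewrite CE cardsU1 aC'.
have C'd : (2 * #|C'| <= d)%N by lia.
have W0 : 0 <= load_weight n C'.
  by apply: sumr_ge0 => P _; apply: sumr_ge0 => B _; exact: expR_ge0.
have C'k : (#|C'| <= k)%N by rewrite -ltnS -cC.
have := IH _ C'k C'd; have := load_increment_le aC' C'd bP.
have -> : #|C|%:R = #|C'|%:R + 1 :> R by rewrite cC natr1.
rewrite mulrDr mulr1 addrC expRD {1}CE load_weightU//.
have e2 : expR 1 - 1 <= 2 :> R by have := expR1_le3 (R := R); lra.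
have e0 : 0 <= expR 1 - 1 :> R by have := expR_ge1Dx (1 : R); lra.
set u := 4 * b%:R / d%:R; set I := load_increment _ _ _; set W := load_weight n C'.
move=> H1 H2; rewrite -mulrA; apply: le_trans (ler_wpM2l (expR_ge0 _) H2).
apply: le_trans (ler_wpM2r W0 (expR_ge1Dx u)).
rewrite [(1 + u) * W]mulrDl mul1r lerD2l.
have I0 : 0 <= I by apply: sumr_ge0 => P _; apply: sumr_ge0 => B _; exact: expR_ge0.
apply: (@le_trans _ _ (2 * I)); first exact: ler_wpM2r.
by apply: le_trans (ler_wpM2l _ H1) _ => //; rewrite /u -/W; lra.
Qed.

(** A soft maximum: k <= ln n + e^k / n for every load k. *)
Lemma block_dual_norm_sqr_le P C (c : 'rV[R]_d) n : (0 < n)%N ->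
  (forall i, -1 <= c 0 i <= 1) -> C = [set i : 'I_d | c 0 i != 0]%SET ->
  block_dual_norm P c ^+ 2 <=
    ln n%:R + (\sum_(B in P) expR (#|(C :&: B)%SET|%:R)) / n%:R.
Proof.
move=> n0 c1 CE.
set X := (X in _ <= X).
have nR : 0 < n%:R :> R by rewrite ltr0n.
have S0 (Q : pred {set 'I_d}) : 0 <= \sum_(B in P | Q B) expR (#|(C :&: B)%SET|%:R) :> R.
  by apply: sumr_ge0 => B _; exact: expR_ge0.
have X0 : 0 <= X.
  rewrite addr_ge0 ?ln_ge0 ?ler1n// divr_ge0 ?(ltW nR)//.
  by apply: sumr_ge0 => B _; exact: expR_ge0.
rewrite -(sqr_sqrtr X0) ler_sqr ?nnegrE ?sqrtr_ge0//; last first.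
  exact: bigmax_ge_id.
apply: bigmax_le; first exact: sqrtr_ge0.
move=> B BP; rewrite l2_on_le ?sqrtr_ge0// sqr_sqrtr//.
apply: (@le_trans _ _ (#|(C :&: B)%SET|%:R)).
  rewrite /dot_on (bigID (mem C))/= [X in _ + X]big1 ?addr0; last first.
    by move=> i /andP[_]; rewrite CE inE negbK => /eqP ->; rewrite mul0r.
  have -> : #|(C :&: B)%SET|%:R = \sum_(i in (C :&: B)%SET) (1 : R) by rewrite sumr_const.
  rewrite [leRHS](eq_bigl (fun i => (i \in B) && (i \in C))); last first.
    by move=> i; rewrite inE andbC.
  apply: ler_sum => i _; have := c1 i; rewrite -expr2 => /andP[? ?].
  by nra.
set k : R := _%:R.
apply: (@le_trans _ _ (ln n%:R + expR k / n%:R)).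
  have := expR_ge1Dx (k - ln n%:R).
  by rewrite expRD expRN lnK ?posrE//; lra.
rewrite lerD2l ler_pM2r ?invr_gt0// (bigD1 B)//= lerDl.
exact: S0.
Qed.

End BlockLoads.

(** * Averages over partitions and the gradient bound *)

Section Averages.
Context {R : realType} {d : nat}.
Implicit Types (P : {set {set 'I_d}}) (F : {set {set 'I_d}} -> R).
Variable n : nat.
Hypothesis nd : (0 < n <= d)%N.

Let N0 : 0 < #|@eqparts d n|%:R :> R.
Proof. by rewrite ltr0n eqparts_neq0. Qed.

Lemma avg_eqparts_affine F (a b : R) :
  avg_eqparts n (fun P => a * F P + b) = a * avg_eqparts n F + b.
Proof.
rewrite /avg_eqparts big_split/= -mulr_sumr sumr_const -[b *+ _]mulr_natr.
by field; rewrite gt_eqF.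
Qed.

Lemma avg_eqparts_cst (b : R) : @avg_eqparts R d n (fun=> b) = b.
Proof.
by rewrite /avg_eqparts sumr_const -[b *+ _]mulr_natr mulfK ?gt_eqF.
Qed.

Lemma ler_avg_eqparts F F' : (forall P, P \in eqparts n -> F P <= F' P) ->
  avg_eqparts n F <= avg_eqparts n F'.
Proof. by move=> FF'; rewrite ler_pM2r ?invr_gt0//; exact: ler_sum. Qed.

Lemma avg_eqparts_le F (b : R) : (forall P, P \in eqparts n -> F P <= b) ->
  avg_eqparts n F <= b.
Proof. by move=> Fb; rewrite -[leRHS]avg_eqparts_cst; exact: ler_avg_eqparts. Qed.

Lemma avg_eqparts_ge F (b : R) : (forall P, P \in eqparts n -> b <= F P) ->
  b <= avg_eqparts n F.
Proof. by move=> Fb; rewrite -[leLHS]avg_eqparts_cst; exact: ler_avg_eqparts. Qed.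

End Averages.

Section GradBound.
Context {R : realType} {d : nat}.
Implicit Types (P : {set {set 'I_d}}) (B : {set 'I_d}) (c : 'rV[R]_d).
Variables (n s : nat).
Hypothesis nd : (0 < n <= d)%N.

Definition sparse_cube : set 'rV[R]_d :=
  [set c : 'rV[R]_d | (forall i, -1 <= c 0 i <= 1) /\
                      (#|[pred i | (c 0 i != 0)%R]| <= s)%N].

Lemma l2_on_le_block_dual P B c : B \in P -> l2_on B c <= block_dual_norm P c.
Proof. by move=> BP; apply: (bigmax_sup B). Qed.

Lemma block_dual_norm_ge0 P c : 0 <= block_dual_norm P c.
Proof. exact: bigmax_ge_id. Qed.

Lemma grad_bound_ge c (X : R) : sparse_cube c -> 0 <= X ->
  (forall P, P \in eqparts n -> X <= block_dual_norm P c) ->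
  X <= @grad_bound_block R d n s.
Proof.
move=> cs X0 Xc.
apply: (@le_trans _ _ (Num.sqrt (avg_eqparts n (fun P => block_dual_norm P c ^+ 2)))).
  rewrite -{1}(ger0_norm X0) -sqrtr_sqr ler_wsqrtr//; apply: avg_eqparts_ge => // P Pn.
  by rewrite ler_sqr ?nnegrE ?block_dual_norm_ge0// Xc.
apply: ub_le_sup; last by exists c.
exists (Num.sqrt d%:R) => _ [c' [c'1 _] <-].
rewrite ler_wsqrtr//; apply: avg_eqparts_le => // P Pn.
rewrite -(sqr_sqrtr (ler0n _ d)) ler_sqr ?nnegrE ?block_dual_norm_ge0 ?sqrtr_ge0//.
apply: bigmax_le => [|B BP]; first exact: sqrtr_ge0.
rewrite l2_on_le ?sqrtr_ge0// sqr_sqrtr ?ler0n//.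
apply: (@le_trans _ _ (\sum_(i in B) 1)).
  by apply: ler_sum => i _; have := c'1 i => /andP[? ?]; nra.
by rewrite sumr_const ler_nat -[leqRHS](card_ord d) max_card.
Qed.

Lemma grad_bound_ge1 : (0 < s)%N -> 1 <= @grad_bound_block R d n s.
Proof.
move=> s0; have /andP[n0 /(leq_trans n0) d0] := nd.
pose i0 := Ordinal d0; pose c : 'rV[R]_d := delta_mx 0 i0.
apply: (@grad_bound_ge c) => //.
  split=> [i|]; first by rewrite mxE eqxx; case: (i == i0) => /=; lra.
  suff -> : #|[pred i | c 0 i != 0]| = 1%N by [].
  apply: etrans (card1 i0); apply: eq_card => i.
  by rewrite !inE mxE eqxx; case: (i == i0) => /=; rewrite ?oner_eq0 ?eqxx.
move=> P Pn; have hP := eqparts_partition Pn.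
have i0P : i0 \in finset.cover P by rewrite (cover_partition hP) inE.
have BP := pblock_mem i0P; apply: le_trans (l2_on_le_block_dual c BP).
rewrite -sqrtr1 ler_wsqrtr// (bigD1 i0) ?mem_pblock//= mxE !eqxx expr1n.
by rewrite lerDl sumr_ge0// => j _; exact: sqr_ge0.
Qed.

(** Blocks have at most b = d / n + 1 elements and the support at most n, so
    that the exponent 4 b |C| / d of the weight is at most 4 (d + n) / d <= 6. *)
Lemma grad_bound_le : (0 < s)%N -> (3 <= n)%N -> (s <= n)%N -> (2 * n <= d)%N ->
  @grad_bound_block R d n s ^+ 2 <= (1 + expR 6) * ln n%:R.
Proof.
move=> s0 n3 sn n2d.
have d0 : (0 < d)%N by lia.
have n0 : (0 < n)%N by lia.
have l1 := ln_ge1 (R := R) n3.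
pose X : R := ln n%:R + expR 6.
have X0 : 0 <= X by rewrite /X; have := expR_ge0 (6 : R); lra.
suff GX : @grad_bound_block R d n s <= Num.sqrt X.
  have G0 : 0 <= @grad_bound_block R d n s by apply: le_trans (grad_bound_ge1 s0).
  apply: (@le_trans _ _ X).
    by rewrite -(sqr_sqrtr X0) ler_sqr ?nnegrE ?sqrtr_ge0.
  by rewrite /X mulrDl mul1r lerD2l ler_peMr// expR_ge0.
apply: ge_sup.
  exists (Num.sqrt (avg_eqparts n (fun P => block_dual_norm P (0 : 'rV[R]_d) ^+ 2))), 0 => //.
  split=> [i|]; first by rewrite mxE; lra.
  by rewrite eq_card0// => i; rewrite !inE mxE eqxx.
move=> _ [c [c1 cs] <-]; rewrite ler_wsqrtr//.
pose C := [set i : 'I_d | c 0 i != 0]%SET.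
have Cs : (#|C| <= s)%N by rewrite cardsE; exact: cs.
pose b := (d %/ n).+1.
have bP P B : P \in @eqparts d n -> B \in P -> (#|B| <= b)%N.
  move=> Pn BP; have := card_eqparts_block d0 Pn BP.
  have := partition_block_gt0 (eqparts_partition Pn) BP.
  rewrite /b => B0 H; suff : (#|B|.-1 <= d %/ n)%N by lia.
  by rewrite leq_divRL// mulnC ltnW.
have N0 : 0 < #|@eqparts d n|%:R :> R by rewrite ltr0n eqparts_neq0.
have nR : 0 < n%:R :> R by rewrite ltr0n.
apply: (@le_trans _ _ (avg_eqparts n (fun P => n%:R^-1 *
    (\sum_(B in P) expR (#|(C :&: B)%SET|%:R)) + ln n%:R))).
  apply: ler_avg_eqparts => // P Pn.
  have := @block_dual_norm_sqr_le R d P C c n n0 c1 erefl.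
  by rewrite addrC [n%:R^-1 * _]mulrC.
rewrite avg_eqparts_affine// addrC lerD2l /avg_eqparts -/(load_weight n C).
have C2 : (2 * #|C| <= d)%N by lia.
have := load_weight_le (R := R) C2 bP.
set W := load_weight n C; set e := expR (_ * _) => We.
have e6 : e <= expR 6.
  rewrite ler_expR mulrAC ler_pdivrMr ?ltr0n//.
  have : (b * #|C| <= d + n)%N.
    apply: (@leq_trans (b * n)); first by rewrite leq_mul2l (leq_trans Cs)// orbT.
    by rewrite /b mulSn addnC leq_add2r leq_divM.
  rewrite -(ler_nat R) natrM natrD => H.
  have : n%:R * 2 <= d%:R :> R by rewrite -natrM ler_nat mulnC.
  lra.
apply: le_trans e6.
rewrite mulrA ler_pdivrMr// mulrC ler_pdivrMr//.
by move: We; rewrite -mulrA [n%:R * _]mulrC.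
Qed.

End GradBound.

(** * Mirror descent with a block norm *)

(** What both domains provide: nonnegativity and the bound M control the
    radius and the diameter, and a vertex other than the start makes the
    diameter, hence the step size, positive. *)
Record start_domain (R : realType) (d : nat) (K : set 'rV[R]_d) (M : R)
    (i0 : 'I_d) (x1 : 'rV[R]_d) : Prop := StartDomain {
  dom_conv : forall x z (t : R), K x -> K z -> 0 <= t <= 1 -> K (x + t *: (z - x));
  dom_comp : compact K;
  dom_ge0 : forall x i, K x -> 0 <= x 0 i;
  dom_le : forall x, K x -> \sum_i x 0 i <= M;
  dom_vertex : K (delta_mx 0 i0);
  dom_start : K x1;
  dom_start_neq : x1 != delta_mx 0 i0 }.

Section BlockDescent.
Context {R : realType} {d : nat}.
Implicit Types (P : {set {set 'I_d}}) (B : {set 'I_d}) (x z u : 'rV[R]_d).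
Variables (K : set 'rV[R]_d) (n : nat) (M : R) (i0 : 'I_d) (x1 : 'rV[R]_d).
Hypotheses (nd : (0 < n <= d)%N) (dom : start_domain K M i0 x1).

Let Kconv := dom_conv dom.
Let Kcomp := dom_comp dom.
Let K_ge0 := dom_ge0 dom.
Let K_le := dom_le dom.
Let Ki0 := dom_vertex dom.
Let Kx1 := dom_start dom.
Let x1i0 := dom_start_neq dom.

Lemma l2_on_le_sum B x : (forall i, 0 <= x 0 i) -> l2_on B x <= \sum_(i in B) x 0 i.
Proof.
move=> x0; have S0 : 0 <= \sum_(i in B) x 0 i by exact: sumr_ge0.
rewrite l2_on_le// /dot_on expr2 mulr_suml; apply: ler_sum => i iB.
rewrite ler_wpM2l// (bigD1 i)//= lerDl; exact: sumr_ge0.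
Qed.

Lemma block_norm_le_sum P x : finset.partition P [set: 'I_d]%SET ->
  (forall i, 0 <= x 0 i) -> block_norm P x <= \sum_i x 0 i.
Proof.
move=> hP x0.
have -> : \sum_i x 0 i = \sum_(B in P) \sum_(i in B) x 0 i.
  by rewrite -(set_partition_big _ hP)/=; apply: eq_bigl => i; rewrite inE.
by apply: ler_sum => B _; exact: l2_on_le_sum.
Qed.

Local Notation r := (radius n K).

Lemma block_norm_le_radius P x : P \in eqparts n -> K x -> block_norm P x <= r.
Proof.
move=> Pn Kx; apply: (@le_trans _ _ (sup [set block_norm P x | x in K])).
  apply: ub_le_sup; last by exists x.
  exists M => _ [z Kz <-]; apply: le_trans (K_le Kz).
  by apply: block_norm_le_sum => [|i]; [exact: eqparts_partition Pn|exact: K_ge0].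
exact: (bigmax_sup P).
Qed.

Lemma radius_le (X : R) : 0 <= X ->
  (forall P x, P \in eqparts n -> K x -> block_norm P x <= X) -> r <= X.
Proof.
move=> X0 H; apply: bigmax_le => // P Pn; apply: ge_sup.
  by exists (block_norm P x1), x1.
by move=> _ [x Kx <-]; exact: H.
Qed.

Lemma radius_ge1 : 1 <= r.
Proof.
have N0 := eqparts_neq0 nd; have /card_gt0P[P Pn] := N0.
apply: le_trans (block_norm_le_radius Pn Ki0).
have hP := eqparts_partition Pn.
have i0P : i0 \in finset.cover P by rewrite (cover_partition hP) inE.
have BP := pblock_mem i0P; apply: le_trans (l2_on_le_block_norm _ BP).
rewrite -sqrtr1 ler_wsqrtr// (bigD1 i0) ?mem_pblock//= mxE !eqxx expr1n.
by rewrite lerDl sumr_ge0// => j _; exact: sqr_ge0.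
Qed.

Lemma radius_gt0 : 0 < r. Proof. exact: lt_le_trans radius_ge1. Qed.

Definition block_modulus (k : nat) : R := (pexp k - 1) ^+ 2 / (gamma k * pexp k).

Section FixedPartition.
Variable P : {set {set 'I_d}}.
Hypothesis Pn : P \in eqparts n.
Local Notation h := (block_mirror n K P).

Lemma block_modulusE : mirror_modulus P = block_modulus n :> R.
Proof. by rewrite /mirror_modulus (eqparts_card Pn). Qed.

Lemma block_modulus_gt0 : 0 < block_modulus n.
Proof. by rewrite -block_modulusE; exact: mirror_modulus_gt0. Qed.

Let hP := eqparts_partition Pn.

Lemma block_mirror_continuous : continuous h.
Proof. exact: mirror_continuous. Qed.

Lemma grad_block_mirrorE x : grad h x = mirror_grad P r x.
Proof. by apply: grad_mirror => //; exact: radius_gt0. Qed.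

Lemma grad_block_mirror_continuous i : continuous (fun x => grad h x 0 i).
Proof.
rewrite (_ : (fun x => _) = (fun x => mirror_grad P r x 0 i)).
  by apply: mirror_grad_continuous => //; exact: radius_gt0.
by apply/funext => x; rewrite grad_block_mirrorE.
Qed.

Lemma block_bregman_ge0 x z : 0 <= bregman h z x.
Proof. by apply: mirror_bregman_ge0 => //; exact: radius_gt0. Qed.

Lemma block_bregman_ge x z : K x -> K z ->
  block_modulus n * dot (z - x) (z - x) <= bregman h z x.
Proof.
move=> Kx Kz; rewrite -block_modulusE.
by apply: mirror_bregman_ge; rewrite ?radius_gt0// block_norm_le_radius.
Qed.

Lemma block_bregman_le x z : K x -> K z -> bregman h z x <= 2 * r ^+ 2 / gamma n.
Proof.
move=> Kx Kz; suff : bregman h z x <= 2 * r ^+ 2 / gamma #|P|.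
  by rewrite (eqparts_card Pn).
apply: mirror_bregman_le; rewrite ?radius_gt0 ?block_norm_le_radius//;
  by move=> i; exact: K_ge0.
Qed.

Lemma sup_bregman_ge z : K z -> bregman h z x1 <= sup [set bregman h z x1 | z in K].
Proof.
move=> Kz; apply: ub_le_sup; last by exists z.
by exists (2 * r ^+ 2 / gamma n) => _ [u Ku <-]; exact: block_bregman_le.
Qed.

Lemma sup_bregman_le : sup [set bregman h z x1 | z in K] <= 2 * r ^+ 2 / gamma n.
Proof.
apply: ge_sup; first by exists (bregman h x1 x1), x1.
by move=> _ [u Ku <-]; exact: block_bregman_le.
Qed.

Section Iterates.
Variables (eta : R) (G : nat -> 'rV[R]_d).
Hypothesis (eta0 : 0 < eta).
Local Notation X := (omd K h eta (fun t => dot (G t)) x1).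

Lemma block_omd_in t : K (X t).
Proof.
exact: (omd_in eta Kcomp (@block_mirror_continuous) G Kx1 t).
Qed.

Lemma block_omd_telescope u t : K u ->
  \sum_(s < t) dot (G s) (X s.+1 - u) <=
  eta^-1 * (bregman h u x1 - bregman h u (X t)).
Proof.
exact: (omd_telescope eta0 Kconv Kcomp (@block_mirror_continuous)
  (@grad_block_mirror_continuous) block_bregman_ge0 G Kx1).
Qed.

Lemma block_omd_drift_le s t i :
  (forall t v, dot (G t) v <= Num.sqrt (dot v v)) -> (s <= t)%N ->
  `|X t 0 i - X s 0 i| <= (t - s)%:R * (eta / block_modulus n).
Proof.
move=> G1 st; exact: (omd_drift_le eta0 Kconv Kcomp (@block_mirror_continuous)
  (@grad_block_mirror_continuous) block_bregman_ge0 Kx1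
  block_modulus_gt0 (@block_bregman_ge) G1 i st).
Qed.

Lemma block_omd_stationary t x : K x ->
  G t + eta^-1 *: (grad h x - grad h (X t)) = 0 -> X t.+1 = x.
Proof.
move=> Kx sx.
have e : omd_argmin K h eta (G t) (X t) = [set x].
  apply: omd_argmin_stationary => // [z Kz|z Kz zx].
    by rewrite sx /dot big1// => i _; rewrite mxE mul0r.
  apply: lt_le_trans (block_bregman_ge Kx Kz).
  rewrite mulr_gt0 ?block_modulus_gt0// ltNge.
  by apply: contra zx => /dot_eq0 /eqP; rewrite subr_eq0.
by rewrite /= grad_dot e; apply: xget_unique => // y ->.
Qed.

Lemma block_regret_ge T u : K u ->
  \sum_(t < T) dot (G t) (X t - u) <= omd_regret K h eta T (fun t => dot (G t)) x1.
Proof.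
have [v Kv [_ H]] := @omd_regret_linear R d K h eta Kcomp T G x1 Kx1.
exact: H.
Qed.

End Iterates.
End FixedPartition.

Let D2 := avg_eqparts n (fun P => sup [set bregman (block_mirror n K P) z x1 | z in K]).

Lemma diam_block_radicand_gt0 : 0 < D2.
Proof.
have N0 := eqparts_neq0 nd; have /card_gt0P[P0 P0n] := N0.
apply: (@lt_le_trans _ _ (block_modulus n * dot (delta_mx 0 i0 - x1) (delta_mx 0 i0 - x1))).
  rewrite mulr_gt0 ?(block_modulus_gt0 P0n)// ltNge.
  by apply: contra x1i0 => /dot_eq0 /eqP; rewrite subr_eq0 eq_sym.
apply: avg_eqparts_ge => // P Pn.
exact: le_trans (block_bregman_ge Pn Kx1 Ki0) (sup_bregman_ge Pn Ki0).
Qed.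

Lemma diam_block_sqr : diam_block n K x1 ^+ 2 = D2.
Proof. by rewrite sqr_sqrtr// ltW// diam_block_radicand_gt0. Qed.

Lemma diam_block_gt0 : 0 < diam_block n K x1.
Proof. by rewrite sqrtr_gt0 diam_block_radicand_gt0. Qed.

Lemma diam_block_sqr_le : diam_block n K x1 ^+ 2 <= 2 * r ^+ 2 / gamma n.
Proof.
by rewrite diam_block_sqr; apply: avg_eqparts_le => // P Pn; exact: sup_bregman_le.
Qed.

(** The regret compares x_t with u, the telescoped inequality x_(t+1) with u;
    the difference of the two is the stability sum, bounded by E. *)
Lemma block_regret_avg_le (eta E : R) T (G : nat -> 'rV[R]_d) : 0 < eta ->
  (forall P X, P \in eqparts n ->
    X = omd K (block_mirror n K P) eta (fun t => dot (G t)) x1 ->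
    \sum_(t < T) dot (G t) (X t - X t.+1) <= E) ->
  avg_eqparts n (fun P => omd_regret K (block_mirror n K P) eta T
    (fun t => dot (G t)) x1) <= eta^-1 * diam_block n K x1 ^+ 2 + E.
Proof.
move=> eta0 HE; rewrite diam_block_sqr -avg_eqparts_affine//.
apply: ler_avg_eqparts => // P Pn.
have [u Ku [-> _]] := @omd_regret_linear R d K (block_mirror n K P) eta Kcomp T G x1 Kx1.
have tel := block_omd_telescope Pn G eta0 T Ku.
have -> : \sum_(t < T) dot (G t) (omd K (block_mirror n K P) eta (fun t => dot (G t)) x1 t - u)
  = \sum_(t < T) dot (G t) (omd K (block_mirror n K P) eta (fun t => dot (G t)) x1 t.+1 - u)
  + \sum_(t < T) dot (G t) (omd K (block_mirror n K P) eta (fun t => dot (G t)) x1 t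
      - omd K (block_mirror n K P) eta (fun t => dot (G t)) x1 t.+1).
  by rewrite -big_split; apply: eq_bigr => t _; rewrite /= -dotDr [in RHS]addrC addrA subrK.
apply: lerD; last exact: HE Pn erefl.
apply: le_trans tel _.
rewrite ler_wpM2l ?invr_ge0 ?(ltW eta0)//.
apply: le_trans (sup_bregman_ge Pn Ku).
by rewrite gerBl block_bregman_ge0.
Qed.

End BlockDescent.

(** * Deterministic linear instances *)

Section LinearInstance.
Context {R : realType} {d : nat}.
Variables (K : set 'rV[R]_d) (T : nat) (G : nat -> 'rV[R]_d) (x1 : 'rV[R]_d).
Hypothesis (Kx1 : K x1).

Fact dot_is_linear (g : 'rV[R]_d) : linear (dot g : 'rV[R]_d -> R^o).
Proof. by move=> a x y; rewrite dotDr dotZr. Qed.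

HB.instance Definition _ (g : 'rV[R]_d) :=
  GRing.isLinear.Build R 'rV[R]_d R^o *:%R (dot g : 'rV[R]_d -> R^o) (dot_is_linear g).

Lemma differentiable_dot (g x : 'rV[R]_d) : differentiable (dot g : _ -> R^o) x.
Proof. by apply: linear_differentiable; exact: dot_continuous. Qed.

Lemma convex_dot (g : 'rV[R]_d) :
  convex_function (K : set (convex_lmodType 'rV[R]_d)) (dot g : _ -> R^o).
Proof.
move=> t x y _ _; rewrite convRE.
by rewrite /conv/= dotDr !dotZr.
Qed.

Definition linear_instance : oco_instance K T :=
  @OCOInstance R d K T _ unit (dirac tt) x1 (fun t _ => dot (G t)) Kx1
    (fun t _ _ => convex_dot (G t))
    (fun t _ x _ _ => differentiable_dot (G t) x)
    (fun t x _ _ => measurable_cst (dot (G t) x)).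

Lemma E_regret_block_linear n s : E_regret_block n s linear_instance =
  (avg_eqparts n (fun P => omd_regret K (block_mirror n K P)
    (diam_block n K x1 / (@grad_bound_block R d n s * Num.sqrt T%:R)) T
    (fun t => dot (G t)) x1))%:E.
Proof.
set r := (X in X%:E); rewrite /E_regret_block.
exact: (@expectation_cst _ _ _ (law linear_instance) r).
Qed.

Lemma integrable_regret_block_linear n s :
  integrable_regret_block n s linear_instance.
Proof. by move=> P _; apply: (finite_measure_integrable_cst (law linear_instance) (regret_block n s (I := linear_instance) P tt)). Qed.

Lemma E_regret_ent_linear : E_regret_ent linear_instance =
  (regret_ent (I := linear_instance) tt)%:E.
Proof.
set r := (X in X%:E); rewrite /E_regret_ent.
have -> : @regret_ent R d K T linear_instance = cst r.
  by apply/funext => -[].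
exact: expectation_cst.
Qed.

Lemma integrable_regret_ent_linear : integrable_regret_ent linear_instance.
Proof. exact: (finite_measure_integrable_cst (law linear_instance) (regret_ent (I := linear_instance) tt)). Qed.

Lemma sparse_losses_linear (s : nat) (C : nat -> {set 'I_d}) :
  (forall t, #|C t| <= s)%N -> (forall t i, -1 <= G t 0 i <= 1) ->
  (forall t i, i \notin C t -> G t 0 i = 0) -> sparse_losses s linear_instance.
Proof.
move=> Cs G1 GC t w _; split=> [x i _|]; first by rewrite grad_dot.
by exists (C t) => // x i _ iC; rewrite grad_dot GC.
Qed.

End LinearInstance.

(** * The simplex and the entropy *)

Section Domains.
Context {R : realType} {d : nat}.
Implicit Types (x z : 'rV[R]_d).

Lemma compact_box_closed (K : set 'rV[R]_d) (M : R) : closed K ->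
  (forall x i, K x -> 0 <= x 0 i <= M) -> compact K.
Proof.
move=> Kcl Kb.
have cM : compact [set v : 'rV[R]_d | forall i, v ord0 i \in `[0, M]].
  apply: (@rV_compact _ _ (fun=> `[0, M]%classic)) => _; exact: segment_compact.
apply: (subclosed_compact Kcl cM) => v Kv i.
by rewrite in_itv/=; exact: Kb.
Qed.

Lemma closed_le0 (f : 'rV[R]_d -> R) : continuous f -> closed [set x | f x <= 0].
Proof. by move=> fc; apply: (closed_comp _ (@closed_le R 0)) => x _; exact: fc. Qed.

Lemma closed_ge0 (f : 'rV[R]_d -> R) : continuous f -> closed [set x | 0 <= f x].
Proof. by move=> fc; apply: (closed_comp _ (@closed_ge R 0)) => x _; exact: fc. Qed.

Lemma sum_coord_cts : continuous (fun x : 'rV[R]_d => \sum_i x 0 i).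
Proof. by apply: sum_cts => i _; exact: coord_cts. Qed.

Lemma closed_simplex : closed (simplex R d).
Proof.
rewrite (_ : simplex R d = (\bigcap_(i in [set: 'I_d]) [set x : 'rV[R]_d | 0 <= x 0 i]) `&`
    [set x : 'rV[R]_d | \sum_i x 0 i = 1]); last first.
  apply/seteqP; split=> x /= [h1 h2]; split=> // i; first by move=> _; exact: h1.
  exact: h1.
apply: closedI; first by apply: closed_bigI => i _; apply: closed_ge0; exact: coord_cts.
by apply: (closed_comp _ (@closed_eq R 1)) => x _; exact: sum_coord_cts.
Qed.

Lemma simplex_le1 x i : simplex R d x -> 0 <= x 0 i <= 1.
Proof.
move=> [x0 x1]; rewrite x0 -x1 (bigD1 i)//= lerDl.
by apply: sumr_ge0 => j _; exact: x0.
Qed.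

Lemma simplex_delta i : simplex R d (delta_mx 0 i).
Proof.
split=> [j|]; first by rewrite mxE eqxx; case: (j == i).
rewrite (bigD1 i)//= mxE !eqxx big1 ?addr0// => j ji.
by rewrite mxE eqxx (negbTE ji).
Qed.

Lemma simplex_uniform : (0 < d)%N -> simplex R d (const_mx d%:R^-1).
Proof.
move=> d0; split=> [i|]; first by rewrite mxE invr_ge0.
under eq_bigr do rewrite mxE.
by rewrite sumr_const card_ord -[LHS]mulr_natl mulfV// pnatr_eq0 -lt0n.
Qed.

Lemma simplex_start_domain (i0 : 'I_d) : (1 < d)%N ->
  start_domain (simplex R d) 1 i0 (const_mx d%:R^-1).
Proof.
move=> d1; split.
- move=> x z t [x0 x1] [z0 z1] /andP[t0 t1]; split=> [i|].
    by rewrite !mxE; have := x0 i; have := z0 i; nra.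
  have -> : \sum_i (x + t *: (z - x)) 0 i =
    (1 - t) * \sum_i x 0 i + t * \sum_i z 0 i.
    by rewrite !mulr_sumr -big_split; apply: eq_bigr => i _; rewrite !mxE/=; ring.
  by rewrite x1 z1; ring.
- exact: compact_box_closed closed_simplex simplex_le1.
- by move=> x i /(simplex_le1 i)/andP[].
- by move=> x [_ ->].
- exact: simplex_delta.
- by apply: simplex_uniform; exact: ltnW.
- apply/eqP => /rowP/(_ i0); rewrite !mxE !eqxx/= => /eqP.
  by rewrite invr_eq1 pnatr_eq1 => /eqP d1E; move: d1; rewrite [X in (_ < X)%N]d1E ltnn.
Qed.

End Domains.

Section Entropy.
Context {R : realType} {d : nat}.
Implicit Types (x y z : 'rV[R]_d).

Definition ent_grad y : 'rV[R]_d := \row_i (ln (y 0 i) + 1).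

(** With w = ln (y / z) the expression is z (e^w - 1 - w). *)
Lemma ent_term_gt0 (z y : R) : 0 <= z -> 0 < y -> z != y ->
  0 < z * ln z - y * ln y - (ln y + 1) * (z - y).
Proof.
move=> z0 y0 zy; have [->|zn0] := eqVneq z 0; first by rewrite mul0r; lra.
have {}z0 : 0 < z by rewrite lt0r zn0.
have yz : y = z * expR (ln y - ln z).
  by rewrite expRD expRN !lnK ?posrE// mulrCA divff// mulr1.
have w0 : ln y - ln z != 0.
  by apply: contra zy; rewrite subr_eq0 => /eqP/(ln_inj y0 z0) ->.
have := expR_gt1Dx w0; rewrite -(ltr_pM2l z0) -yz.
lra.
Qed.

Lemma ent_subgradient y z : (forall i, 0 < y 0 i) -> (forall i, 0 <= z 0 i) ->
  dot (ent_grad y) (z - y) <= h_ent z - h_ent y.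
Proof.
move=> y0 z0; rewrite /h_ent -sumrB; apply: ler_sum => i _; rewrite !mxE.
have [->|zy] := eqVneq (z 0 i) (y 0 i); first by rewrite !subrr mulr0.
by have := ent_term_gt0 (z0 i) (y0 i) zy; lra.
Qed.

Lemma grad_ent y : (forall i, 0 < y 0 i) -> grad h_ent y = ent_grad y.
Proof.
move=> y0; apply: (@grad_of_subgradient _ _ _ _ [set z : 'rV[R]_d | forall i, 0 < z 0 i]).
- apply: (@filter_forall _ _ (fun i (z : 'rV[R]_d) => 0 < z 0 i) _ (nbhs_filter y)) => i.
  by apply: (cvgr_gt (f := fun z : 'rV[R]_d => z 0 i) (y 0 i)) => //; exact: coord_cts.
- by move=> u z u0 z0; apply: ent_subgradient => // i; exact: ltW.
- move=> i; rewrite (_ : (fun z => _) = (fun z : 'rV[R]_d => ln (z 0 i) + 1)); last first.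
    by apply/funext => z; rewrite mxE.
  apply: (@continuousD R R^o _ (fun z : 'rV[R]_d => ln (z 0 i)) (fun=> 1)); last exact: cst_continuous.
  refine (@continuous_comp _ R R (fun z : 'rV[R]_d => z 0 i) (@ln R) y _ _).
    exact: coord_cts.
  exact: continuous_ln.
Qed.

Lemma bregman_ent_gt0 y z : (forall i, 0 < y 0 i) -> (forall i, 0 <= z 0 i) ->
  z != y -> 0 < bregman h_ent z y.
Proof.
move=> y0 z0 zy; have [i ziy] : exists i, z 0 i != y 0 i.
  apply/existsP; rewrite -negb_forall; apply: contra zy => /forallP zy.
  by apply/eqP/rowP => i; exact/eqP.
rewrite /bregman grad_ent// /h_ent /dot -!sumrB (bigD1 i)//=.
rewrite ltr_wpDr//; last by rewrite !mxE; exact: ent_term_gt0.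
apply: sumr_ge0 => j _; rewrite !mxE.
have [->|zyj] := eqVneq (z 0 j) (y 0 j); first by rewrite !subrr mulr0 subr0.
by rewrite ltW// ent_term_gt0.
Qed.

End Entropy.

(** * Exponentiated gradient with a constant loss *)

Section Entropic.
Context {R : realType} {d : nat}.
Variables (i0 : 'I_d) (T : nat).
Hypothesis (d1 : (1 < d)%N).
Local Notation e0 := (delta_mx 0 i0 : 'rV[R]_d).
Local Notation g := (- e0).
Local Notation x1 := (const_mx d%:R^-1 : 'rV[R]_d).
Let d0 : (0 < d)%N := ltnW d1.

Definition vertex_instance : oco_instance (simplex R d) T :=
  linear_instance T (fun=> g) (simplex_uniform d0).

Lemma vertex_sparse s : (0 < s)%N -> sparse_losses s vertex_instance.
Proof.
move=> s0; apply: (@sparse_losses_linear _ _ _ _ _ _ _ s (fun=> [set i0]%SET)).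
- by move=> _; rewrite cards1.
- by move=> _ i; rewrite !mxE eqxx; case: (i == i0) => /=; lra.
- by move=> _ i; rewrite inE !mxE eqxx => /negbTE ->; rewrite oppr0.
Qed.

Lemma dot_vertex (x z : 'rV[R]_d) : dot g (x - z) = z 0 i0 - x 0 i0.
Proof. by rewrite dotC dotNr dot_delta !mxE opprB. Qed.

Section Trajectory.
Variable eta : R.
Hypothesis eta0 : 0 < eta.

Definition ent_weight (t : nat) (i : 'I_d) : R := expR (eta * t%:R * (i == i0)%:R).
Definition ent_total t : R := \sum_i ent_weight t i.

Lemma ent_total_gt0 t : 0 < ent_total t.
Proof.
rewrite /ent_total (bigD1 i0)//= ltr_wpDr ?expR_gt0//.
by apply: sumr_ge0 => i _; exact: expR_ge0.
Qed.

Lemma ent_total_ge t : d%:R <= ent_total t.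
Proof.
rewrite -[in leLHS](card_ord d) -sumr_const; apply: ler_sum => i _.
rewrite -[leLHS]expR0 ler_expR !mulr_ge0//; exact: ltW.
Qed.

(** Multiplicative weights: at the normalized weights the optimality vector is
    constant, and constant vectors are orthogonal to differences of points of
    the simplex. *)
Lemma entropic_omd t :
  omd (simplex R d) h_ent eta (fun=> dot g) x1 t = \row_i (ent_weight t i / ent_total t).
Proof.
elim: t => [|t IH].
  apply/rowP => i; rewrite !mxE /ent_total /ent_weight mulr0 mul0r expR0 mul1r.
  under eq_bigr do rewrite mul0r expR0.
  by rewrite sumr_const card_ord.
rewrite /= IH grad_dot.
set y := \row_i _; set x := \row_i _.
have pos s i : 0 < ent_weight s i / ent_total s.
  by rewrite divr_gt0 ?expR_gt0 ?ent_total_gt0.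
have simp s : simplex R d (\row_i (ent_weight s i / ent_total s)).
  split=> [i|]; first by rewrite mxE ltW.
  under eq_bigr do rewrite mxE.
  by rewrite -mulr_suml mulfV// gt_eqF// ent_total_gt0.
have yp i : 0 < y 0 i by rewrite mxE.
have xp i : 0 < x 0 i by rewrite mxE.
suff -> : omd_argmin (simplex R d) h_ent eta g y = [set x].
  by apply: xget_unique => // z ->.
apply: omd_argmin_stationary => //; first exact: simp.
  move=> z [_ z1].
  have -> : g + eta^-1 *: (grad h_ent x - grad h_ent y) =
      const_mx (eta^-1 * (ln (ent_total t) - ln (ent_total t.+1))).
    apply/rowP => i; rewrite !grad_ent// !mxE.
    rewrite !ln_div ?posrE ?expR_gt0 ?ent_total_gt0// !expRK -natr1.
    by rewrite eqxx/=; field; rewrite gt_eqF.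
  rewrite dotBr; have [_ xs] := simp t.+1.
  rewrite /dot; under eq_bigr do rewrite mxE.
  under [X in _ - X]eq_bigr do rewrite mxE.
  by rewrite -!mulr_sumr z1 xs subrr.
by move=> z [z0 _] zx; apply: bregman_ent_gt0.
Qed.

Lemma entropic_omd_le t :
  omd (simplex R d) h_ent eta (fun=> dot g) x1 t 0 i0 <= expR (eta * t%:R) / d%:R.
Proof.
rewrite entropic_omd mxE /ent_weight eqxx mulr1 ler_wpM2l ?expR_ge0//.
by rewrite lef_pV2 ?posrE ?ent_total_gt0 ?ltr0n// ent_total_ge.
Qed.

End Trajectory.

Lemma uniform_ent_bregman (z : 'rV[R]_d) : simplex R d z ->
  bregman h_ent z x1 = h_ent z + ln d%:R.
Proof.
move=> [_ z1]; have [_ x1s] := simplex_uniform (R := R) d0.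
have dR : 0 < d%:R :> R by rewrite ltr0n.
have xp i : 0 < x1 0 i by rewrite mxE invr_gt0.
rewrite /bregman grad_ent// dotBr.
have -> : ent_grad x1 = const_mx (ln d%:R^-1 + 1) by apply/rowP => i; rewrite !mxE.
have D (x : 'rV[R]_d) : \sum_i x 0 i = 1 -> dot (const_mx (ln d%:R^-1 + 1)) x = ln d%:R^-1 + 1.
  by move=> xs; rewrite /dot; under eq_bigr do rewrite mxE; rewrite -mulr_sumr xs mulr1.
rewrite !D// subrr subr0; congr (_ + _).
rewrite /h_ent; under eq_bigr do rewrite mxE.
by rewrite sumr_const card_ord lnV ?posrE// -mulr_natl; field; rewrite gt_eqF.
Qed.

Lemma h_ent_le0 (z : 'rV[R]_d) : simplex R d z -> h_ent z <= 0.
Proof.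
move=> zs; rewrite /h_ent; apply: sumr_le0 => i _.
have /andP[z0 z1] := simplex_le1 i zs.
by rewrite mulr_ge0_le0// ln_le0.
Qed.

Lemma h_ent_vertex : h_ent e0 = 0.
Proof.
rewrite /h_ent big1// => i _; rewrite mxE eqxx.
by case: (i == i0); rewrite ?ln1 ?mulr0 ?mul0r.
Qed.

Lemma diam_ent_vertex : diam_ent vertex_instance = Num.sqrt (ln d%:R).
Proof.
rewrite /diam_ent; congr Num.sqrt; apply/le_anti/andP; split.
  apply: ge_sup; first by exists (bregman h_ent e0 x1), e0 => //; exact: simplex_delta.
  move=> _ [z zs <-]; rewrite uniform_ent_bregman//.
  by have := h_ent_le0 zs; lra.
apply: ub_le_sup.
  exists (ln d%:R) => _ [z zs <-]; rewrite uniform_ent_bregman//.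
  by have := h_ent_le0 zs; lra.
exists e0; first exact: simplex_delta.
by rewrite uniform_ent_bregman ?h_ent_vertex ?add0r//; exact: simplex_delta.
Qed.

Lemma grad_bound_ent_vertex (w : Omega vertex_instance) : (0 < T)%N ->
  1 <= grad_bound_ent w.
Proof.
move=> T0; apply: le_trans (le_bigmax _ _ (Ordinal T0)).
have -> : [set `|grad (loss vertex_instance (Ordinal T0) w) x| | x in simplex R d] = [set `|g|].
  apply/seteqP; split => [_ [x _ <-]|_ ->] /=; first by rewrite grad_dot.
  by exists e0; [exact: simplex_delta|rewrite grad_dot].
rewrite sup1.
have := @ler_norm R (e0 0 i0); rewrite mxE !eqxx/= => h.
apply: le_trans h _.
rewrite normrN [leRHS]/Num.norm/= mx_normrE; apply/bigmax_geP; right => /=.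
by exists (0, i0) => //=; rewrite mxE !eqxx.
Qed.

(** Each of the first N rounds costs at least 1/2 more than the vertex, and no
    round costs less than the vertex. *)
Lemma vertex_regret_ge (X : nat -> 'rV[R]_d) (N : nat) : (N <= T)%N ->
  (forall t, simplex R d (X t)) -> (forall t, (t < N)%N -> X t 0 i0 <= 2^-1) ->
  N%:R / 2 <= \sum_(t < T) dot g (X t - e0).
Proof.
move=> NT Xs XN.
have -> : \sum_(t < T) dot g (X t - e0) = \sum_(0 <= t < T) (1 - X t 0 i0).
  by rewrite big_mkord; apply: eq_bigr => t _; rewrite dot_vertex mxE !eqxx.
rewrite (big_cat_nat (n := N))//= -[leLHS]addr0; apply: lerD.
  rewrite big_mkord mulr_natl.
  have -> : 2^-1 *+ N = \sum_(t < N) 2^-1 :> R by rewrite sumr_const card_ord.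
  by apply: ler_sum => t _; have := XN t (ltn_ord t); lra.
rewrite big_nat_cond; apply: sumr_ge0 => t _.
by have := simplex_le1 i0 (Xs t); lra.
Qed.

End Entropic.

(** * Standard step sizes and the constant loss *)

Lemma card_ord_lt d s (sd : (s <= d)%N) : #|[pred i : 'I_d | (i < s)%N]| = s.
Proof.
rewrite -cardsE (_ : [set i in _]%SET = (widen_ord sd @: [set: 'I_s])%SET); last first.
  apply/setP => i; rewrite !inE; apply/idP/imsetP => [is_|[j _ ->]].
    by exists (Ordinal is_); rewrite ?inE//; apply: val_inj.
  exact: ltn_ord j.
rewrite card_imset ?cardsT ?card_ord// => x y /(congr1 val)/= h.
exact: val_inj.
Qed.

Section StandardStep.
Context {R : realType} {d : nat}.
Variables (K : set 'rV[R]_d) (n s : nat) (M : R) (i0 : 'I_d) (x1 : 'rV[R]_d).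
Hypotheses (nd : (0 < n <= d)%N) (dom : start_domain K M i0 x1) (s0 : (0 < s)%N).

Lemma grad_bound_gt0 : 0 < @grad_bound_block R d n s.
Proof. exact: lt_le_trans (grad_bound_ge1 nd s0). Qed.

(** D^2 <= 2 r^2 / gamma_n <= 6 r^2 ln n and G^2 <= (1 + e^6) ln n. *)
Lemma diam_grad_bound_le (r : R) : radius n K <= r ->
  (s <= n)%N -> (3 <= n)%N -> (2 * n <= d)%N ->
  diam_block n K x1 * @grad_bound_block R d n s <= 6 * r * (1 + expR 6) * ln n%:R.
Proof.
move=> Kr sn n3 n2d.
have l1 := ln_ge1 (R := R) n3.
have r0 := radius_ge1 nd dom.
have g0 := gamma_gt0 n (R := R).
have D2 := diam_block_sqr_le nd dom.
have G2 := grad_bound_le nd s0 n3 sn n2d (R := R).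
have D0 := diam_block_gt0 nd dom.
have G0 := grad_bound_gt0.
have e0 := expR_gt0 (6 : R).
have D2' : diam_block n K x1 ^+ 2 <= 6 * r ^+ 2 * ln n%:R.
  apply: le_trans D2 _.
  have -> : 6 * r ^+ 2 * ln n%:R = 2 * r ^+ 2 * (3 * ln n%:R) by ring.
  apply: ler_pM; [by rewrite mulr_ge0 ?sqr_ge0|by rewrite invr_ge0 ltW| |exact: gammaV_le].
  by rewrite ler_wpM2l// ler_sqr ?nnegrE; lra.
set e := expR 6 in G2 e0 *.
set D := diam_block _ _ _ in D2' D0 *; set Gb := grad_bound_block _ _ in G2 G0 *.
set l := ln _ in l1 D2' G2 *.
rewrite -ler_sqr ?nnegrE; last 2 first.
- by rewrite mulr_ge0 ?(ltW D0) ?(ltW G0).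
- by rewrite !mulr_ge0//; lra.
have H : (D * Gb) ^+ 2 <= (6 * r ^+ 2 * l) * ((1 + e) * l).
  by rewrite exprMn; apply: ler_pM => //; exact: sqr_ge0.
apply: le_trans H _.
have -> : (6 * r * (1 + e) * l) ^+ 2 = (6 * r ^+ 2 * l) * ((1 + e) * l) * (6 * (1 + e)) by ring.
by rewrite ler_peMr ?mulr_ge0 ?sqr_ge0//; lra.
Qed.

Variable T : nat.
Hypothesis T0 : (0 < T)%N.

Definition std_step : R :=
  diam_block n K x1 / (@grad_bound_block R d n s * Num.sqrt T%:R).

Let sT : 0 < Num.sqrt T%:R :> R.
Proof. by rewrite sqrtr_gt0 ltr0n. Qed.

Lemma std_step_gt0 : 0 < std_step.
Proof. by rewrite divr_gt0 ?(diam_block_gt0 nd dom)// mulr_gt0 ?grad_bound_gt0. Qed.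

Lemma std_step_le (D g : R) : diam_block n K x1 <= D -> 0 < g ->
  g <= @grad_bound_block R d n s -> std_step <= D / (g * Num.sqrt T%:R).
Proof.
move=> HD g0 Hg; apply: ler_pM => //.
- by rewrite ltW// (diam_block_gt0 nd dom).
- by rewrite invr_ge0 mulr_ge0 ?(ltW sT)// (ltW grad_bound_gt0).
- by rewrite lef_pV2 ?posrE ?mulr_gt0 ?grad_bound_gt0// ler_pM2r.
Qed.

Lemma std_regret_avg_le (E : R) (G : nat -> 'rV[R]_d) :
  (forall P X, P \in eqparts n ->
    X = omd K (block_mirror n K P) std_step (fun t => dot (G t)) x1 ->
    \sum_(t < T) dot (G t) (X t - X t.+1) <= E) ->
  avg_eqparts n (fun P => omd_regret K (block_mirror n K P) std_step T
    (fun t => dot (G t)) x1) <=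
  diam_block n K x1 * @grad_bound_block R d n s * Num.sqrt T%:R + E.
Proof.
move=> /(block_regret_avg_le nd dom std_step_gt0); congr (_ <= _ + _).
rewrite /std_step; field.
by rewrite !gt_eqF ?(diam_block_gt0 nd dom) ?grad_bound_gt0.
Qed.

End StandardStep.

(** The only block is everything, and the indicator of s coordinates has norm
    sqrt s. *)
Lemma grad_bound_euc_ge (R : realType) (d s : nat) : (0 < s <= d)%N ->
  Num.sqrt s%:R <= @grad_bound_block R d 1 s.
Proof.
move=> /andP[s0 sd]; have nd : (0 < 1 <= d)%N by exact: leq_trans s0 sd.
have card_s := card_ord_lt sd.
pose c : 'rV[R]_d := \row_i (i < s)%N%:R.
apply: (@grad_bound_ge R d 1 s nd c) => //.
  split=> [i|]; first by rewrite mxE; case: (i < s)%N => /=; lra.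
  rewrite -[X in (_ <= X)%N]card_s; apply: subset_leq_card; apply/fintype.subsetP => i.
  by rewrite !inE mxE; case: (i < s)%N; rewrite ?eqxx.
move=> P Pn; have PE := eqparts1 Pn.
have BP : [set: 'I_d]%SET \in P by rewrite PE inE.
apply: le_trans (l2_on_le_block_dual c BP); rewrite ler_wsqrtr//.
rewrite -[X in X%:R <= _]card_s -sum1_card natr_sum big_mkcond/=.
under [leRHS]eq_bigl do rewrite inE.
apply: ler_sum => i _; rewrite mxE; case: ifP; rewrite inE => ->; rewrite ?expr1n ?expr0n//.
Qed.

Section SimplexBounds.
Context {R : realType} {d : nat}.
Variables (i0 : 'I_d) (T s : nat).
Hypothesis (d1 : (1 < d)%N) (T0 : (0 < T)%N).
Local Notation e0 := (delta_mx 0 i0 : 'rV[R]_d).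
Local Notation g := (- e0).
Local Notation x1 := (const_mx d%:R^-1 : 'rV[R]_d).
Local Notation K := (simplex R d).
Let dom := simplex_start_domain (R := R) i0 d1.

Lemma simplex_radius_le1 n : (0 < n <= d)%N -> radius n K <= 1.
Proof.
move=> nd; apply: (radius_le dom) => // P x Pn Kx.
have [x0 <-] := Kx.
by apply: block_norm_le_sum => //; exact: eqparts_partition Pn.
Qed.

Lemma vertex_le_sqrt t (v : 'rV[R]_d) : dot ((fun _ : nat => g) t) v <= Num.sqrt (dot v v).
Proof.
rewrite dotC dotNr dot_delta; apply: (@le_trans _ _ `|v 0 i0|).
  by rewrite -normrN ler_norm.
by rewrite -sqrtr_sqr ler_wsqrtr// sqr_coord_le_dot.
Qed.

Lemma E_regret_block_vertex n : E_regret_block n s (vertex_instance (R := R) i0 T d1) =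
  (avg_eqparts n (fun P => omd_regret K (block_mirror n K P) (std_step K n s x1 T) T
    (fun=> dot g) x1))%:E.
Proof. exact: E_regret_block_linear. Qed.

Definition simplex_const : R := 6 * (1 + expR 6) + 1.

(** The stability sum telescopes to a difference of values of coordinate i0. *)
Lemma simplex_block_regret_le : (3 <= s)%N -> (2 * s <= d)%N ->
  avg_eqparts s (fun P => omd_regret K (block_mirror s K P) (std_step K s s x1 T) T
    (fun=> dot g) x1) <= simplex_const * ln s%:R * Num.sqrt T%:R.
Proof.
move=> s3 s2d.
have s0 : (0 < s)%N by lia.
have sd : (0 < s <= d)%N by lia.
have H := @std_regret_avg_le R d K s s 1 i0 x1 sd dom s0 T T0 1 (fun=> g).
apply: le_trans (H _) _.
  move=> P X Pn XE.
  have XK t : K (X t) by rewrite XE; exact: (block_omd_in s dom P _ (fun=> g) t).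
  have -> : \sum_(t < T) dot g (X t - X t.+1) = X T 0 i0 - X 0%N 0 i0.
    under eq_bigr do rewrite dot_vertex.
    by rewrite -(big_mkord xpredT (fun t => X t.+1 0 i0 - X t 0 i0)) telescope_sumr.
  by have := simplex_le1 i0 (XK T); have := simplex_le1 i0 (XK 0%N); lra.
have Hr := diam_grad_bound_le sd dom s0 (simplex_radius_le1 sd) (leqnn s) s3 s2d.
have l1 := ln_ge1 (R := R) s3.
have sT1 : 1 <= Num.sqrt T%:R :> R by rewrite -[leLHS]sqrtr1 ler_wsqrtr// ler1n.
rewrite mulr1 in Hr.
have := ler_wpM2r (sqrtr_ge0 (T%:R : R)) Hr.
rewrite /simplex_const; nra.
Qed.

Lemma simplex_block_regret_gt0 : (0 < s <= d)%N ->
  0 < avg_eqparts s (fun P => omd_regret K (block_mirror s K P) (std_step K s s x1 T) T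
    (fun=> dot g) x1).
Proof.
move=> sd; have s0 : (0 < s)%N by lia.
apply: (@lt_le_trans _ _ (1 / 2)); first by lra.
apply: avg_eqparts_ge => // P Pn.
have eta0 := std_step_gt0 sd dom s0 T0.
apply: le_trans (block_regret_ge s dom P _ (fun=> g) T (simplex_delta i0)).
apply: (@vertex_regret_ge R d i0 T _ 1%N) => //.
  by move=> t; exact: (block_omd_in s dom P _ (fun=> g) t).
move=> [|//] _; rewrite /= mxE lef_pV2 ?posrE ?ler_nat//; by rewrite ltr0n; lia.
Qed.

(** With D <= 2 and G >= sqrt s a round moves coordinate i0 by at most
    4 / sqrt (s T), so that sqrt (s T) / 16 rounds take it from at most 1/4 to
    at most 1/2. *)
Lemma simplex_euc_regret_ge : (0 < s <= d)%N -> (4 <= d)%N -> (s <= T)%N ->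
  32 <= Num.sqrt (s%:R * T%:R) :> R ->
  Num.sqrt (s%:R * T%:R) / 64 <=
  avg_eqparts 1 (fun P => omd_regret K (block_mirror 1 K P) (std_step K 1 s x1 T) T
    (fun=> dot g) x1).
Proof.
move=> sd d4 sT big; have s0 : (0 < s)%N by lia.
have nd : (0 < 1 <= d)%N by lia.
apply: avg_eqparts_ge => // P Pn.
have eta0 := std_step_gt0 nd dom s0 T0.
set q := Num.sqrt _ in big *.
have q0 : 0 < q by lra.
pose N := Num.truncn (q / 16).
have Nq : N%:R <= q / 16 by rewrite truncn_le//; lra.
have qN : q / 16 < N%:R + 1 by rewrite natr1; have /andP[] := truncn_itv (ltW (divr_gt0 q0 (ltr0n _ 16))).
have qT : q <= T%:R.
  rewrite -(ler_sqr (ltW q0)) ?nnegrE// sqr_sqrtr ?mulr_ge0// expr2.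
  by rewrite ler_wpM2r// ler_nat.
have NT : (N <= T)%N by rewrite -(ler_nat R); lra.
apply: le_trans (block_regret_ge 1 dom P _ (fun=> g) T (simplex_delta i0)).
apply: (@le_trans _ _ (N%:R / 2)); first by lra.
apply: (@vertex_regret_ge R d i0 T _ N) => //.
  by move=> t; exact: (block_omd_in 1 dom P _ (fun=> g) t).
move=> t tN.
have := block_omd_drift_le nd dom Pn eta0 i0 vertex_le_sqrt (leq0n t).
rewrite subn0 ler_norml [omd _ _ _ _ _ 0]/= [x1 0 i0]mxE => /andP[_].
have -> : block_modulus 1 = 2^-1 :> R by rewrite /block_modulus /pexp /gamma/=; lra.
have D2 : diam_block 1 K x1 <= 2.
  have := diam_block_sqr_le nd dom; have := simplex_radius_le1 nd.
  have := radius_ge1 nd dom; have := diam_block_gt0 nd dom.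
  rewrite /gamma/=; set D := diam_block _ _ _; set r := radius _ _; nra.
have eta_le := std_step_le nd dom s0 T0 D2 _ (grad_bound_euc_ge R sd).
have sR : 0 < Num.sqrt s%:R :> R by rewrite sqrtr_gt0 ltr0n.
have {eta_le} := eta_le sR; rewrite -sqrtrM// -/q.
set eta := std_step _ _ _ _ _ => eta_le.
have dV : d%:R^-1 <= 4^-1 :> R by rewrite lef_pV2 ?posrE ?ler_nat ?ltr0n//; lia.
have tq : t%:R <= q / 16 by apply: le_trans Nq; rewrite ler_nat ltnW.
have te : t%:R * eta <= 8^-1.
  apply: (@le_trans _ _ (q / 16 * (2 / q))); first by apply: ler_pM => //; exact: ltW.
  by rewrite le_eqVlt; apply/orP; left; apply/eqP; field; rewrite gt_eqF.
lra.
Qed.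

(** As eta <= sqrt (ln d / T), the weight e^(eta t) / d is at most
    d^(-1/2) <= 1/2 up to t = sqrt (T ln d) / 2. *)
Lemma vertex_ent_regret_ge : (4 <= d)%N -> ln d%:R <= T%:R :> R ->
  8 <= Num.sqrt (ln d%:R * T%:R) :> R ->
  Num.sqrt (ln d%:R * T%:R) / 8 <= regret_ent (I := vertex_instance (R := R) i0 T d1) tt.
Proof.
move=> d4 lT; have l1 : 1 <= ln d%:R :> R by apply: ln_ge1; lia.
have dR : 0 < d%:R :> R by rewrite ltr0n; lia.
set q := Num.sqrt _ => q8.
rewrite /regret_ent diam_ent_vertex.
set eta := _ / (_ * _).
have Gb := @grad_bound_ent_vertex R d i0 T d1 tt T0.
have sT : 0 < Num.sqrt T%:R :> R by rewrite sqrtr_gt0 ltr0n.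
have sl : 0 < Num.sqrt (ln d%:R) :> R by rewrite sqrtr_gt0; lra.
have Gb0 := lt_le_trans ltr01 Gb.
have eta0 : 0 < eta by apply: divr_gt0 => //; apply: mulr_gt0.
have q0 : 0 < q by lra.
have qE : q = Num.sqrt (ln d%:R) * Num.sqrt T%:R by rewrite /q sqrtrM//; lra.
have eta_le : eta <= Num.sqrt (ln d%:R) / Num.sqrt T%:R.
  rewrite /eta ler_pM2l//.
  rewrite lef_pV2 ?posrE//; last exact: mulr_gt0.
  by rewrite ler_peMl// ltW.
pose N := Num.truncn (q / 2).
have Nq : N%:R <= q / 2 by rewrite truncn_le//; lra.
have qN : q / 2 < N%:R + 1 by rewrite natr1; have /andP[] := truncn_itv (ltW (divr_gt0 q0 (ltr0n _ 2))).
have qT : q <= T%:R.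
  rewrite -(ler_sqr (ltW q0)) ?nnegrE// sqr_sqrtr ?mulr_ge0//; last lra.
  by rewrite expr2 ler_wpM2r.
have NT : (N <= T)%N by rewrite -(ler_nat R); lra.
have [u _ [_ H]] := @omd_regret_linear R d K h_ent eta (dom_comp dom) T (fun=> g) x1 (dom_start dom).
apply: le_trans (H _ (simplex_delta i0)).
apply: (@le_trans _ _ (N%:R / 2)); first by lra.
apply: (@vertex_regret_ge R d i0 T _ N) => //.
  move=> t; rewrite entropic_omd//; split=> [i|].
    by rewrite mxE divr_ge0 ?expR_ge0 ?(ltW (ent_total_gt0 _ _ _)).
  under eq_bigr do rewrite mxE.
  by rewrite -mulr_suml mulfV// gt_eqF// ent_total_gt0.
move=> t tN; apply: le_trans (entropic_omd_le _ _ _ _) _ => //.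
have tq : t%:R <= q / 2 by apply: le_trans Nq; rewrite ler_nat ltnW.
have et : eta * t%:R <= ln d%:R / 2.
  apply: (@le_trans _ _ (Num.sqrt (ln d%:R) / Num.sqrt T%:R * (q / 2))).
    by apply: ler_pM => //; exact: ltW.
  rewrite qE -[X in _ <= X / 2](sqr_sqrtr (_ : 0 <= ln d%:R)); last by lra.
  by rewrite le_eqVlt; apply/orP; left; apply/eqP; field; rewrite gt_eqF.
rewrite ler_pdivrMr//; apply: le_trans (_ : expR (ln d%:R / 2) <= _); first by rewrite ler_expR.
set w := expR _; have w2 : w ^+ 2 = d%:R.
  by rewrite /w -expRM_natl mulrC divfK// lnK ?posrE.
have w0 : 0 < w := expR_gt0 _.
have : 4 <= d%:R :> R by rewrite ler_nat.
by rewrite -w2; nra.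
Qed.

End SimplexBounds.

(** * The separation over the simplex *)

Lemma exists_ln_ge (R : realType) (X : R) :
  exists d0 : nat, forall d : nat, (d0 <= d)%N -> X <= ln d%:R.
Proof.
exists (Num.truncn (expR X)).+1 => d dX.
have eX : expR X < d%:R.
  apply: (@lt_le_trans _ _ (Num.truncn (expR X)).+1%:R); last by rewrite ler_nat.
  by have /andP[] := truncn_itv (expR_ge0 X).
rewrite -[leLHS]expRK ler_ln ?posrE ?expR_gt0 ?ltW//.
exact: lt_trans (expR_gt0 X) eX.
Qed.

Lemma ln_le_half (R : realType) (d : nat) : (0 < d)%N -> ln d%:R <= d%:R / 2 :> R.
Proof.
move=> d0; have dR : 0 < d%:R :> R by rewrite ltr0n.
have l2 : ln 2 <= 1 :> R by apply: (@le_trans _ _ (ln (1 + 1))) => //; apply: le_ln1Dx; lra.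
have -> : d%:R = 2 * (1 + (d%:R / 2 - 1)) :> R by field.
rewrite lnM ?posrE//; last by lra.
have := @le_ln1Dx R (d%:R / 2 - 1).
have : -1 < d%:R / 2 - 1 :> R by lra.
by move=> h /(_ h); lra.
Qed.

(** Between s and ln d there is only rounding: the block norm pays
    ln s sqrt T, the two others sqrt (T ln d) up to constants. *)
Lemma simplex_part (R : realType) (d : nat) : (4 : R) <= ln d%:R ->
  exists T0 : nat, forall T : nat, (T0 <= T)%N ->
    let s := Num.truncn (ln (d%:R : R)) in
     exists I : oco_instance (simplex R d) T,
       [/\ (forall i, 0 < start I 0 i), sparse_losses s I,
           [/\ integrable_regret_euc s I, integrable_regret_ent I
             & integrable_regret_block s s I],
           (0 < E_regret_block s s I)%E
         & (((128 * simplex_const)^-1 * (Num.sqrt (ln d%:R) / ln (ln d%:R)))%:E * E_regret_block s s I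
            <= Order.min (E_regret_euc s I) (E_regret_ent I))%E].
Proof.
move=> L4; set L : R := ln d%:R.
have d0 : (0 < d)%N.
  by case: d @L L4 => // L; rewrite ln0// => ?; exfalso; lra.
have dL := ln_le_half R d0; rewrite -/L in dL L4.
have d4 : (4 <= d)%N by rewrite -(ler_nat R); lra.
have d1 : (1 < d)%N by lia.
set s := Num.truncn L.
have L0 : 0 <= L by lra.
have sL : s%:R <= L by rewrite truncn_le.
have Ls : L < s%:R + 1 by rewrite natr1; have /andP[] := truncn_itv L0.
have s3 : (3 <= s)%N by rewrite -(ler_nat R); lra.
have s2d : (2 * s <= d)%N by rewrite -(ler_nat R) natrM; lra.
have sd : (0 < s <= d)%N by lia.
exists (1024 + s.+1)%N => T TT.
have T0 : (0 < T)%N by lia.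
have TR : 1024 <= T%:R :> R by rewrite (ler_nat _ 1024 T); lia.
have TL : L <= T%:R.
  by apply: ltW; apply: (lt_le_trans Ls); rewrite natr1 ler_nat; lia.
have sT : (s <= T)%N by lia.
pose i0 := Ordinal d0.
have s1 : 3 <= s%:R :> R by rewrite (ler_nat _ 3).
have q32 : 32 <= Num.sqrt (s%:R * T%:R) :> R.
  rewrite -[leLHS]ger0_norm// -sqrtr_sqr ler_wsqrtr//.
  by nra.
have qs : Num.sqrt (L * T%:R) / 2 <= Num.sqrt (s%:R * T%:R).
  rewrite -ler_sqr ?nnegrE ?divr_ge0 ?sqrtr_ge0// expr_div_n !sqr_sqrtr ?mulr_ge0//.
  nra.
have q8 : 8 <= Num.sqrt (L * T%:R).
  rewrite -[leLHS]ger0_norm// -sqrtr_sqr ler_wsqrtr//; nra.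
clear TR.
have q64 : Num.sqrt (L * T%:R) / 128 <= Num.sqrt (s%:R * T%:R) / 64 by lra.
have q128 : Num.sqrt (L * T%:R) / 128 <= Num.sqrt (L * T%:R) / 8 by lra.
have C0 : 0 < simplex_const :> R by rewrite /simplex_const; have := expR_gt0 (6 : R); lra.
have lnL : 0 < ln L by rewrite ln_gt0//; lra.
have lns : ln s%:R <= ln L by rewrite ler_ln ?posrE//; lra.
exists (vertex_instance i0 T d1).
have Hup := @simplex_block_regret_le R d i0 T s d1 T0 s3 s2d.
have Hgt := @simplex_block_regret_gt0 R d i0 T s d1 T0 sd.
have Heuc := @simplex_euc_regret_ge R d i0 T s d1 T0 sd d4 sT q32.
have Hent := @vertex_ent_regret_ge R d i0 T d1 T0 d4 TL q8.
split.
- by move=> i; rewrite /= mxE invr_gt0 ltr0n.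
- by apply: vertex_sparse; case/andP: sd.
- split; [exact: integrable_regret_block_linear|exact: integrable_regret_ent_linear|].
  exact: integrable_regret_block_linear.
- by rewrite E_regret_block_vertex lte_fin; exact: Hgt.
rewrite /E_regret_euc !E_regret_block_vertex E_regret_ent_linear -EFin_min -EFinM lee_fin.
have main : (128 * simplex_const)^-1 * (Num.sqrt L / ln L) *
   avg_eqparts s (fun P => omd_regret (simplex R d) (block_mirror s (simplex R d) P)
      (std_step (simplex R d) s s (const_mx d%:R^-1) T) T
      (fun=> dot (- delta_mx 0 i0)) (const_mx d%:R^-1)) <= Num.sqrt (L * T%:R) / 128.
  apply: (@le_trans _ _ ((128 * simplex_const)^-1 * (Num.sqrt L / ln L) *
     (simplex_const * ln L * Num.sqrt T%:R))).
    apply: ler_wpM2l.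
      by rewrite mulr_ge0 ?invr_ge0 ?divr_ge0 ?mulr_ge0 ?sqrtr_ge0// ltW.
    apply: (le_trans Hup); apply: ler_wpM2r; first exact: sqrtr_ge0.
    by apply: ler_wpM2l => //; exact: ltW.
  rewrite sqrtrM//.
  by rewrite le_eqVlt; apply/orP; left; apply/eqP; field; rewrite !gt_eqF.
rewrite le_min; apply/andP; split; apply: (le_trans main).
  exact: le_trans q64 Heuc.
exact: le_trans q128 Hent.
Qed.

(** * The spiked simplex *)

Section SpikedSimplex.
Local Open Scope convex_scope.
Context {R : realType} {d : nat}.
Variable rho : R.
Hypotheses (rho1 : 1 < rho) (d0 : (0 < d)%N).
Implicit Types (x z : 'rV[R]_d).
Local Notation spike := (const_mx (rho / d%:R) : 'rV[R]_d).

Let dR : 0 < d%:R :> R. Proof. by rewrite ltr0n. Qed.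
Let rB1 : 0 < rho - 1. Proof. by rewrite subr_gt0. Qed.
Let rho0 : 0 < rho. Proof. exact: lt_trans rho1. Qed.

(** A point of the hull with coordinate sum S has weight (S - 1) / (rho - 1) on
    the spike; the inequalities say that the rest is nonnegative. *)
Definition spiked_polytope : set 'rV[R]_d :=
  [set x | 1 <= \sum_i x 0 i <= rho /\
    forall i, (\sum_i x 0 i - 1) * (rho / d%:R) <= x 0 i * (rho - 1)].

Definition spiked_simplex : set 'rV[R]_d := conv_hull (simplex R d `|` [set spike]).

Lemma sum_spike : \sum_i spike 0 i = rho.
Proof.
under eq_bigr do rewrite mxE.
by rewrite sumr_const card_ord -[LHS]mulr_natr divfK// gt_eqF.
Qed.

Lemma conv_rVE (t : {i01 R}) (x z : 'rV[R]_d) :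
  ((x : convex_lmodType 'rV[R]_d) <| t |> z) = t%:num *: x + (1 - t%:num) *: z :> 'rV[R]_d.
Proof. by []. Qed.

Lemma sum_conv (a b : R) x z :
  \sum_i (a *: x + b *: z) 0 i = a * \sum_i x 0 i + b * \sum_i z 0 i.
Proof. by rewrite !mulr_sumr -big_split; apply: eq_bigr => i _; rewrite !mxE. Qed.

Lemma spiked_polytope_conv (t : R) x z : 0 <= t <= 1 ->
  spiked_polytope x -> spiked_polytope z ->
  spiked_polytope (t *: x + (1 - t) *: z).
Proof.
move=> /andP[t0 t1] [/andP[x1 x2] xi] [/andP[z1 z2] zi]; split.
  by rewrite sum_conv; apply/andP; split; nra.
move=> i; rewrite sum_conv !mxE.
move: (xi i) (zi i); set S := \sum_i x 0 i; set S' := \sum_i z 0 i.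
have -> : (t * S + (1 - t) * S' - 1) * (rho / d%:R) =
    t * ((S - 1) * (rho / d%:R)) + (1 - t) * ((S' - 1) * (rho / d%:R)) by ring.
have -> : (t * x 0 i + (1 - t) * z 0 i) * (rho - 1) =
    t * (x 0 i * (rho - 1)) + (1 - t) * (z 0 i * (rho - 1)) by ring.
by move=> h1 h2; apply: lerD; apply: ler_wpM2l => //; lra.
Qed.

Lemma spiked_simplexE : spiked_simplex = spiked_polytope.
Proof.
apply/seteqP; split.
  apply: smallest_sub.
    move=> x z t; rewrite !inE => xK zK; rewrite conv_rVE.
    by apply: spiked_polytope_conv => //; apply/andP; split.
  move=> x [[x0 x1]|->]; split.
  - by rewrite x1 lexx ltW.
  - by move=> i; rewrite x1 subrr mul0r mulr_ge0// subr_ge0 ltW.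
  - by rewrite sum_spike lexx ltW.
  - by move=> i; rewrite sum_spike mxE mulrC.
move=> x [/andP[x1 x2] xi] A [Aconv GA].
set S := \sum_i x 0 i in x1 x2 xi.
have [Sr|Sr] := eqVneq S rho.
  suff -> : x = spike by apply: GA; right.
  have xge i : rho / d%:R <= x 0 i.
    by have := xi i; rewrite Sr [leLHS]mulrC ler_pM2r.
  have H : \sum_i (x 0 i - rho / d%:R) = 0.
    rewrite sumrB -/S Sr; have := sum_spike; under eq_bigr do rewrite mxE.
    by move=> ->; rewrite subrr.
  apply/rowP => i; rewrite mxE; apply/eqP; rewrite -subr_eq0.
  have := introT eqP H; rewrite psumr_eq0; last by move=> j _; rewrite subr_ge0.
  by move=> /allP/(_ i); rewrite mem_index_enum => /(_ isT).
have {}Sr : S < rho by rewrite lt_neqAle Sr.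
pose t := (S - 1) / (rho - 1).
have t0 : 0 <= t by rewrite divr_ge0//; lra.
have t1 : t < 1 by rewrite ltr_pdivrMr//; lra.
have tE : t * (rho - 1) = S - 1 by rewrite divfK// gt_eqF.
pose p : 'rV[R]_d := (1 - t)^-1 *: (x - t *: spike).
have ps : simplex R d p.
  split=> [i|].
    rewrite !mxE mulr_ge0 ?invr_ge0 ?subr_ge0 ?(ltW t1)//.
    by have := xi i; rewrite -tE mulrAC ler_pM2r.
  under eq_bigr do rewrite mxE.
  rewrite -mulr_sumr; have -> : \sum_i (x - t *: spike) 0 i = 1 - t.
    rewrite (_ : x - t *: spike = 1 *: x + (- t) *: spike); last by rewrite scale1r scaleNr.
    by rewrite sum_conv sum_spike -/S; lra.
  by rewrite mulVf// gt_eqF//; lra.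
have := Aconv spike p (Itv01 t0 (ltW t1)); rewrite !inE conv_rVE/=.
have -> : t *: spike + (1 - t) *: p = x.
  by rewrite scalerA mulfV ?gt_eqF ?subr_gt0// scale1r addrC subrK.
by apply; apply: GA; [right|left].
Qed.

Lemma spiked_ge0 x i : spiked_polytope x -> 0 <= x 0 i.
Proof.
move=> [/andP[x1 _] /(_ i)].
have : 0 <= (\sum_i x 0 i - 1) * (rho / d%:R).
  by rewrite mulr_ge0 ?divr_ge0 ?(ltW rho0)// subr_ge0.
by move=> h1 h2; rewrite -(pmulr_lge0 _ rB1); exact: le_trans h2.
Qed.

Lemma spiked_le x i : spiked_polytope x -> 0 <= x 0 i <= rho.
Proof.
move=> xK; rewrite spiked_ge0//=; have [/andP[_]] := xK.
rewrite (bigD1 i)//= => + _; apply: le_trans; rewrite lerDl.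
by apply: sumr_ge0 => j _; exact: spiked_ge0.
Qed.

Lemma closed_spiked : closed spiked_polytope.
Proof.
rewrite (_ : spiked_polytope = ([set x : 'rV[R]_d | 0 <= \sum_i x 0 i - 1] `&`
    [set x : 'rV[R]_d | \sum_i x 0 i - rho <= 0]) `&`
   (\bigcap_(i in [set: 'I_d]) [set x : 'rV[R]_d |
      0 <= x 0 i * (rho - 1) - (\sum_i x 0 i - 1) * (rho / d%:R)])); last first.
  apply/seteqP; split=> x /=.
    move=> [/andP[x1 x2] xi]; split; first by split; lra.
    by move=> i _ /=; rewrite subr_ge0.
  move=> [[x1 x2] xi]; split; first by apply/andP; split; lra.
  by move=> i; have := xi i I; rewrite /= subr_ge0.
have sc (c : R) : continuous (fun x : 'rV[R]_d => \sum_i x 0 i - c).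
  move=> x; apply: (@continuousB R R^o _ (fun x : 'rV[R]_d => \sum_i x 0 i) (fun=> c)).
    exact: sum_coord_cts.
  exact: cst_continuous.
apply: closedI; first by apply: closedI; [apply: closed_ge0|apply: closed_le0].
apply: closed_bigI => i _; apply: closed_ge0 => x.
apply: (@continuousB R R^o _ (fun x : 'rV[R]_d => x 0 i * (rho - 1))
  (fun x : 'rV[R]_d => (\sum_i x 0 i - 1) * (rho / d%:R))).
  refine (@continuousM R _ (fun x : 'rV[R]_d => x 0 i) (fun=> rho - 1) x _ (@cst_continuous _ _ _ _)).
  exact: coord_cts.
refine (@continuousM R _ (fun x : 'rV[R]_d => \sum_i x 0 i - 1) (fun=> rho / d%:R) x _ (@cst_continuous _ _ _ _)).
exact: sc.
Qed.

Lemma simplex_spiked x : simplex R d x -> spiked_polytope x.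
Proof. by move=> xs; rewrite -spiked_simplexE; apply: sub_gen_smallest; left. Qed.

Lemma spiked_start_domain (i0 : 'I_d) x1 : simplex R d x1 ->
  x1 != delta_mx 0 i0 -> start_domain spiked_simplex rho i0 x1.
Proof.
move=> x1s x1i0; rewrite spiked_simplexE; split=> //.
- move=> x z t Kx Kz /andP[t0 t1].
  have -> : x + t *: (z - x) = t *: z + (1 - t) *: x.
    by rewrite scalerBr scalerBl scale1r addrCA.
  by apply: spiked_polytope_conv => //; apply/andP; split.
- exact: compact_box_closed closed_spiked spiked_le.
- by move=> x i; exact: spiked_ge0.
- by move=> x [/andP[]].
- by apply: simplex_spiked; exact: simplex_delta.
- exact: simplex_spiked.
Qed.

(** A convex function is bounded on the hull by its bound on the generators. *)
Lemma spiked_block_norm_le P (X : R) x : finset.partition P [set: 'I_d]%SET ->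
  1 <= X -> block_norm P spike <= X -> spiked_simplex x -> block_norm P x <= X.
Proof.
move=> hP X1 Xs.
suff : spiked_simplex `<=` [set x | block_norm P x <= X] by apply.
apply: smallest_sub.
  move=> y z t; rewrite !inE /= conv_rVE => yX zX.
  apply: (le_trans (block_normD _ _ _)).
  have t0 : 0 <= t%:num by [].
  have t1 : t%:num <= 1 by [].
  have t1' : 0 <= 1 - t%:num by rewrite subr_ge0.
  rewrite (block_normZ _ _ t0) (block_normZ _ _ t1').
  move: t0 t1' yX zX; move: (t%:num) => u; nra.
move=> y [[y0 y1]|->] //=; apply: le_trans X1; rewrite -y1.
exact: block_norm_le_sum.
Qed.

(** Blocks of exactly d / n elements would give the norm
    n (rho / d) sqrt (d / n) = sqrt n / rho <= 1; the factor 2 absorbs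
    rounding. *)
Lemma spike_block_norm_le n P : (0 < n)%N -> n%:R <= rho ^+ 2 -> rho ^+ 4 = d%:R ->
  P \in @eqparts d n -> block_norm P spike <= 2.
Proof.
move=> n0 nr r4 Pn.
have nR : 0 < n%:R :> R by rewrite ltr0n.
have -> : 2 = \sum_(B in P) (2 / n%:R) :> R.
  by rewrite sumr_const (eqparts_card Pn) -[RHS]mulr_natr divfK// gt_eqF.
apply: ler_sum => B BP; rewrite l2_on_le ?divr_ge0//.
have -> : dot_on B spike spike = #|B|%:R * (rho / d%:R) ^+ 2.
  by rewrite /dot_on; under eq_bigr do rewrite !mxE; rewrite sumr_const -[LHS]mulr_natl expr2.
have nB : n%:R * #|B|%:R <= 2 * d%:R :> R.
  have := card_eqparts_block d0 Pn BP; rewrite -(ltr_nat R) natrM => h.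
  have B0 := partition_block_gt0 (eqparts_partition Pn) BP.
  have -> : #|B|%:R = #|B|.-1%:R + 1 :> R by rewrite natr1 prednK.
  rewrite mulrDr mulr1.
  have : rho ^+ 2 <= d%:R by rewrite -r4 ler_eXn2l.
  lra.
rewrite -r4 in nB *; rewrite !expr_div_n.
rewrite -(ler_pM2l (exprn_gt0 2 nR)).
have -> : n%:R ^+ 2 * (2 ^+ 2 / n%:R ^+ 2) = 4 :> R by field; rewrite gt_eqF.
have -> : n%:R ^+ 2 * (#|B|%:R * (rho ^+ 2 / (rho ^+ 4) ^+ 2)) =
  (n%:R * (n%:R * #|B|%:R)) / rho ^+ 6 by field; rewrite gt_eqF.
rewrite ler_pdivrMr ?exprn_gt0//.
apply: (@le_trans _ _ (rho ^+ 2 * (2 * rho ^+ 4))).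
  by apply: ler_pM => //; rewrite mulr_ge0.
have r6 : 0 < rho ^+ 6 by rewrite exprn_gt0.
have -> : rho ^+ 2 * (2 * rho ^+ 4) = 2 * rho ^+ 6 by ring.
by rewrite ler_pM2r//; lra.
Qed.

End SpikedSimplex.

Lemma K_mixE (R : realType) (d : nat) : (0 < d)%N ->
  K_mix R d = @spiked_simplex R d (d%:R `^ (1 / 4)).
Proof.
move=> d0; rewrite /K_mix /spiked_simplex; congr (conv_hull (_ `|` [set const_mx _])).
have dn0 : d%:R != 0 :> R by rewrite pnatr_eq0 -lt0n.
rewrite -[X in _ = _ / X]powRr1// -powRN -powRD ?dn0 ?implybT//.
by congr (_ `^ _); field.
Qed.

Lemma quarter_powE (R : realType) (d : nat) : (d%:R `^ (1 / 4)) ^+ 4 = d%:R :> R.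
Proof.
rewrite -powR_mulrn ?powR_ge0// -powRrM (_ : 1 / 4 * 4%:R = 1) ?powRr1//.
by field.
Qed.

(** * Cyclic losses *)

Section CyclicLosses.
Context {R : realType}.
Variables (m : nat) (m0 : (0 < m)%N) (N T : nat).
Hypothesis NT : (N * m <= T)%N.
Implicit Types (x u v : 'rV[R]_m.+1) (X : nat -> 'rV[R]_m.+1).

Definition cyc_idx (t : nat) : 'I_m.+1 := lift ord0 (Ordinal (ltn_pmod t m0)).

(** The losses stop after N cycles.  With N of order sqrt T the stability sum
    is bounded, while missing the spike in N cycles is already as expensive as
    the lower bounds require. *)
Definition cyc_grad (t : nat) : 'rV[R]_m.+1 :=
  if (t < N * m)%N then - delta_mx 0 (cyc_idx t) else 0.

Definition tail_sum x : R := \sum_(j < m) x 0 (lift ord0 j).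

Lemma sum_head_tail x : \sum_i x 0 i = x 0 ord0 + tail_sum x.
Proof. exact: big_ord_recl. Qed.

Lemma cyc_idxE (k : nat) (j : 'I_m) : cyc_idx (k * m + j) = lift ord0 j.
Proof. by congr lift; apply: val_inj; rewrite /= modnMDl modn_small. Qed.

Lemma dot_cyc_grad t v :
  dot (cyc_grad t) v = if (t < N * m)%N then - v 0 (cyc_idx t) else 0.
Proof.
rewrite /cyc_grad; case: ifP => _; first by rewrite dotC dotNr dot_delta.
by rewrite /dot big1// => i _; rewrite mxE mul0r.
Qed.

Lemma dot_cyc_grad_le t v : dot (cyc_grad t) v <= Num.sqrt (dot v v).
Proof.
rewrite dot_cyc_grad; case: ifP => _; last exact: sqrtr_ge0.
apply: (@le_trans _ _ `|v 0 (cyc_idx t)|); first by rewrite -normrN ler_norm.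
by rewrite -sqrtr_sqr ler_wsqrtr// sqr_coord_le_dot.
Qed.

Lemma sum_cycles (f : nat -> R) k :
  \sum_(t < k * m) f t = \sum_(l < k) \sum_(j < m) f (l * m + j)%N.
Proof.
elim: k => [|k IH]; first by rewrite mul0n !big_ord0.
rewrite big_ord_recr/= -IH mulSn addnC big_split_ord/=; congr (_ + _).
Qed.

Lemma sum_cyc_grad_prefix (F : nat -> 'rV[R]_m.+1) k : (k <= N)%N ->
  \sum_(t < k * m) dot (cyc_grad t) (F t) =
  - \sum_(l < k) \sum_(j < m) F (l * m + j)%N 0 (lift ord0 j).
Proof.
move=> kN; rewrite -sumrN (eq_bigr (fun t : 'I_(k * m) => - F t 0 (cyc_idx t))).
  rewrite (sum_cycles (fun t => - F t 0 (cyc_idx t))); apply: eq_bigr => l _.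
  by rewrite -sumrN; apply: eq_bigr => j _; rewrite cyc_idxE.
move=> t _; rewrite dot_cyc_grad ifT//.
by apply: leq_trans (ltn_ord t) _; rewrite leq_mul2r kN orbT.
Qed.

Lemma sum_cyc_grad (F : nat -> 'rV[R]_m.+1) :
  \sum_(t < T) dot (cyc_grad t) (F t) =
  - \sum_(l < N) \sum_(j < m) F (l * m + j)%N 0 (lift ord0 j).
Proof.
rewrite -sum_cyc_grad_prefix//.
rewrite -(big_mkord xpredT (fun t => dot (cyc_grad t) (F t))).
rewrite (big_cat_nat (n := N * m))//= [X in _ + X]big_nat_cond [X in _ + X]big1 ?addr0; last first.
  by move=> t /andP[/andP[h _] _]; rewrite dot_cyc_grad ltnNge h.
by rewrite big_mkord.
Qed.

Section Drift.
Variables (X : nat -> 'rV[R]_m.+1) (delta : R).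
Hypotheses (delta0 : 0 <= delta)
  (Xd : forall s t i, (s <= t)%N -> `|X t 0 i - X s 0 i| <= (t - s)%:R * delta).

(** The regret evaluates the iterate before the loss (e = 0), the telescoped
    inequality after it (e = 1). *)
Lemma cycle_sum_le (e k : nat) : (e <= 1)%N ->
  \sum_(j < m) X (k * m + j + e)%N 0 (lift ord0 j) <=
  tail_sum (X (k * m)%N) + m%:R ^+ 2 * delta.
Proof.
move=> e1; have -> : m%:R ^+ 2 * delta = \sum_(j < m) m%:R * delta.
  by rewrite sumr_const card_ord -[RHS]mulr_natl expr2 mulrA.
rewrite -big_split/=; apply: ler_sum => j _.
have le : (k * m <= k * m + j + e)%N by rewrite -addnA leq_addr.
have := Xd (lift ord0 j) le; rewrite ler_norml => /andP[_].
have : (k * m + j + e - k * m)%:R * delta <= m%:R * delta.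
  apply: ler_wpM2r => //; rewrite ler_nat -addnA addKn.
  by apply: leq_trans (leq_add (leqnn j) e1) _; rewrite addn1.
by lra.
Qed.

Lemma cyc_stability : \sum_(t < T) dot (cyc_grad t) (X t - X t.+1) <= N%:R * m%:R * delta.
Proof.
rewrite (sum_cyc_grad (fun t => X t - X t.+1)) -sumrN.
have -> : N%:R * m%:R * delta = \sum_(l < N) \sum_(j < m) delta.
  under eq_bigr do rewrite sumr_const card_ord.
  by rewrite sumr_const card_ord -[RHS]mulr_natl -[X in _ = _ * X]mulr_natl mulrA.
apply: ler_sum => l _; rewrite -sumrN; apply: ler_sum => j _.
have := Xd (lift ord0 j) (leqnSn (l * m + j)); rewrite subSnn mul1r !mxE ler_norml.
by lra.
Qed.

(** A cycle charges each coordinate of the tail once; up to the drift within the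
    cycle, that is the tail sum at its beginning. *)
Lemma cyc_regret_ge u :
  \sum_(l < N) (tail_sum u - tail_sum (X (l * m)%N)) - N%:R * (m%:R ^+ 2 * delta) <=
  \sum_(t < T) dot (cyc_grad t) (X t - u).
Proof.
rewrite (sum_cyc_grad (fun t => X t - u)) -sumrN.
have -> : N%:R * (m%:R ^+ 2 * delta) = \sum_(l < N) m%:R ^+ 2 * delta.
  by rewrite sumr_const card_ord -[RHS]mulr_natl.
rewrite -sumrB; apply: ler_sum => l _.
have := @cycle_sum_le 0 l (leq0n 1).
have -> : \sum_(j < m) (X (l * m + j)%N - u) 0 (lift ord0 j) =
   \sum_(j < m) X (l * m + j + 0)%N 0 (lift ord0 j) - tail_sum u.
  by rewrite -sumrB; apply: eq_bigr => j _; rewrite !mxE addn0.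
by lra.
Qed.

End Drift.

End CyclicLosses.

(** * The exact trajectory for singleton blocks *)

Section HalfRow.
Context {R : realType}.
Variables (m : nat).
Hypothesis m0 : (0 < m)%N.

Definition half_row (a : 'I_m -> R) : 'rV[R]_m.+1 :=
  \row_i (if unlift ord0 i is Some j then a j else 2^-1).

Lemma half_row0 a : half_row a 0 ord0 = 2^-1.
Proof. by rewrite mxE unlift_none. Qed.

Lemma half_row_lift a j : half_row a 0 (lift ord0 j) = a j.
Proof. by rewrite mxE liftK. Qed.

Lemma sum_half_row a : \sum_i half_row a 0 i = 2^-1 + \sum_j a j.
Proof.
rewrite sum_head_tail half_row0; congr (_ + _).
by apply: eq_bigr => j _; rewrite half_row_lift.
Qed.

Definition half_start : 'rV[R]_m.+1 := half_row (fun=> (2 * m%:R)^-1).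

Let mR : 0 < m%:R :> R. Proof. by rewrite ltr0n. Qed.

Lemma tail_half_start : tail_sum half_start = 2^-1.
Proof.
rewrite /tail_sum; under eq_bigr do rewrite half_row_lift.
by rewrite sumr_const card_ord -[LHS]mulr_natr; field; rewrite gt_eqF.
Qed.

Lemma half_row_ind (Q : R -> Prop) a : Q 2^-1 -> (forall j, Q (a j)) ->
  forall i, Q (half_row a 0 i).
Proof.
by move=> Q0 Qa i; rewrite mxE; case: unliftP => [j _|_]; [exact: Qa|exact: Q0].
Qed.

Lemma half_start_simplex : simplex R m.+1 half_start.
Proof.
split; last by rewrite sum_head_tail half_row0 tail_half_start; lra.
by apply: (@half_row_ind (fun z => 0 <= z)) => [|_]; rewrite ?invr_ge0 ?mulr_ge0// ltW.
Qed.

Lemma half_start_neq : half_start != delta_mx 0 ord0.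
Proof.
apply/eqP => /rowP/(_ ord0); rewrite half_row0 mxE !eqxx/= => h.
by have : 2^-1 = 1 :> R by []; lra.
Qed.

End HalfRow.

Section Coordinatewise.
Context {R : realType}.
Variables (m : nat) (rho : R).
Hypotheses (m1 : (1 < m)%N) (rho2 : 2 <= rho) (rho_m : rho <= m%:R).
Let m0 : (0 < m)%N := ltnW m1.
Let mR : 0 < m%:R :> R. Proof. by rewrite ltr0n. Qed.
Let rho1 : 1 < rho. Proof. by apply: lt_le_trans rho2; rewrite ltr1n. Qed.
Local Notation d := (m.+1).
Local Notation K := (spiked_simplex (d := d) rho).
Local Notation x1 := (half_start (R := R) m).

Lemma half_start_domain : start_domain K rho ord0 x1.
Proof.
by apply: spiked_start_domain => //; [exact: half_start_simplex|exact: half_start_neq].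
Qed.

Let dom := half_start_domain.
Let nd : (0 < d <= d)%N. Proof. by rewrite /= leqnn. Qed.
Local Notation r := (radius d K).
Local Notation g := (gamma d : R).
Local Notation q := (pexp d - 1 : R).
Let r0 : 0 < r. Proof. exact: radius_gt0 nd dom. Qed.
Let g0 : 0 < g. Proof. exact: gamma_gt0. Qed.
Let q0 : 0 < q. Proof. by have /andP[] := pexpB1_itv (R := R) d. Qed.

Section Partition.
Variable P : {set {set 'I_d}}.
Hypothesis Pd : P \in eqparts d.

Lemma pblock_eqparts_full i : finset.pblock P i = [set i]%SET.
Proof.
have hP := eqparts_partition Pd.
have iP : i \in finset.cover P by rewrite (cover_partition hP) inE.
have /eqP/cards1P [j e] := eqparts_full_card1 Pd (pblock_mem iP).
have : i \in finset.pblock P i by rewrite mem_pblock.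
by rewrite e inE => /eqP ->.
Qed.

Lemma grad_full_mirror (x : 'rV[R]_d) i : 0 < x 0 i ->
  grad (block_mirror d K P) x 0 i = r / g * (x 0 i / r) `^ q.
Proof.
move=> xi; rewrite (grad_block_mirrorE nd dom Pd) !mxE (eqparts_card Pd).
congr (_ * _); rewrite pblock_eqparts_full mulrC.
have -> : l2_on [set i]%SET (r^-1 *: x) = r^-1 * x 0 i.
  rewrite /l2_on big_set1 mxE sqrtr_sqr ger0_norm// mulr_ge0// ?invr_ge0 ?(ltW r0)//.
  exact: ltW.
have y0 : 0 < r^-1 * x 0 i by rewrite mulr_gt0 ?invr_gt0.
rewrite [x 0 i / r]mulrC -{1}[r^-1 * x 0 i](powRr1 (ltW y0)) -powRD; last first.
  by rewrite (gt_eqF y0) implybT.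
by congr (_ `^ _); ring.
Qed.

Variables (N : nat) (eta : R).
Hypothesis (eta0 : 0 < eta).

(** In the mirror coordinate (r / g) (x_i / r)^q a visit of coordinate i adds
    eta; relative to the initial value that is the amount w.  After k visits
    the coordinate itself has grown by the factor [growth k]. *)
Definition growth_rate : R := eta * g / (r * ((2 * m%:R)^-1 / r) `^ q).
Local Notation w := growth_rate.
Definition growth (k : nat) : R := (1 + k%:R * w) `^ q^-1.

Hypotheses (step_small : expR (w / q) <= 1 + rho^-1)
  (total_small : expR (N%:R * w / q) <= rho / 2).

Let y0 : 0 < ((2 * m%:R)^-1 / r) `^ q :> R.
Proof. by rewrite powR_gt0// divr_gt0// invr_gt0 mulr_gt0. Qed.

Let w0 : 0 < w.
Proof. by rewrite divr_gt0 ?mulr_gt0. Qed.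

Lemma growth_base_ge1 k : 1 <= 1 + k%:R * w.
Proof. by rewrite lerDl mulr_ge0// ltW. Qed.

Let base_gt0 k : 0 < 1 + k%:R * w.
Proof. exact: lt_le_trans (growth_base_ge1 k). Qed.

Lemma growth_ge1 k : 1 <= growth k.
Proof.
rewrite -(powRr0 (1 + k%:R * w)) ler_powR ?growth_base_ge1//.
by rewrite invr_ge0 ltW.
Qed.

Lemma growth_le_expR k : growth k <= expR (k%:R * w / q).
Proof.
rewrite /growth /powR gt_eqF// ler_expR mulrC ler_pM2r ?invr_gt0//.
apply: le_ln1Dx; apply: (@lt_le_trans _ _ 0); first by rewrite ltrN10.
by rewrite mulr_ge0// ltW.
Qed.

Lemma ler_growth k l : (k <= l)%N -> growth k <= growth l.
Proof.
move=> kl; apply: ge0_ler_powR; rewrite ?nnegrE ?invr_ge0 ?(ltW q0) ?(ltW (base_gt0 _))//.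
by rewrite lerD2l ler_wpM2r ?(ltW w0)// ler_nat.
Qed.

Lemma growth_le k : (k <= N)%N -> growth k <= rho / 2.
Proof.
move=> kN; apply: le_trans (growth_le_expR k) _; apply: le_trans total_small.
rewrite ler_expR ler_pM2r ?invr_gt0// ler_wpM2r ?(ltW w0)//.
by rewrite ler_nat.
Qed.

Lemma growthS_le k : growth k.+1 <= growth k * (1 + rho^-1).
Proof.
have h1 : growth 1 <= 1 + rho^-1.
  by apply: le_trans (growth_le_expR 1) _; rewrite mul1r.
apply: le_trans (ler_wpM2l (powR_ge0 _ _) h1).
rewrite -powRM ?(ltW (base_gt0 _))//.
apply: ge0_ler_powR; rewrite ?nnegrE ?invr_ge0 ?(ltW q0) ?mulr_ge0 ?(ltW (base_gt0 _))//.
rewrite -natr1; have := w0; have : 0 <= k%:R :> R by [].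
by move: (k%:R) w => a b; nra.
Qed.

Lemma growth_grad k : r / g * (growth k / (2 * m%:R) / r) `^ q =
  r / g * ((2 * m%:R)^-1 / r) `^ q * (1 + k%:R * w).
Proof.
have -> : growth k / (2 * m%:R) / r = ((2 * m%:R)^-1 / r) * growth k.
  by field; rewrite !gt_eqF.
rewrite powRM; last 2 first.
- by rewrite divr_ge0 ?invr_ge0 ?mulr_ge0 ?(ltW r0).
- exact: powR_ge0.
rewrite /growth -powRrM mulVf ?gt_eqF// powRr1 ?(ltW (base_gt0 k))//.
by rewrite mulrA.
Qed.

(** The visit counts of two coordinates differ by at most one, and one more
    visit multiplies by at most 1 + 1/rho: the tail is flat enough to satisfy
    the inequalities of the polytope. *)
Lemma half_row_growth_in (k : nat) (c : 'I_m -> nat) :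
  (forall j, (k <= c j <= k.+1)%N) -> (forall j, (c j <= N)%N) ->
  K (half_row (fun j => growth (c j) / (2 * m%:R))).
Proof.
move=> ck cN; rewrite spiked_simplexE//.
have m2 : 0 < 2 * m%:R :> R by rewrite mulr_gt0.
pose j0 : 'I_m := Ordinal m0.
have kN : (k <= N)%N by have /andP[h _] := ck j0; exact: leq_trans h (cN j0).
set S := \sum_j growth (c j) / (2 * m%:R).
have S1 : 2^-1 <= S.
  have -> : 2^-1 = \sum_(j < m) (2 * m%:R)^-1 :> R.
    by rewrite sumr_const card_ord -[RHS]mulr_natr; field; rewrite gt_eqF.
  by apply: ler_sum => j _; rewrite ler_peMl ?invr_ge0 ?(ltW m2)// growth_ge1.
have Sle (X : R) : (forall j, growth (c j) <= X) -> S <= X / 2.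
  move=> H; have -> : X / 2 = \sum_(j < m) X / (2 * m%:R).
    by rewrite sumr_const card_ord -[RHS]mulr_natr; field; rewrite gt_eqF.
  by apply: ler_sum => j _; rewrite ler_pM2r ?invr_gt0.
have S2 : S <= rho / 2 / 2 by apply: Sle => j; exact: growth_le.
have S3 : S <= growth k * (1 + rho^-1) / 2.
  apply: Sle => j; apply: le_trans (growthS_le k); apply: ler_growth.
  by have /andP[] := ck j.
have Fk := growth_le kN.
have rho0 : 0 < rho by apply: lt_trans rho1.
have dV : rho / d%:R <= rho / m%:R.
  by rewrite ler_pM2l// lef_pV2 ?posrE ?ltr0n// ler_nat.
have m2R : 2 <= m%:R :> R by rewrite (ler_nat _ 2).
have dV2 : rho / d%:R <= rho / 2.
  by apply: le_trans dV _; rewrite ler_pM2l// lef_pV2 ?posrE.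
have dV0 : 0 <= rho / d%:R by rewrite divr_ge0 ?(ltW rho0).
split; first by rewrite sum_half_row -/S; apply/andP; split; lra.
rewrite sum_half_row -/S; apply: (@half_row_ind R m (fun z => _ <= z * (rho - 1))).
  apply: (@le_trans _ _ ((rho / 2 / 2 - 2^-1) * (rho / d%:R))).
    by apply: ler_wpM2r => //; lra.
  have dV1 : rho / d%:R <= 1 by apply: le_trans dV _; rewrite ler_pdivrMr// mul1r.
  apply: (@le_trans _ _ (rho / 2 / 2 - 2^-1)); last by lra.
  by rewrite ler_piMr//; lra.
move=> j; have kc : growth k <= growth (c j) by apply: ler_growth; case/andP: (ck j).
apply: (@le_trans _ _ (growth k / (2 * m%:R) * (rho - 1))); last first.
  by rewrite ler_wpM2r ?subr_ge0 ?(ltW rho1)// ler_pM2r ?invr_gt0.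
apply: (@le_trans _ _ ((growth k * (1 + rho^-1) / 2 - 2^-1) * (rho / m%:R))).
  apply: ler_pM => //; lra.
have -> : (growth k * (1 + rho^-1) / 2 - 2^-1) * (rho / m%:R) =
   (growth k * (rho + 1) - rho) / (2 * m%:R) by field; rewrite !gt_eqF.
rewrite mulrAC ler_pM2r ?invr_gt0//.
lra.
Qed.

(** How often the first t rounds visit coordinate j of the tail. *)
Definition visits (t : nat) (j : 'I_m) : nat := (t %/ m + (j < t %% m))%N.

Lemma visitsS t j : visits t.+1 j = (visits t j + (j == t %% m :> nat))%N.
Proof.
rewrite /visits; have lm : (t %% m < m)%N by rewrite ltn_mod.
have tE := divn_eq t m; move: (t %/ m)%N (t %% m)%N lm tE => k l lm ->.
have [lm1|lm1] := ltnP l.+1 m.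
  rewrite -addnS divnMDl// modnMDl (divn_small lm1) (modn_small lm1) addn0.
  rewrite -addnA; congr (_ + _)%N; rewrite ltnS leq_eqVlt.
  by case: eqP => [->|]; rewrite ?ltnn ?addn0 ?add0n.
have lE : l.+1 = m by apply/eqP; rewrite eqn_leq lm lm1.
have jl : (j <= l)%N by rewrite -ltnS lE.
rewrite -addnS lE -mulSnr mulnK// modnMl ltn0 addn0 -addnA -addn1.
by congr (_ + _)%N; move: jl; rewrite leq_eqVlt; case: eqP => [->|_ /= ->]; rewrite ?ltnn ?addn0.
Qed.

Lemma visits_itv t j : (t %/ m <= visits t j <= (t %/ m).+1)%N.
Proof. by rewrite /visits leq_addr -[X in (_ <= X)%N]addn1 leq_add2l leq_b1. Qed.

Lemma visits_le t j : (t <= N * m)%N -> (visits t j <= N)%N.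
Proof.
rewrite leq_eqVlt => /predU1P[->|tN].
  by rewrite /visits mulnK// modnMl ltn0 addn0.
have /andP[_ h] := visits_itv t j; apply: leq_trans h _.
by rewrite ltn_divLR.
Qed.

Local Notation X := (omd K (block_mirror d K P) eta (fun t => dot (cyc_grad m0 N t)) x1).

(** With singleton blocks the unconstrained step changes one coordinate only; its
    result lies in the domain, so it is the constrained step. *)
Lemma coordinatewise_trajectory t : (t <= N * m)%N ->
  X t = half_row (fun j => growth (visits t j) / (2 * m%:R)).
Proof.
have m2 : 0 < 2 * m%:R :> R by rewrite mulr_gt0.
elim: t => [_|t IH tN].
  apply/rowP => i; rewrite /= !mxE; case: unliftP => // j _.
  rewrite /visits div0n mod0n ltn0 addn0 /growth mul0r addr0.
  by rewrite powR1 mul1r.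
have {}IH := IH (ltnW tN).
apply: (block_omd_stationary nd dom Pd eta0).
  by apply: (@half_row_growth_in (t.+1 %/ m)%N) => j; [exact: visits_itv|exact: visits_le].
rewrite IH; apply/rowP => i.
have pos (c : 'I_m -> nat) i' : 0 < half_row (fun j => growth (c j) / (2 * m%:R)) 0 i'.
  apply: (@half_row_ind R m (fun z => 0 < z)); first by rewrite invr_gt0.
  by move=> j; rewrite divr_gt0// (lt_le_trans ltr01)// growth_ge1.
have gE (c : 'I_m -> nat) :
    grad (block_mirror d K P) (half_row (fun j => growth (c j) / (2 * m%:R))) 0 i =
    r / g * (half_row (fun j => growth (c j) / (2 * m%:R)) 0 i / r) `^ q.
  exact: grad_full_mirror (pos c i).
have coord (u v z : 'rV[R]_d) :
    (u + eta^-1 *: (v - z)) 0 i = u 0 i + eta^-1 * (v 0 i - z 0 i) by rewrite !mxE.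
rewrite coord [X in _ * (X - _)](gE (visits t.+1)) [X in _ * (_ - X)](gE (visits t)).
rewrite [RHS]mxE /cyc_grad tN.
have [j ->|->] := unliftP ord0 i; last first.
  by rewrite !half_row0 subrr mulr0 addr0 !mxE eqxx/= oppr0.
rewrite (half_row_lift _ j) (half_row_lift _ j).
rewrite [X in _ * (X - _)]growth_grad [X in _ * (_ - X)]growth_grad visitsS.
rewrite [(- delta_mx 0 _) 0 _]mxE [delta_mx 0 _ 0 _]mxE eqxx/=.
have -> : (lift ord0 j == cyc_idx m0 t) = (j == (t %% m)%N :> nat).
  by rewrite (inj_eq lift_inj) -(inj_eq val_inj).
rewrite natrD; set e : R := (nat_of_bool _)%:R; set k : R := (visits t j)%:R.
have we : r / g * ((2 * m%:R)^-1 / r) `^ q * w = eta.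
  by rewrite /growth_rate; field; rewrite !gt_eqF.
rewrite -mulrBr.
have -> : 1 + (k + e) * w - (1 + k * w) = e * w by ring.
set A := r / g * _ in we *.
have -> : A * (e * w) = e * eta by rewrite -we; ring.
by rewrite mulrCA mulVf ?gt_eqF// mulr1 addNr.
Qed.

(** A visited coordinate is at most rho / (4m), that of the spike at least
    rho / (2m). *)
Lemma coordinatewise_regret_ge T : (N * m <= T)%N ->
  N%:R * rho / 4 <= omd_regret K (block_mirror d K P) eta T
    (fun t => dot (cyc_grad m0 N t)) x1.
Proof.
move=> NT; have rho0 : 0 < rho by apply: lt_trans rho1.
have Ku : K (const_mx (rho / d%:R)) by apply: sub_gen_smallest; right.
apply: le_trans (block_regret_ge d dom P eta (cyc_grad m0 N) T Ku).
rewrite (sum_cyc_grad m0 NT (fun t => X t - const_mx (rho / d%:R))) -sumrN.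
have -> : N%:R * rho / 4 = \sum_(l < N) rho / 4.
  by rewrite sumr_const card_ord -[RHS]mulr_natl mulrA.
apply: ler_sum => l _; rewrite -sumrN.
have -> : rho / 4 = \sum_(j < m) rho / (4 * m%:R).
  by rewrite sumr_const card_ord -[RHS]mulr_natr; field; rewrite gt_eqF.
apply: ler_sum => j _; rewrite !mxE coordinatewise_trajectory; last first.
  apply: (@leq_trans (l.+1 * m)%N); last by rewrite leq_mul2r ltn_ord orbT.
  by rewrite mulSnr leq_add2l ltnW.
rewrite half_row_lift opprB.
have h1 : growth (visits (l * m + j) j) / (2 * m%:R) <= rho / 2 / (2 * m%:R).
  rewrite ler_pM2r ?invr_gt0 ?mulr_gt0//; apply: growth_le; apply: visits_le.
  apply: (@leq_trans (l.+1 * m)%N); last by rewrite leq_mul2r ltn_ord orbT.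
  by rewrite mulSnr leq_add2l ltnW.
have h2 : rho / (2 * m%:R) <= rho / d%:R.
  rewrite ler_pM2l// lef_pV2 ?posrE ?mulr_gt0 ?ltr0n// -natrM ler_nat.
  by rewrite mul2n -addnn -addn1 leq_add2l.
have h3 : rho / 2 / (2 * m%:R) = rho / (2 * m%:R) / 2 by field; rewrite gt_eqF.
have h4 : rho / (4 * m%:R) = rho / (2 * m%:R) / 2 by field; rewrite gt_eqF.
rewrite h4 lerBrDr; apply: le_trans h2; rewrite h3 in h1.
by apply: le_trans (lerD (lexx _) h1) _; rewrite -splitr.
Qed.

End Partition.
End Coordinatewise.

(** * Block norms on the spiked simplex *)

Section SpikedBounds.
Context {R : realType}.
Variables (m : nat) (rho : R).
Hypotheses (m1 : (1 < m)%N) (rho20 : 20 <= rho) (rho4 : rho ^+ 4 = m.+1%:R).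
Let m0 : (0 < m)%N := ltnW m1.
Let rho1 : 1 < rho. Proof. by apply: lt_le_trans rho20; rewrite ltr1n. Qed.
Let rho2 : 2 <= rho. Proof. by apply: le_trans rho20; rewrite ler_nat. Qed.
Let rho0 : 0 < rho. Proof. exact: lt_trans rho1. Qed.
Local Notation d := (m.+1).
Local Notation K := (spiked_simplex (d := d) rho).
Local Notation x1 := (half_start (R := R) m).
Local Notation spike := (const_mx (rho / d%:R) : 'rV[R]_d).
Implicit Types (x : 'rV[R]_d).

Let dom : start_domain K rho ord0 x1 := half_start_domain m1 rho2.

Lemma rho_le_dim : 16 * rho <= d%:R.
Proof.
have -> : d%:R = rho ^+ 3 * rho by rewrite -rho4 exprSr.
rewrite ler_wpM2r ?(ltW rho0)//.
have r3 : rho ^+ 1 <= rho ^+ 3 by rewrite ler_eXn2l.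
by apply: le_trans r3; rewrite expr1; apply: le_trans rho20; lra.
Qed.

Let rho_d : rho / d%:R <= 16^-1.
Proof. rewrite ler_pdivrMr ?ltr0n//; have := rho_le_dim; lra. Qed.

Lemma tail_spike : tail_sum spike = rho - rho / d%:R.
Proof.
have h : rho / d%:R + tail_sum spike = rho.
  by rewrite -[RHS](sum_spike (R := R) rho (ltn0Sn m)) sum_head_tail mxE.
by apply/eqP; rewrite eq_sym subr_eq addrC h.
Qed.

Lemma tail_le_spike x : K x -> tail_sum x <= tail_sum spike.
Proof.
rewrite spiked_simplexE// tail_spike => -[/andP[S1 Sr] /(_ ord0)].
rewrite !sum_head_tail in S1 Sr *.
have rd := rho_d; have r20 := rho20.
set u := rho / d%:R in rd *; move: (x 0 ord0) (tail_sum x) S1 Sr => a t S1 Sr h.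
have u0 : 0 <= u by rewrite divr_ge0// ltW.
have B : 0 < rho - 1 by rewrite subr_gt0.
rewrite -(ler_pM2r B).
have h2 : (rho - (a + t)) * (rho - 1 - u) >= 0 by apply: mulr_ge0; lra.
lra.
Qed.

(** The spike has at most 1/16 at coordinate 0, so a mass of 1/4 there leaves
    weight at most 4/5 for the spike, and coordinate sum at most
    1 + 4/5 (rho - 1). *)
Lemma tail_gap x : K x -> 4^-1 <= x 0 ord0 -> tail_sum x + rho / 10 <= tail_sum spike.
Proof.
rewrite spiked_simplexE// tail_spike => -[/andP[S1 Sr] xi] x0.
rewrite !sum_head_tail in S1 Sr.
have u0 : 0 <= rho / d%:R by rewrite divr_ge0// ltW.
have B : 0 < rho - 1 by rewrite subr_gt0.
have H : m%:R * ((x 0 ord0 + tail_sum x - 1) * (rho / d%:R)) <= tail_sum x * (rho - 1).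
  have -> : m%:R * ((x 0 ord0 + tail_sum x - 1) * (rho / d%:R)) =
      \sum_(j < m) (x 0 ord0 + tail_sum x - 1) * (rho / d%:R).
    by rewrite sumr_const card_ord -[RHS]mulr_natl.
  rewrite /tail_sum mulr_suml; apply: ler_sum => j _.
  by have := xi (lift ord0 j); rewrite sum_head_tail.
have mE : m%:R * (rho / d%:R) = rho - rho / d%:R.
  have e : d%:R * (rho / d%:R) = rho by rewrite mulrC divfK// pnatr_eq0.
  by rewrite -[X in _ = X - _]e -{2}natr1 mulrDl mul1r addrK.
have {}H : (x 0 ord0 + tail_sum x - 1) * (rho - rho / d%:R) <= tail_sum x * (rho - 1).
  by rewrite -mE mulrCA; exact: H.
have rd := rho_d; have r20 := rho20.
set u := rho / d%:R in rd u0 H *.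
move: (x 0 ord0) (tail_sum x) x0 S1 Sr H => a t x0 S1 Sr H.
have H2 : (a + t - 1) * (1 - u) <= (1 - a) * (rho - 1) by lra.
have : (a + t - 1) * (1 - 16^-1) <= 3 / 4 * (rho - 1).
  apply: (@le_trans _ _ ((a + t - 1) * (1 - u))).
    by apply: ler_wpM2l; lra.
  by apply: le_trans H2 _; apply: ler_wpM2r; lra.
have := rho20; lra.
Qed.

Section Cycles.
Variables (N T s : nat).
Hypotheses (NT : (N * m <= T)%N) (T0 : (0 < T)%N) (s3 : (3 <= s)%N)
  (sr : s%:R <= rho ^+ 2) (s2d : (2 * s <= d)%N).
Local Notation Q := (Num.sqrt T%:R : R).
Local Notation cg := (cyc_grad (R := R) m0 N).
Let s0 : (0 < s)%N := leq_trans (isT : (0 < 3)%N) s3.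
Let sd : (0 < s <= d)%N.
Proof. by rewrite s0 (leq_trans _ s2d)// mul2n -addnn leq_addr. Qed.

Lemma spiked_radius_le n : (0 < n <= d)%N -> n%:R <= rho ^+ 2 -> radius n K <= 2.
Proof.
move=> /andP[n0 nd] nr; apply: (radius_le dom) => // P x Pn Kx.
apply: (spiked_block_norm_le (eqparts_partition Pn) _ _ Kx); first by lra.
exact: (spike_block_norm_le rho1 (ltn0Sn m) n0 nr rho4 Pn).
Qed.

Let drift n P (eta : R) (nd : (0 < n <= d)%N) (Pn : P \in eqparts n) (eta0 : 0 < eta) :
  forall a b i, (a <= b)%N ->
   `|omd K (block_mirror n K P) eta (fun t => dot (cg t)) x1 b 0 i -
     omd K (block_mirror n K P) eta (fun t => dot (cg t)) x1 a 0 i| <=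
   (b - a)%:R * (eta / block_modulus n).
Proof.
by move=> a b i ab; apply: (block_omd_drift_le nd dom Pn eta0 i (dot_cyc_grad_le m0 N)).
Qed.

Lemma spiked_block_regret_le :
  avg_eqparts s (fun P => omd_regret K (block_mirror s K P) (std_step K s s x1 T) T
    (fun t => dot (cg t)) x1) <=
  12 * (1 + expR 6) * ln s%:R * Q +
  N%:R * m%:R * (std_step K s s x1 T / block_modulus s).
Proof.
have e0 := std_step_gt0 sd dom s0 T0.
apply: le_trans (std_regret_avg_le sd dom s0 T0 (E := N%:R * m%:R *
    (std_step K s s x1 T / block_modulus s)) (G := cg) _) _.
  move=> P X Pn XE; rewrite XE; apply: (cyc_stability m0 NT).
  exact: drift Pn e0.
rewrite lerD2r; apply: ler_wpM2r; first exact: sqrtr_ge0.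
have -> : 12 * (1 + expR 6) * ln s%:R = 6 * 2 * (1 + expR 6) * ln s%:R :> R by ring.
have H := diam_grad_bound_le sd dom s0 (spiked_radius_le sd sr) (leqnn s) s3 s2d.
exact: H.
Qed.

(** During the first K0 cycles the iterate is still close to the start and pays
    at least 1 per cycle against the spike.  No cycle gains more than the drift
    within it, and the sum of these drifts is below K0. *)
Lemma spiked_regret_gt0 n (K0 : nat) : (0 < n <= d)%N -> (K0 <= N)%N ->
  let delta := std_step K n s x1 T / block_modulus n in
  m%:R ^+ 2 * K0%:R * delta <= 1 ->
  N%:R * (m%:R ^+ 2 * delta) < K0%:R ->
  0 < avg_eqparts n (fun P => omd_regret K (block_mirror n K P) (std_step K n s x1 T) T
    (fun t => dot (cg t)) x1).
Proof.
move=> nd K0N delta small_drift K0big.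
have e0 := std_step_gt0 nd dom s0 T0.
apply: (@lt_le_trans _ _ (K0%:R - N%:R * (m%:R ^+ 2 * delta))); first by rewrite subr_gt0.
apply: avg_eqparts_ge => // P Pn.
have k0 : 0 < block_modulus n :> R := block_modulus_gt0 Pn.
have d0 : 0 <= delta by rewrite divr_ge0 ?(ltW e0) ?(ltW k0).
have Ku : K spike by apply: sub_gen_smallest; right.
apply: le_trans (block_regret_ge n dom P _ cg T Ku).
set X := omd _ _ _ _ _.
have Xd : forall a b i, (a <= b)%N -> `|X b 0 i - X a 0 i| <= (b - a)%:R * delta.
  exact: drift Pn e0.
apply: le_trans (cyc_regret_ge m0 NT d0 Xd spike); rewrite lerD2r.
have XK t : K (X t) by exact: (block_omd_in n dom P _ cg t).
rewrite -(big_mkord xpredT (fun l => tail_sum spike - tail_sum (X (l * m)%N))).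
rewrite (big_cat_nat (n := K0))//= -[leLHS]addr0; apply: lerD; last first.
  by apply: sumr_ge0 => l _; rewrite subr_ge0 tail_le_spike.
have -> : K0%:R = \sum_(0 <= l < K0) 1 :> R.
  by rewrite big_mkord sumr_const card_ord.
apply: ler_sum_nat => l /andP[_ lK].
have h : tail_sum (X (l * m)%N) <= tail_sum x1 + \sum_(j < m) (l * m)%:R * delta.
  rewrite /tail_sum -big_split/=; apply: ler_sum => j _.
  by have := Xd 0%N (l * m)%N (lift ord0 j) (leq0n _); rewrite subn0 ler_norml => /andP[_]; rewrite /=; lra.
have h2 : \sum_(j < m) (l * m)%:R * delta <= 1.
  rewrite sumr_const card_ord -[leLHS]mulr_natl; apply: le_trans small_drift.
  have -> : m%:R * ((l * m)%:R * delta) = m%:R ^+ 2 * l%:R * delta by rewrite natrM; ring.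
  by rewrite ler_wpM2r// ler_wpM2l ?sqr_ge0// ler_nat ltnW.
rewrite (tail_half_start m0) in h; rewrite tail_spike.
move: rho_d rho20 h h2; move: (rho / _) (tail_sum _) (\sum_(_ < _) _) => u t S; lra.
Qed.

End Cycles.

End SpikedBounds.

(** * Lower bounds for projected gradient descent and singleton blocks *)

Section SpikedLower.
Context {R : realType}.
Variables (m : nat) (rho : R).
Hypotheses (m1 : (1 < m)%N) (rho20 : 20 <= rho) (rho4 : rho ^+ 4 = m.+1%:R).
Let m0 : (0 < m)%N := ltnW m1.
Let mR : 0 < m%:R :> R. Proof. by rewrite ltr0n. Qed.
Let rho1 : 1 < rho. Proof. by apply: lt_le_trans rho20; rewrite ltr1n. Qed.
Let rho2 : 2 <= rho. Proof. by apply: le_trans rho20; rewrite ler_nat. Qed.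
Let rho0 : 0 < rho. Proof. exact: lt_trans rho1. Qed.
Local Notation d := (m.+1).
Local Notation K := (spiked_simplex (d := d) rho).
Local Notation x1 := (half_start (R := R) m).
Local Notation spike := (const_mx (rho / d%:R) : 'rV[R]_d).
Implicit Types (x : 'rV[R]_d).
Variables (N T s : nat).
Hypotheses (NT : (N * m <= T)%N) (T0 : (0 < T)%N) (s3 : (3 <= s)%N)
  (sr : s%:R <= rho ^+ 2) (rs : rho ^+ 2 <= 4 * s%:R) (s2d : (2 * s <= d)%N).
Local Notation Q := (Num.sqrt T%:R : R).
Local Notation cg := (cyc_grad (R := R) m0 N).
Let s0 : (0 < s)%N := leq_trans (isT : (0 < 3)%N) s3.
Let sd : (0 < s <= d)%N.
Proof. by rewrite s0 (leq_trans _ s2d)// mul2n -addnn leq_addr. Qed.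
Let dom : start_domain K rho ord0 x1 := half_start_domain m1 rho2.
Let Q0 : 0 < Q. Proof. by rewrite sqrtr_gt0 ltr0n. Qed.

Lemma tail_le_rho x : K x -> tail_sum x <= rho.
Proof.
move=> Kx; apply: le_trans (dom_le dom Kx); rewrite sum_head_tail lerDr.
exact: dom_ge0 dom _ _ Kx.
Qed.

Lemma block_modulus1 : block_modulus 1 = 2^-1 :> R.
Proof. by rewrite /block_modulus /pexp /gamma/=; lra. Qed.

Let nd1 : (0 < 1 <= d)%N. Proof. by []. Qed.

(** Here D <= 3, from the radius 2, and G >= sqrt s >= rho / 2. *)
Lemma spiked_euc_step_le : std_step K 1 s x1 T <= 6 / (rho * Q).
Proof.
have D3 : diam_block 1 K x1 <= 3.
  have D2 := diam_block_sqr_le nd1 dom.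
  have r2 : radius 1 K <= 2.
    apply: (spiked_radius_le m1 rho20 rho4) => //.
    by rewrite -(expr1n _ 2) ler_sqr ?nnegrE ?(ltW rho0)// ltW.
  have r1 := radius_ge1 nd1 dom; have D0 := diam_block_gt0 nd1 dom.
  move: D2 r2 r1 D0; rewrite /gamma/=.
  by move: (diam_block _ _ _) (radius _ _) => D r D2 r2 r1 D0; nra.
have Gs : rho / 2 <= @grad_bound_block R d 1 s.
  apply: le_trans (grad_bound_euc_ge R sd).
  rewrite -(ler_sqr) ?nnegrE ?sqrtr_ge0 ?divr_ge0 ?(ltW rho0)//.
  by rewrite sqr_sqrtr// expr_div_n ler_pdivrMr//; move: rs; lra.
have r20 : 0 < rho / 2 by rewrite divr_gt0.
have -> : 6 / (rho * Q) = 3 / (rho / 2 * Q) by field; rewrite !gt_eqF.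
exact: (std_step_le nd1 dom s0 T0 D3 r20 Gs).
Qed.

(** The telescoped inequality with the start as comparator bounds
    |x1 - x_t|^2 / 2 by eta times what the losses have yielded so far, at most
    rho plus drift per cycle.  For small eta N rho coordinate 0 remains above
    1/4 and [tail_gap] applies to every cycle. *)
Lemma spiked_euc_regret_ge (delta : R) :
  delta = std_step K 1 s x1 T / block_modulus 1 ->
  2 * std_step K 1 s x1 T * N%:R * (rho + m%:R ^+ 2 * delta) <= 16^-1 ->
  N%:R * (rho / 10) - N%:R * (m%:R ^+ 2 * delta) <=
  avg_eqparts 1 (fun P => omd_regret K (block_mirror 1 K P) (std_step K 1 s x1 T) T
    (fun t => dot (cg t)) x1).
Proof.
move=> deltaE small.
have e0 := std_step_gt0 nd1 dom s0 T0.
set eta := std_step _ _ _ _ _ in deltaE small e0 *.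
apply: avg_eqparts_ge => // P Pn.
have d0 : 0 <= delta by rewrite deltaE divr_ge0 ?(ltW e0)// block_modulus1.
have Ku : K spike by apply: sub_gen_smallest; right.
apply: le_trans (block_regret_ge 1 dom P _ cg T Ku).
set X := omd _ _ _ _ _.
have Xd : forall a b i, (a <= b)%N -> `|X b 0 i - X a 0 i| <= (b - a)%:R * delta.
  move=> a b i ab; rewrite deltaE.
  exact: (block_omd_drift_le nd1 dom Pn e0 i (dot_cyc_grad_le m0 N) ab).
apply: le_trans (cyc_regret_ge m0 NT d0 Xd spike); rewrite lerD2r.
have XK t : K (X t) by exact: (block_omd_in 1 dom P _ cg t).
have -> : N%:R * (rho / 10) = \sum_(l < N) rho / 10.
  by rewrite sumr_const card_ord -[RHS]mulr_natl.
apply: ler_sum => l _.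
suff X0 : 4^-1 <= X (l * m)%N 0 ord0.
  by rewrite lerBrDl; exact: (tail_gap rho20 rho4 (XK _) X0).
have lN := ltnW (ltn_ord l).
have tel := block_omd_telescope nd1 dom Pn cg e0 (l * m) (dom_start dom).
rewrite bregmanxx sub0r mulrN -/X in tel.
rewrite (sum_cyc_grad_prefix m0 (fun t => X t.+1 - x1) lN) lerN2 in tel.
have sumle : \sum_(k < l) \sum_(j < m) (X (k * m + j).+1 - x1) 0 (lift ord0 j) <=
    N%:R * (rho + m%:R ^+ 2 * delta).
  apply: (@le_trans _ _ (\sum_(k < l) (rho + m%:R ^+ 2 * delta))).
    apply: ler_sum => k _; have := cycle_sum_le d0 Xd k (leqnn 1).
    have := tail_le_rho (XK (k * m)%N).
    have : \sum_(j < m) (X (k * m + j).+1 - x1) 0 (lift ord0 j) <=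
       \sum_(j < m) X (k * m + j + 1)%N 0 (lift ord0 j).
      apply: ler_sum => j _; rewrite addn1 !mxE lerBlDr lerDl.
      by have := dom_ge0 dom (lift ord0 j) (dom_start dom); rewrite mxE.
    by lra.
  rewrite sumr_const card_ord -[leLHS]mulr_natl ler_wpM2r ?ler_nat//.
  by rewrite addr_ge0 ?(ltW rho0)// mulr_ge0 ?sqr_ge0.
have B := block_bregman_ge nd1 dom Pn (XK (l * m)%N) (dom_start dom).
rewrite block_modulus1 in B.
have c := sqr_coord_le_dot (x1 - X (l * m)%N) ord0.
have {}tel := le_trans tel sumle.
rewrite ler_pdivrMl// in tel.
have {}B := le_trans B tel.
have {c B} : (x1 - X (l * m)%N) 0 ord0 ^+ 2 <= 4^-1 ^+ 2.
  apply: (le_trans c); move: B small; move: (dot _ _) => D.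
  by lra.
move=> h; have {h} : `|(x1 - X (l * m)%N) 0 ord0| <= 4^-1.
  by rewrite -ler_sqr ?nnegrE ?invr_ge0// real_normK ?num_real.
rewrite !mxE unlift_none ler_norml; lra.
Qed.

Let nd : (0 < d <= d)%N. Proof. by rewrite /= leqnn. Qed.
Let rho_m : rho <= m%:R.
Proof.
have := rho_le_dim rho20 rho4; rewrite -natr1; have := rho20; lra.
Qed.

Lemma radius_full_le : radius d K <= rho.
Proof.
apply: (radius_le dom); first exact: ltW.
move=> P x Pn Kx; apply: le_trans (dom_le dom Kx).
apply: block_norm_le_sum; first exact: eqparts_partition Pn.
by move=> i; exact: dom_ge0 dom x i Kx.
Qed.

(** With D <= 3 r ln d, G >= 1 and q = 1 / ln d the exponent is at most
    3 ln d / (e sqrt T) divided by the power (2 m r)^(- 1 / ln d), which is at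
    least e^(-3) since 2 m r <= d^3; finally e^2 <= 9. *)
Lemma growth_exponent_le (L : R) : L = ln d%:R ->
  growth_rate m rho (std_step K d s x1 T) / (pexp d - 1) <= 27 * L / Q.
Proof.
move=> LE.
have d3 : (3 <= d)%N by rewrite ltnS.
have L1 : 1 <= L by rewrite LE ln_ge1.
have L0 : 0 < L by apply: lt_le_trans L1.
have e0 := std_step_gt0 nd dom s0 T0.
have r1 := radius_ge1 nd dom.
have rle := radius_full_le.
have D2 := diam_block_sqr_le nd dom.
have D0 := diam_block_gt0 nd dom.
have g3 : (gamma d)^-1 <= 3 * L :> R by rewrite LE; exact: gammaV_le.
set r := radius d K in r1 rle D2 *.
have r0 : 0 < r by apply: lt_le_trans r1.
have D3 : diam_block d K x1 <= 3 * r * L.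
  have {D2 g3} : diam_block d K x1 ^+ 2 <= 2 * r ^+ 2 * (3 * L).
    by apply: le_trans D2 _; rewrite ler_wpM2l// mulr_ge0 ?sqr_ge0.
  move=> h; rewrite -ler_sqr ?nnegrE ?(ltW D0)//; last first.
    by rewrite !mulr_ge0 ?(ltW r0) ?(ltW L0).
  apply: (le_trans h).
  have -> : 2 * r ^+ 2 * (3 * L) = (6 * r ^+ 2 * L) * 1 by ring.
  have -> : (3 * r * L) ^+ 2 = (6 * r ^+ 2 * L) * (3 / 2 * L) by field.
  rewrite ler_wpM2l ?mulr_ge0 ?sqr_ge0 ?(ltW L0) ?(ltW r0)//.
  by move: L1; lra.
have eta_le : std_step K d s x1 T <= 3 * r * L / (1 * Q).
  exact: (std_step_le nd dom s0 T0 D3 ltr01 (grad_bound_ge1 nd s0)).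
rewrite mul1r in eta_le.
set eta := std_step _ _ _ _ _ in e0 eta_le *.
have gE : gamma d = (expR 1 * L)^-1 :> R.
  by rewrite /gamma ifF ?ifF ?LE//; apply/negbTE; rewrite -?ltnNge //; case: (m) m1 => [|[|]].
have qE : pexp d - 1 = L^-1 :> R.
  rewrite /pexp ifF; first by rewrite addrAC subrr add0r LE.
  by apply/negbTE; rewrite -ltnNge.
pose y := ((2 * m%:R)^-1 / r) `^ (pexp d - 1).
have yb : 0 < (2 * m%:R)^-1 / r by rewrite divr_gt0// invr_gt0 mulr_gt0.
have y0 : 0 < y by rewrite powR_gt0.
have y3 : expR (- 3) <= y.
  rewrite /y /powR gt_eqF// ler_expR qE ler_pdivlMl//.
  rewrite lnM ?posrE ?invr_gt0 ?mulr_gt0// !lnV ?posrE ?mulr_gt0// -opprD mulrN lerN2.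
  rewrite -lnM ?posrE ?mulr_gt0//.
  have -> : L * 3 = ln (d%:R ^+ 3) by rewrite lnXn ?ltr0n// LE mulr_natr.
  rewrite ler_ln ?posrE ?mulr_gt0 ?exprn_gt0 ?ltr0n//.
  have dE : d%:R = m%:R + 1 :> R by rewrite natr1.
  have m2 : 2 <= m%:R :> R by rewrite (ler_nat _ 2).
  have rm : r <= m%:R := le_trans rle rho_m.
  apply: (@le_trans _ _ (m%:R ^+ 3)); last first.
    by rewrite dE lerXn2r ?nnegrE ?addr_ge0// lerDl.
  rewrite !exprS expr0 mulr1 mulrA; apply: ler_pM => //; first exact: ltW.
  by rewrite ler_wpM2r.
have e9 : expR 2 <= 9 :> R.
  have -> : 2 = 1 + 1 :> R by ring.
  rewrite expRD; have := expR1_le3 (R := R); have := expR_gt0 (1 : R).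
  by move: (expR 1) => e; nra.
have -> : growth_rate m rho eta / (pexp d - 1) = eta * (expR 1)^-1 / r / y.
  rewrite /growth_rate -/y gE qE -/r; field.
  by rewrite !gt_eqF ?expR_gt0.
have step1 : eta * (expR 1)^-1 / r / y <= eta * (expR 1)^-1 / r / expR (- 3).
  apply: ler_wpM2l.
    apply: mulr_ge0; last by rewrite invr_ge0 ltW.
    by apply: mulr_ge0; rewrite ?invr_ge0 ?expR_ge0 ?(ltW e0).
  by rewrite lef_pV2 ?posrE ?expR_gt0.
apply: (le_trans step1).
have -> : eta * (expR 1)^-1 / r / expR (- 3) = eta * expR 2 / r.
  rewrite expRN invrK (_ : 3 = 1 + 2); last by ring.
  by rewrite expRD; field; rewrite !gt_eqF ?expR_gt0.
have -> : 27 * L / Q = 3 * r * L / Q * 9 / r by field; rewrite !gt_eqF.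
rewrite ler_wpM2r ?invr_ge0 ?(ltW r0)//.
by apply: ler_pM => //; exact: ltW.
Qed.

Lemma spiked_full_regret_ge (L : R) : L = ln d%:R ->
  27 * L / Q <= ln (1 + rho^-1) -> N%:R * (27 * L / Q) <= ln (rho / 2) ->
  N%:R * rho / 4 <=
  avg_eqparts d (fun P => omd_regret K (block_mirror d K P) (std_step K d s x1 T) T
    (fun t => dot (cg t)) x1).
Proof.
move=> LE h1 h2; apply: avg_eqparts_ge => // P Pn.
have e0 := std_step_gt0 nd dom s0 T0.
have v := growth_exponent_le LE.
have rV : 0 < 1 + rho^-1 by rewrite addr_gt0// invr_gt0.
have r2 : 0 < rho / 2 by rewrite divr_gt0.
apply: (coordinatewise_regret_ge m1 rho2 rho_m Pn e0 _ _ NT).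
- by rewrite -[leRHS](lnK (_ : 1 + rho^-1 \is Num.pos)) ?posrE// ler_expR (le_trans v).
rewrite -[leRHS](lnK (_ : rho / 2 \is Num.pos)) ?posrE// ler_expR.
by apply: le_trans h2; rewrite -mulrA ler_wpM2l.
Qed.

End SpikedLower.

(** * Regrets for a long horizon *)

Lemma exists_sqrt_ge (R : realType) (X : R) :
  exists T0 : nat, forall T : nat, (T0 <= T)%N -> (0 < T)%N /\ X <= Num.sqrt T%:R.
Proof.
exists (Num.truncn (X ^+ 2)).+1 => T TX; split; first exact: leq_ltn_trans TX.
apply: (le_trans (ler_norm X)); rewrite -sqrtr_sqr ler_wsqrtr//.
have /andP[_ /ltW h] := truncn_itv (sqr_ge0 X).
by apply: (le_trans h); rewrite ler_nat.
Qed.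

Lemma terms_le_of_sum_le (R : realType) (a b c u v X : R) :
  0 <= a -> 0 <= b -> 0 <= c -> 0 <= u -> 0 <= v -> a + b + c + u + v <= X ->
  [/\ a <= X, b <= X, c <= X, u <= X & v <= X].
Proof. by move=> *; split; lra. Qed.

(** The number of cycles during which the s-block iterates stay near the start:
    short enough for the drift b k / Q to be at most 1, and more than b of
    them, which exceeds the total drift b N / Q of all cycles. *)
Lemma initial_cycles (R : realType) (b Q : R) : 0 <= b -> (400 + b) * (b + 1) <= Q ->
  exists2 k : nat, (k <= Num.truncn (Q / 400))%N & b < k%:R /\ k%:R * (400 + b) <= Q.
Proof.
move=> b0 bQ.
have b400 : 0 < 400 + b by lra.
have Q0 : 0 <= Q by apply: le_trans bQ; apply: mulr_ge0; lra.
have y0 : 0 <= Q / (400 + b) := divr_ge0 Q0 (ltW b400).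
have y4 : 0 <= Q / 400 := divr_ge0 Q0 (ler0n R 400).
have /andP[kQ Qk] := truncn_itv y0.
have /andP[_ Nk] := truncn_itv y4.
exists (Num.truncn (Q / (400 + b))); last split.
- rewrite -ltnS -(ltr_nat R); apply: (le_lt_trans kQ); apply: le_lt_trans Nk.
  by apply: ler_wpM2l => //; rewrite lef_pV2 ?posrE; lra.
- have : b + 1 <= Q / (400 + b) by rewrite ler_pdivlMr// mulrC.
  by move: Qk; rewrite -natr1; lra.
- by rewrite -ler_pdivlMr.
Qed.

Section Arithmetic.
Context {R : realType}.
Implicit Types eta N rho L Q z : R.

Lemma euc_gain_ge N rho Q z : z <= 1 -> 20 <= rho -> Q / 800 <= N -> 0 <= Q ->
  rho * Q / (20 * 800) <= N * (rho / 10) - N * z.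
Proof.
move=> z1 rho20 QN Q0.
have h1 : 0 <= (N - Q / 800) * (rho / 20) by apply: mulr_ge0; lra.
have h2 : 0 <= N * (rho / 20 - z) by apply: mulr_ge0; lra.
lra.
Qed.

Lemma euc_step_small eta N rho Q z : 0 <= eta -> eta <= 6 / (rho * Q) ->
  0 <= N -> N <= Q / 400 -> 0 <= z -> z <= 1 -> 20 <= rho -> 0 < Q ->
  2 * eta * N * (rho + z) <= 16^-1.
Proof.
move=> e0 eta_le N0 NQ z0 z1 rho20 Q0.
have rho0 : 0 < rho by lra.
have h1 : eta * N <= 6 / (rho * Q) * (Q / 400) by apply: ler_pM.
have h2 : eta * N * (rho + z) <= 6 / (rho * Q) * (Q / 400) * (2 * rho).
  by apply: ler_pM => //; [apply: mulr_ge0|lra|lra].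
have E : 6 / (rho * Q) * (Q / 400) * (2 * rho) = 12 / 400.
  by field; rewrite !gt_eqF.
rewrite E in h2; lra.
Qed.

Lemma full_gain_ge N rho Q : 0 <= rho -> Q / 800 <= N -> 0 <= Q ->
  rho * Q / (20 * 800) <= N * rho / 4.
Proof.
move=> rho0 QN Q0.
have h1 : 0 <= (N - Q / 800) * rho by apply: mulr_ge0; lra.
have h2 : 0 <= Q * rho by apply: mulr_ge0; lra.
lra.
Qed.

Lemma growth_budget N L Q : 100 <= L -> N <= Q / 400 -> 0 < Q ->
  N * (27 * L / Q) <= L / 8.
Proof.
move=> L100 NQ Q0; have L0 : 0 <= L by lra.
apply: (@le_trans _ _ (Q / 400 * (27 * L / Q))).
  by apply: ler_wpM2r => //; apply: divr_ge0; lra.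
have -> : Q / 400 * (27 * L / Q) = 27 / 400 * L by field; rewrite gt_eqF.
lra.
Qed.

End Arithmetic.

Definition spiked_const (R : realType) : R := 12 * (1 + expR 6) + 1.

Section SpikedPart.
Context {R : realType}.
Variables (m s : nat) (rho L : R).
Hypotheses (m1 : (1 < m)%N) (rho20 : 20 <= rho) (rho4 : rho ^+ 4 = m.+1%:R)
  (s3 : (3 <= s)%N) (sr : s%:R <= rho ^+ 2) (rs : rho ^+ 2 <= 4 * s%:R)
  (s2d : (2 * s <= m.+1)%N) (LE : L = ln m.+1%:R)
  (L100 : 100 <= L) (rhoL : ln (rho / 2) >= L / 8).
Let m0 : (0 < m)%N := ltnW m1.
Let rho1 : 1 < rho. Proof. by apply: lt_le_trans rho20; rewrite ltr1n. Qed.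
Let rho0 : 0 < rho. Proof. exact: lt_trans rho1. Qed.
Let rho2 : 2 <= rho. Proof. by apply: le_trans rho20; rewrite ler_nat. Qed.
Local Notation d := (m.+1).
Local Notation K := (spiked_simplex (d := d) rho).
Local Notation x1 := (half_start (R := R) m).
Let dom : start_domain K rho ord0 x1 := half_start_domain m1 rho2.
Let s0 : (0 < s)%N := leq_trans (isT : (0 < 3)%N) s3.
Let sd : (0 < s <= d)%N.
Proof. by rewrite s0 (leq_trans _ s2d)// mul2n -addnn leq_addr. Qed.
Let nd1 : (0 < 1 <= d)%N. Proof. by []. Qed.

(** A standard step moves each coordinate by at most [drift_scale n] divided by
    sqrt T. *)
Definition drift_scale n : R :=
  diam_block n K x1 / @grad_bound_block R d n s / block_modulus n.

Lemma drift_scaleE n T : std_step K n s x1 T / block_modulus n = drift_scale n / Num.sqrt T%:R.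
Proof. by rewrite /std_step /drift_scale invfM; ring. Qed.

Lemma drift_scale_ge0 n : (0 < n <= d)%N -> 0 <= drift_scale n.
Proof.
move=> nd; have /card_gt0P[P Pn] := eqparts_neq0 nd.
rewrite /drift_scale; apply: divr_ge0.
  apply: divr_ge0; first exact: (ltW (diam_block_gt0 nd dom)).
  exact: (ltW (grad_bound_gt0 nd s0)).
exact: (ltW (block_modulus_gt0 Pn)).
Qed.

Local Notation b1 := (m%:R ^+ 2 * drift_scale 1).
Local Notation bs := (m%:R ^+ 2 * drift_scale s).

(** The requirements on sqrt T: rounding the number of cycles costs at most a
    factor 2; the cycles fit into T rounds; the drift within a cycle is at most
    1 for projected gradient descent; the drift of the s-block iterates allows a
    positive regret; and one visit grows a coordinate by at most 1 + 1/rho. *)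
Definition horizon_scale : R :=
  1600 + m%:R + b1 + (400 + bs) * (bs + 1) + 27 * L / ln (1 + rho^-1).

Let b1_ge0 : 0 <= b1. Proof. by rewrite mulr_ge0 ?sqr_ge0 ?drift_scale_ge0. Qed.
Let bs_ge0 : 0 <= bs. Proof. by rewrite mulr_ge0 ?sqr_ge0 ?drift_scale_ge0. Qed.

Section Horizon.
Variable T : nat.
Hypotheses (T0 : (0 < T)%N) (TX : horizon_scale <= Num.sqrt T%:R).
Local Notation Q := (Num.sqrt T%:R : R).
Definition n_cycles : nat := Num.truncn (Q / 400).
Local Notation N := n_cycles.
Local Notation cg := (cyc_grad (R := R) m0 N).

Let lnV : 0 < ln (1 + rho^-1) :> R.
Proof. by rewrite ln_gt0// ltrDl invr_gt0. Qed.

Let prod_ge : 0 <= (400 + bs) * (bs + 1).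
Proof.
exact: (mulr_ge0 (addr_ge0 (ler0n R 400) bs_ge0) (addr_ge0 bs_ge0 ler01)).
Qed.

Let last_ge : 0 <= 27 * L / ln (1 + rho^-1).
Proof.
apply: divr_ge0; last exact: (ltW lnV).
by apply: mulr_ge0; [exact: (ler0n R 27)|exact: (le_trans (ler0n R 100) L100)].
Qed.

Let horizon_bounds : [/\ 1600 <= Q, m%:R <= Q, b1 <= Q, (400 + bs) * (bs + 1) <= Q
  & 27 * L / ln (1 + rho^-1) <= Q].
Proof. exact: (terms_le_of_sum_le (ler0n R 1600) (ler0n R m) b1_ge0 prod_ge last_ge TX). Qed.

Let Q1600 : 1600 <= Q. Proof. by case: horizon_bounds. Qed.
Let Qm : m%:R <= Q. Proof. by case: horizon_bounds. Qed.
Let Qb1 : b1 <= Q. Proof. by case: horizon_bounds. Qed.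
Let Qbs : (400 + bs) * (bs + 1) <= Q. Proof. by case: horizon_bounds. Qed.
Let QL : 27 * L / ln (1 + rho^-1) <= Q. Proof. by case: horizon_bounds. Qed.

Let Q0 : 0 < Q. Proof. by rewrite sqrtr_gt0 ltr0n. Qed.

Let NQ : N%:R <= Q / 400.
Proof.
have h := divr_ge0 (ltW Q0) (ler0n R 400).
by rewrite truncn_le.
Qed.

Let QN : Q / 800 <= N%:R.
Proof.
have : Q / 400 < N%:R + 1.
  by rewrite natr1; have /andP[] := truncn_itv (divr_ge0 (ltW Q0) (ler0n R 400)).
by move: Q1600; move: Q (N%:R) => a b; lra.
Qed.

Let NT : (N * m <= T)%N.
Proof.
rewrite -(ler_nat R) natrM -(sqr_sqrtr (ler0n R T)) expr2.
apply: ler_pM => //; apply: (le_trans NQ).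
by move: Q0; move: Q => a; lra.
Qed.

Lemma cyc_block_le :
  avg_eqparts s (fun P => omd_regret K (block_mirror s K P) (std_step K s s x1 T) T
    (fun t => dot (cg t)) x1) <= spiked_const R * L * Q.
Proof.
apply: (le_trans (spiked_block_regret_le m1 rho20 rho4 NT T0 s3 sr s2d)).
have h : N%:R * m%:R * (std_step K s s x1 T / block_modulus s) <= L * Q.
  rewrite drift_scaleE.
  apply: (@le_trans _ _ (1 * Q)); last by rewrite ler_wpM2r ?(ltW Q0)//; apply: le_trans L100; rewrite ler1n.
  have mR : 1 <= m%:R :> R by rewrite ler1n.
  have d0 := drift_scale_ge0 sd.
  have Nd : N%:R * (drift_scale s / Q) <= drift_scale s.
    have -> : N%:R * (drift_scale s / Q) = drift_scale s * (N%:R / Q) by ring.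
    rewrite ler_piMr// ler_pdivrMr// mul1r; apply: (le_trans NQ).
    by move: Q0; move: Q => a; lra.
  have : drift_scale s * m%:R <= Q.
    apply: le_trans Qbs.
    apply: (@le_trans _ _ bs).
      rewrite mulrC expr2 -mulrA ler_wpM2l// ler_peMl//.
    by move: bs_ge0; move: bs => b; nra.
  rewrite mul1r => h; apply: le_trans h.
  have -> : N%:R * m%:R * (drift_scale s / Q) = N%:R * (drift_scale s / Q) * m%:R by ring.
  by rewrite ler_wpM2r.
have lsL : ln s%:R <= L.
  rewrite LE ler_ln ?posrE ?ltr0n// ler_nat.
  by case/andP: sd.
have e0 : 0 <= 12 * (1 + expR 6) :> R by rewrite mulr_ge0 ?addr_ge0 ?expR_ge0.
have h2 : 12 * (1 + expR 6) * ln s%:R * Q <= 12 * (1 + expR 6) * L * Q.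
  by rewrite ler_wpM2r ?(ltW Q0)// ler_wpM2l.
apply: (le_trans (lerD h2 h)).
by rewrite /spiked_const -[leRHS]mulrA [leRHS]mulrDl mul1r !mulrA.
Qed.

Lemma cyc_block_gt0 :
  0 < avg_eqparts s (fun P => omd_regret K (block_mirror s K P) (std_step K s s x1 T) T
    (fun t => dot (cg t)) x1).
Proof.
have [K0 K0N [K0b K0Q]] := initial_cycles bs_ge0 Qbs.
apply: (spiked_regret_gt0 m1 rho20 rho4 NT T0 s3 sd K0N).
  rewrite drift_scaleE.
  have -> : m%:R ^+ 2 * K0%:R * (drift_scale s / Q) = K0%:R * bs / Q by ring.
  rewrite ler_pdivrMr// mul1r; apply: le_trans K0Q.
  by apply: ler_wpM2l; rewrite ?ler0n// lerDr ler0n.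
rewrite drift_scaleE; apply: le_lt_trans K0b.
have -> : N%:R * (m%:R ^+ 2 * (drift_scale s / Q)) = bs * (N%:R / Q) by ring.
apply: ler_piMr; first exact: bs_ge0.
rewrite ler_pdivrMr// mul1r; apply: (le_trans NQ).
by move: Q0; move: Q => a; lra.
Qed.

Lemma cyc_euc_ge : rho * Q / (20 * 800) <=
  avg_eqparts 1 (fun P => omd_regret K (block_mirror 1 K P) (std_step K 1 s x1 T) T
    (fun t => dot (cg t)) x1).
Proof.
have z0 : 0 <= m%:R ^+ 2 * (drift_scale 1 / Q).
  apply: mulr_ge0; first exact: sqr_ge0.
  exact: (divr_ge0 (drift_scale_ge0 nd1) (ltW Q0)).
have z1 : m%:R ^+ 2 * (drift_scale 1 / Q) <= 1.
  by rewrite mulrA ler_pdivrMr// mul1r.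
apply: (le_trans (euc_gain_ge z1 rho20 QN (ltW Q0))).
apply: (spiked_euc_regret_ge m1 rho20 rho4 NT T0 s3 (esym (drift_scaleE 1 T))).
exact: (euc_step_small (ltW (std_step_gt0 nd1 dom s0 T0))
  (spiked_euc_step_le m1 rho20 rho4 T0 s3 rs s2d) (ler0n R N) NQ z0 z1 rho20 Q0).
Qed.

Lemma cyc_full_ge : rho * Q / (20 * 800) <=
  avg_eqparts d (fun P => omd_regret K (block_mirror d K P) (std_step K d s x1 T) T
    (fun t => dot (cg t)) x1).
Proof.
apply: (le_trans (full_gain_ge (ltW rho0) QN (ltW Q0))).
apply: (spiked_full_regret_ge m1 rho20 rho4 NT T0 s3 LE).
  by rewrite ler_pdivrMr // [leRHS]mulrC -ler_pdivrMr.
exact: (le_trans (growth_budget L100 NQ Q0) rhoL).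
Qed.

End Horizon.
End SpikedPart.

(** * The separation over the spiked simplex *)

Section SpikedInstance.
Context {R : realType}.
Variables (m : nat) (rho : R).
Hypotheses (m1 : (1 < m)%N) (rho2 : 2 <= rho).
Local Notation K := (spiked_simplex (d := m.+1) rho).

Definition spiked_instance (N T : nat) : oco_instance K T :=
  linear_instance T (cyc_grad (R := R) (ltnW m1) N) (dom_start (half_start_domain m1 rho2)).

Lemma E_regret_block_spiked N T n s : E_regret_block n s (spiked_instance N T) =
  (avg_eqparts n (fun P => omd_regret K (block_mirror n K P)
    (std_step K n s (half_start m) T) T
    (fun t => dot (cyc_grad (R := R) (ltnW m1) N t)) (half_start m)))%:E.
Proof. exact: E_regret_block_linear. Qed.

Lemma spiked_sparse N T s : (0 < s)%N -> sparse_losses s (spiked_instance N T).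
Proof.
move=> s0; apply: (sparse_losses_linear (C := fun t => [set cyc_idx (ltnW m1) t]%SET)).
- by move=> t; rewrite cards1.
- move=> t i; rewrite /cyc_grad; case: ifP => _; rewrite !mxE; last by lra.
  by case: (i == _); rewrite /=; lra.
- move=> t i; rewrite inE => /negPf it; rewrite /cyc_grad; case: ifP => _; rewrite !mxE //.
  by rewrite it andbF oppr0.
Qed.

End SpikedInstance.

Lemma spiked_part (R : realType) (d : nat) : (100 : R) <= ln d%:R ->
  exists T0 : nat, forall T : nat, (T0 <= T)%N ->
    let s := Num.truncn (Num.sqrt (d%:R : R)) in
     exists I : oco_instance (K_mix R d) T,
       [/\ sparse_losses s I,
           [/\ integrable_regret_euc s I, integrable_regret_block d s I
             & integrable_regret_block s s I],
           (0 < E_regret_block s s I)%E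
         & (((20 * 800 * spiked_const R)^-1 * (d%:R `^ (1 / 4) / ln d%:R))%:E
              * E_regret_block s s I
            <= Order.min (E_regret_euc s I) (E_regret_block d s I))%E].
Proof.
move=> L100.
have d0 : (0 < d)%N.
  by case: d L100 => //; rewrite ln0// => h; exfalso; lra.
rewrite K_mixE//.
have rho4 := quarter_powE R d.
have rhoE : d%:R `^ (1 / 4) = expR (ln d%:R / 4) :> R.
  by rewrite /powR pnatr_eq0 (gtn_eqF d0); congr expR; field.
case: d d0 L100 rho4 rhoE => // m _; set rho := _ `^ (1 / 4) => L100 rho4 rhoE.
set L := ln _ in L100 rhoE *.
have C0 : 0 < spiked_const R by rewrite /spiked_const; have := expR_gt0 (6 : R); lra.
have L0 : 0 < L by lra.
have c0 : 0 <= 20 * 800 :> R by lra.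
have rho25 : 26 <= rho.
  by rewrite rhoE; apply: le_trans (expR_ge1Dx _); lra.
have rho0 : 0 < rho by lra.
have rhoL : L / 8 <= ln (rho / 2).
  have l2 : ln 2 <= 1 :> R by apply: (@le_trans _ _ (ln (1 + 1))) => //; apply: le_ln1Dx; lra.
  by rewrite ln_div ?posrE// rhoE expRK; lra.
have sqE : Num.sqrt m.+1%:R = rho ^+ 2 :> R.
  have -> : m.+1%:R = (rho ^+ 2) ^+ 2 by rewrite -exprM rho4.
  by rewrite sqrtr_sqr ger0_norm// sqr_ge0.
rewrite sqE; set s := Num.truncn _.
have /andP[sr rs1] := truncn_itv (sqr_ge0 rho); rewrite -/s -natr1 in sr rs1.
have r2 : 26 * rho <= rho ^+ 2 by rewrite expr2 ler_wpM2r// ltW.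
have s3 : (3 <= s)%N by rewrite -(ler_nat R); lra.
have s0 : (0 < s)%N by apply: leq_trans s3.
have rs : rho ^+ 2 <= 4 * s%:R by lra.
have s2d : (2 * s <= m.+1)%N.
  rewrite -(ler_nat R) natrM -rho4 -[4%N]/(2 * 2)%N exprM [leRHS]expr2.
  by apply: ler_pM => //; lra.
have m1 : (1 < m)%N by rewrite -ltnS; apply: leq_trans s2d; rewrite mul2n -addnn; apply: (leq_add s0 (ltnW s3)).
have rho20 : 20 <= rho by lra.
have rho2 : 2 <= rho by lra.
have [T0 HT] := exists_sqrt_ge (horizon_scale m s rho L).
exists T0 => T /HT[T1 TX] /=.
have Hup := cyc_block_le m1 rho20 rho4 s3 sr s2d erefl L100 T1 TX.
have Hgt := cyc_block_gt0 m1 rho20 rho4 s3 s2d L100 T1 TX.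
have Heuc := cyc_euc_ge m1 rho20 rho4 s3 rs s2d L100 T1 TX.
have Hfull := cyc_full_ge m1 rho20 rho4 s3 s2d erefl L100 rhoL T1 TX.
exists (spiked_instance m1 rho2 (n_cycles (R := R) T) T); split.
- exact: spiked_sparse.
- by split; exact: integrable_regret_block_linear.
- by rewrite E_regret_block_spiked lte_fin; exact: Hgt.
rewrite /E_regret_euc !E_regret_block_spiked -EFin_min -EFinM lee_fin.
set A := avg_eqparts s _ in Hup Hgt *.
have main : (20 * 800 * spiked_const R)^-1 * (rho / L) * A <= rho * Num.sqrt T%:R / (20 * 800).
  have -> : rho * Num.sqrt T%:R / (20 * 800) = (20 * 800 * spiked_const R)^-1 * (rho / L) *
     (spiked_const R * L * Num.sqrt T%:R).
    by field; rewrite !gt_eqF.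
  apply: ler_wpM2l; last exact: Hup.
  apply: mulr_ge0; last exact: divr_ge0 (ltW rho0) (ltW L0).
  by rewrite invr_ge0; exact: mulr_ge0 c0 (ltW C0).
rewrite le_min; apply/andP; split; first exact: le_trans main Heuc.
exact: le_trans main Hfull.
Qed.

(** * Both separations *)

Lemma improvement_weaken (R : realType) (c1 c2 a : R) (x y : \bar R) :
  c1 <= c2 -> 0 <= a -> (0 <= x)%E ->
  ((c2 * a)%:E * x <= y)%E -> ((c1 * a)%:E * x <= y)%E.
Proof.
move=> c12 a0 x0; apply: le_trans; apply: lee_wpmul2r => //.
by rewrite lee_fin; apply: ler_wpM2r.
Qed.

Theorem theorem2 (R : realType) :
  exists (c : R) (d0 : nat), 0 < c /\
  forall d : nat, (d0 <= d)%N ->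
  exists T0 : nat, forall T : nat, (T0 <= T)%N ->
    (let s := Num.truncn (Num.sqrt (d%:R : R)) in
     exists I : oco_instance (K_mix R d) T,
       [/\ sparse_losses s I,
           [/\ integrable_regret_euc s I, integrable_regret_block d s I
             & integrable_regret_block s s I],
           (0 < E_regret_block s s I)%E
         & ((c * (d%:R `^ (1 / 4) / ln d%:R))%:E * E_regret_block s s I
            <= Order.min (E_regret_euc s I) (E_regret_block d s I))%E])
    /\
    (let s := Num.truncn (ln (d%:R : R)) in
     exists I : oco_instance (simplex R d) T,
       [/\ (forall i, 0 < start I 0 i), sparse_losses s I,
           [/\ integrable_regret_euc s I, integrable_regret_ent I
             & integrable_regret_block s s I],
           (0 < E_regret_block s s I)%E
         & ((c * (Num.sqrt (ln d%:R) / ln (ln d%:R)))%:E * E_regret_block s s I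
            <= Order.min (E_regret_euc s I) (E_regret_ent I))%E]).
Proof.
have [d0 Hd] := exists_ln_ge (100 : R).
have e6 := expR_gt0 (6 : R).
have cS : 0 < (20 * 800 * spiked_const R)^-1 by rewrite invr_gt0 /spiked_const; lra.
have cV : 0 < (128 * simplex_const : R)^-1 by rewrite invr_gt0 /simplex_const; lra.
pose c := Num.min (20 * 800 * spiked_const R)^-1 (128 * simplex_const)^-1.
exists c, d0; split; first by rewrite lt_min cS.
move=> d /Hd L100.
have [TS HS] := spiked_part L100.
have L4 : 4 <= ln (d%:R : R) by lra.
have [TV HV] := simplex_part L4.
exists (TS + TV)%N => T TT; split => s.
  have [I [sI iI E0 EI]] := HS T (leq_trans (leq_addr _ _) TT).
  exists I; split=> //; apply: improvement_weaken EI.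
  - by rewrite ge_min lexx.
  - by apply: divr_ge0; [exact: powR_ge0|lra].
  - exact: ltW.
have [I [x0 sI iI E0 EI]] := HV T (leq_trans (leq_addl _ _) TT).
exists I; split=> //; apply: improvement_weaken EI.
- by rewrite ge_min lexx orbT.
- by apply: divr_ge0; [exact: sqrtr_ge0|apply: ln_ge0; lra].
- exact: ltW.
Qed.
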